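(* Let $(X,S)$ be a minimal subshift over a finite alphabet which is an almost 1-1 extension, via $\pi:X\to H$, of the odometer $H=\varprojlim\mathbb{Z}/n_t\mathbb{Z}$ (with $n_t\mid n_{t+1}$). If $$\lim_{t\to\infty}\frac{\delta(E^t)}{\varphi(n_t)}=0,$$ where $\varphi$ is the Euler totient function, then $(X,S)$ satisfies a PNT.
   Context: A topological dynamical system $(X,T)$ satisfies a prime number theorem (PNT) if for every $y\in X$ and every $f\in C(X)$ the limit $\lim_{N\to\infty}\frac{1}{\pi(N)}\sum_{p<N}f(T^py)$ exists, where $p$ runs over primes and $\pi(N)$ is the number of primes up to $N$. $S$ is the left shift on $\mathcal{A}^{\mathbb{Z}}$, $\mathcal{A}$ a finite alphabet; a subshift is a closed $S$-invariant subset $X\subset\mathcal{A}^{\mathbb{Z}}$ with $S$ restricted to it. The odometer $H=\varprojlim\mathbb{Z}/n_t\mathbb{Z}$ carries the translation $T h=h+(1,1,\ldots)$. $(X,S)$ is an almost 1-1 extension of $(H,T)$ via $\pi$ if $\pi:X\to H$ is a continuous surjection with $\pi\circ S=T\circ\pi$ and there is $h\in H$ with $|\pi^{-1}(h)|=1$. (The class of such minimal subshifts coincides with the class of Toeplitz subshifts.) For $t\ge0$ and $0\le j<n_t$ let $D^t_j=\{h\in H:h_t=j\}$ and $E^t_j=\pi^{-1}(D^t_j)$. Put $\delta(E^t)=\sum_{0\le j<n_t}\operatorname{diam}(E^t_j)$, the diameter being taken with respect to the metric $d(y,z)=2^{-\inf\{|n|:y(n)\neq z(n)\}}$ (with $d(y,y)=0$).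 *)

(* Defs.v *)
From HB Require Import structures.
From mathcomp Require Import all_boot all_order all_algebra.
From mathcomp Require Import complex.
From mathcomp Require Import all_classical all_reals all_analysis.

Set Implicit Arguments.
Unset Strict Implicit.
Unset Printing Implicit Defensive.

Import Order.TTheory GRing.Theory Num.Theory.
Import numFieldNormedType.Exports.

Local Open Scope classical_set_scope.
Local Open Scope ring_scope.

(* A dynamical system is given by an ambient space M, a total map T : M -> M
   and a T-invariant set X carrying the subspace topology. *)
Section TopologicalDynamics.

Definition is_subsystem (M : topologicalType) (T : M -> M) (X : set M) : Prop :=
  closed X /\ T @` X = X.

Definition minimal_subsystem (M : topologicalType) (T : M -> M) (X : set M) :
    Prop :=
  [/\ is_subsystem T X, X !=set0 &
      forall Y : set M, is_subsystem T Y -> Y !=set0 -> Y `<=` X -> Y = X].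

Definition almost_1_1_extension (M N : topologicalType)
    (T : M -> M) (X : set M) (U : N -> N) (H : set N) (pi : M -> N) : Prop :=
  [/\ {within X, continuous pi},
      pi @` X = H,
      forall x, X x -> pi (T x) = U (pi x) &
      exists2 h, H h & exists x, X `&` pi @^-1` [set h] = [set x]].

Definition prime_counting (N : nat) : nat := count prime (iota 0 N.+1).

(* K is the field of values of the functions of C(X). *)
Definition satisfies_PNT (K : numFieldType) (M : topologicalType)
    (T : M -> M) (X : set M) : Prop :=
  forall (y : M) (f : M -> K), X y -> {within X, continuous f} ->
    cvgn (fun N : nat =>
      (\sum_(0 <= p < N | prime p) f (iter p T y)) / (prime_counting N)%:R).

Definition diam (R : realType) (M : Type) (d : M -> M -> R) (E : set M) : R :=
  sup [set d yz.1 yz.2 | yz in E `*` E].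

End TopologicalDynamics.

Section FullShift.
Variable A : finType.

Definition full_shift := prod_topology (fun _ : int => discrete_topology A).
HB.instance Definition _ := Topological.on full_shift.

Definition left_shift (y : full_shift) : full_shift := fun n => y (n + 1).

Definition shift_dist (R : realType) (y z : full_shift) : R :=
  if `[< y = z >] then 0
  else 2 `^ (- inf [set (`|n|%N)%:R | n in [set n : int | y n <> z n]]).

End FullShift.

(* The inverse limit of the Z/n_t, with residue classes represented by
   their representatives 0 <= h_t < n_t. *)
Section Odometer.
Variable n : nat -> nat.

Definition odometer_space := prod_topology (fun _ : nat => nat).
HB.instance Definition _ := Topological.on odometer_space.

Definition odometer : set odometer_space :=
  [set h | forall t, (h t < n t)%N /\ h t.+1 = h t %[mod n t]].

Definition odometer_map (h : odometer_space) : odometer_space :=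
  fun t => ((h t + 1) %% n t)%N.

Definition odometer_cyl (t j : nat) : set odometer_space :=
  odometer `&` [set h | h t = j].

Variables (A : finType) (X : set (full_shift A)).
Variable pi : full_shift A -> odometer_space.

Definition tower_level (t j : nat) : set (full_shift A) :=
  X `&` pi @^-1` odometer_cyl t j.

Definition tower_diam (R : realType) (t : nat) : R :=
  \sum_(0 <= j < n t) diam (@shift_dist A R) (tower_level t j).

End Odometer.

(* Main.v *)
(* The orbit of a point visits the tower levels [E^t_j] periodically with period
   [n_t], and all but few of the levels are so small that a continuous function
   is nearly constant on them: at most [2^m delta(E^t)] levels have diameter
   [>= 2^-m]. Averages along primes are therefore governed, up to an error that
   is controlled by [delta(E^t) / phi(n_t)], by averages of [n_t]-periodic
   functions, which converge by the prime number theorem in arithmetic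
   progressions.

   The latter is proved by elementary means and without complex characters.
   Selberg's formula in the Tatuzawa-Iseki form, applied to all classes coprime
   to [q] simultaneously, bounds the Moebius sum [M_a(N)] over a class [a] by a
   logarithmic average of all [M_c(n) / n] (Postnikov-Romanov). Since
   [sum_n M_c(n) / n^2] is bounded, [M_c(n)] must be small on a positive
   proportion of each long interval, and iterating the inequality gives
   [M_a(N) = o(N)]. The boundedness rests on Dirichlet's theorem
   [sum_n v(c n) / n != 0] for some [c], for each nonzero [q]-periodic
   zero-mean [v] supported on the classes coprime to [q]: a counterexample is
   shown to be a multiple of a real character [eps], for which [1 * eps >= 0]
   gives a contradiction. *)
Require Import Defs.
From HB Require Import structures.
From mathcomp Require Import all_boot all_order all_algebra.
From mathcomp Require Import complex cyclic.
From mathcomp Require Import all_classical all_reals all_analysis.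
From mathcomp Require Import zify ring lra.

Set Implicit Arguments.
Unset Strict Implicit.
Unset Printing Implicit Defensive.

Import Order.TTheory GRing.Theory Num.Theory.
Import numFieldNormedType.Exports.

Local Open Scope classical_set_scope.
Local Open Scope ring_scope.

(* [lra] unfolds [n.+1%:R] below an inverse, so such inverses are abstracted. *)
Ltac abstract_inv T U o n :=
  match n with context [?v] => is_var v end;
  let y := fresh "iv" in
  set (y := @GRing.inv T (@GRing.natmul U o (S n))) in *; clearbody y.
Ltac lrai :=
  repeat match goal with
  | |- context [@GRing.inv ?T (@GRing.natmul ?U ?o (S ?n))] => abstract_inv T U o n
  | H : context [@GRing.inv ?T (@GRing.natmul ?U ?o (S ?n))] |- _ => abstract_inv T U o n
  end; lra.

(** For each precision a single [t] is fixed before [N] tends to infinity, so that primes are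
    counted modulo one fixed [q]. They equidistribute over the [phi(q)] coprime classes only, and in
    the worst case all wide levels lie over such classes: hence the comparison of [delta] with
    [phi(n_t)]. The values found for different [t] are not compared with each other; the averages
    are shown to be Cauchy.

    The place of characters is taken by the action of the units on periodic functions through
    [dilate]. Estimates therefore have to hold for a function and all its dilates with one constant,
    and L-values are studied as functions [c |-> Lser (dilate c v)].

    The Postnikov-Romanov inequality is neutral: from [|M_c(n)| <= b n] for all [c] it returns the
    same [b] up to lower order terms. The gain has to come from blocks where [M_c] is small, and its
    size depends only on a lower bound for [b], so finitely many rounds reach any prescribed level.
    Nonvanishing serves to bound the sums of [mu(n) g(n) / n]. *)

Lemma perm_divisors N k : (0 < k <= N)%N ->
  perm_eq (divisors k) [seq d <- index_iota 1 N.+1 | (d %| k)%N].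
Proof.
move=> /andP[k0 kN]; apply: uniq_perm; first exact: divisors_uniq.
  by rewrite filter_uniq// iota_uniq.
move=> d; rewrite mem_filter -dvdn_divisors// mem_index_iota.
case: (boolP (d %| k)%N) => //= dk.
by rewrite (dvdn_gt0 k0 dk) ltnS (leq_trans (dvdn_leq k0 dk) kN).
Qed.

Lemma perm_multiples N d : (0 < d)%N ->
  perm_eq [seq k <- index_iota 1 N.+1 | (d %| k)%N]
          [seq (d * n)%N | n <- index_iota 1 (N %/ d).+1].
Proof.
move=> d0; apply: uniq_perm; first by rewrite filter_uniq// iota_uniq.
  rewrite map_inj_in_uniq ?iota_uniq// => x y _ _ /eqP.
  by rewrite eqn_pmul2l// => /eqP.
move=> k; rewrite mem_filter mem_index_iota; apply/idP/mapP.
  move=> /andP[/dvdnP[n ->{k}]] /andP[nd0]; rewrite ltnS => ndN.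
  exists n; last by rewrite mulnC.
  by rewrite mem_index_iota ltnS leq_divRL// ndN andbT; case: n nd0 {ndN}.
move=> [n]; rewrite mem_index_iota ltnS leq_divRL// => /andP[n0 ndN] ->.
by rewrite dvdn_mulr//= muln_gt0 d0 n0 ltnS mulnC.
Qed.

(** * Dirichlet convolution and elementary estimates *)

Section DirichletSums.
Variable V : nmodType.
Implicit Types (F : nat -> nat -> V) (G : nat -> V).

Lemma sum_divisors N k G : (0 < k <= N)%N ->
  \sum_(d <- divisors k) G d = \sum_(1 <= d < N.+1 | (d %| k)%N) G d.
Proof. by move=> kN; rewrite (perm_big _ (perm_divisors kN)) big_filter. Qed.

Lemma sum_codivisors k G : (0 < k)%N ->
  \sum_(d <- divisors k) G d = \sum_(d <- divisors k) G (k %/ d)%N.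
Proof.
move=> k0; have kkd d : (d %| k)%N -> (k %/ (k %/ d))%N = d.
  by move=> dk; rewrite divnA// mulKn.
rewrite -(big_map (fun d => k %/ d)%N predT G).
apply: perm_big; apply: uniq_perm; first exact: divisors_uniq.
  rewrite map_inj_in_uniq ?divisors_uniq// => x y.
  by rewrite -!dvdn_divisors// => xk yk xy; rewrite -(kkd x xk) xy kkd.
move=> e; apply/idP/mapP => [|[c]]; rewrite -!dvdn_divisors//.
  move=> ek; exists (k %/ e)%N; last by rewrite kkd.
  by rewrite -dvdn_divisors// dvdn_div.
by move=> ck ->; rewrite dvdn_div.
Qed.

Lemma sum_multiples N d G : (0 < d)%N ->
  \sum_(1 <= k < N.+1 | (d %| k)%N) G k =
  \sum_(1 <= n < (N %/ d).+1) G (d * n)%N.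
Proof.
by move=> d0; rewrite -big_filter (perm_big _ (perm_multiples N d0)) big_map.
Qed.

Lemma sum_hyperbola N F :
  \sum_(1 <= d < N.+1) \sum_(1 <= n < (N %/ d).+1) F d n =
  \sum_(1 <= k < N.+1) \sum_(d <- divisors k) F d (k %/ d)%N.
Proof.
have -> : \sum_(1 <= k < N.+1) \sum_(d <- divisors k) F d (k %/ d)%N =
   \sum_(1 <= k < N.+1) \sum_(1 <= d < N.+1 | (d %| k)%N) F d (k %/ d)%N.
  by apply: eq_big_nat => k /andP[k0 kN]; apply: sum_divisors; rewrite k0.
rewrite (exchange_big_dep_nat predT)//=; apply: eq_big_nat => d /andP[d0 _].
rewrite (sum_multiples N (fun k => F d (k %/ d)%N) d0).
by apply: eq_bigr => n _; rewrite mulKn.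
Qed.

(** Both sides run over the triples with [d * e * c = k]: this is associativity of Dirichlet
    convolution, for an arbitrary [F] so that it also serves for weights such as [eps (d * e)]. *)
Lemma sum_divisors_assoc k (F : nat -> nat -> nat -> V) : (0 < k)%N ->
  \sum_(a <- divisors k) \sum_(d <- divisors a) F d (a %/ d)%N (k %/ a)%N =
  \sum_(d <- divisors k) \sum_(e <- divisors (k %/ d))
     F d e (k %/ d %/ e)%N.
Proof.
move=> k0; have kk : (0 < k <= k)%N by rewrite k0 leqnn.
rewrite !(@sum_divisors k k)//.
have -> : \sum_(1 <= a < k.+1 | (a %| k)%N) \sum_(d <- divisors a)
     F d (a %/ d)%N (k %/ a)%N =
   \sum_(1 <= a < k.+1 | (a %| k)%N) \sum_(1 <= d < k.+1 | (d %| a)%N)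
     F d (a %/ d)%N (k %/ a)%N.
  rewrite [LHS]big_nat_cond [RHS]big_nat_cond; apply: eq_bigr => a.
  by move=> /andP[/andP[a0 ak] _]; apply: sum_divisors; rewrite a0.
rewrite (exchange_big_dep_nat [pred d | (d %| k)%N])/=; last first.
  by move=> a d _ _ ak da; exact: dvdn_trans da ak.
rewrite [LHS]big_nat_cond [RHS]big_nat_cond; apply: eq_bigr => d.
move=> /andP[/andP[d0 dk] ddk].
under eq_bigl do rewrite andbC.
rewrite big_mkcondr/=.
rewrite (sum_multiples k (fun a => if (a %| k)%N then
  F d (a %/ d)%N (k %/ a)%N else 0) d0).
rewrite (@sum_divisors (k %/ d) (k %/ d)); last first.
  by rewrite leqnn divn_gt0// -ltnS dk.
rewrite [RHS]big_mkcond/=; apply: eq_bigr => e _.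
by rewrite mulKn// divnMA -{1}(divnK ddk) mulnC dvdn_pmul2r.
Qed.

End DirichletSums.

(** * Divisor sums of the Moebius and von Mangoldt functions *)

Section ArithmeticFunctions.
Variable R : realType.
Implicit Types (f g h : nat -> R) (N : nat).

(** A prime of exponent above 1 contributes the factor 0. At 0 the value is 1, since [primes 0] is
    empty; all sums start at 1. *)
Definition mobius (n : nat) : R :=
  \prod_(p <- primes n) (if logn p n == 1%N then -1 else 0).

Definition mangoldt (n : nat) : R :=
  if primes n is [:: p] then ln p%:R else 0.

Local Notation mu := mobius.
Local Notation Lam := mangoldt.

Lemma mobius1 : mu 1 = 1. Proof. by rewrite /mu big_nil. Qed.

Lemma normr_mobius n : `|mu n| <= 1.
Proof.
rewrite /mu; elim: (primes n) => [|p s IH]; first by rewrite big_nil normr1.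
rewrite big_cons normrM mulr_ile1//.
by case: ifP => _; rewrite ?normrN ?normr1 ?normr0.
Qed.

Lemma mobius_int n : mu n \is a Num.int.
Proof.
rewrite /mu; apply: rpred_prod => p _.
by case: ifP => _; rewrite ?rpredN ?rpred1 ?rpred0.
Qed.

Lemma mobiusM_prime p d : prime p -> (0 < d)%N ->
  mu (p * d) = if (p %| d)%N then 0 else - mu d.
Proof.
move=> pp d0; have p0 := prime_gt0 pp.
case: ifPn => pd.
  rewrite /mu (big_rem p)/=; last by rewrite mem_primes pp muln_gt0 p0 d0 dvdn_mulr.
  rewrite ifF ?mul0r//; apply/negbTE; rewrite lognM// logn_prime// eqxx add1n.
  by rewrite eqSS -lt0n logn_gt0 mem_primes pp d0.
rewrite /mu (perm_big (p :: primes d)); last first.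
  apply: uniq_perm; first exact: primes_uniq.
    by rewrite /= primes_uniq mem_primes (negbTE pd) !andbF.
  by move=> q; rewrite primesM// primes_prime// !inE.
rewrite big_cons lognM// logn_prime// eqxx (_ : logn p d = 0)%N; last first.
  by apply/eqP; rewrite eqn0Ngt logn_gt0 mem_primes (negbTE pd) !andbF.
rewrite addn0 eqxx/= mulN1r; congr (- _); rewrite !big_seq; apply: eq_bigr => q.
rewrite mem_primes => /and3P[qp _ qd]; rewrite lognM// logn_prime//.
by case: (eqVneq q p) => [qE|_]; [rewrite -qE qd in pd|rewrite add0n].
Qed.

(** Fix a prime [p] dividing [n]. The divisors that are multiples of [p] are [p * d] with [d]
    dividing [n %/ p]; those prime to [p] also divide [n %/ p]. By [mobiusM_prime] the two sums
    cancel term by term. *)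
Lemma sum_mobius n : (0 < n)%N ->
  \sum_(d <- divisors n) mu d = (n == 1%N)%:R.
Proof.
case: n => [//|[_|n0 _]]; first by rewrite /divisors/= big_seq1 mobius1.
set n := n0.+2; rewrite [RHS](_ : _ = 0)//.
have n1 : (1 < n)%N by [].
have [p pp pn] := pdivP n1; have p0 := prime_gt0 pp.
have np0 : (0 < n %/ p)%N by rewrite divn_gt0// dvdn_leq.
rewrite (bigID (fun d => (p %| d)%N))/=.
have -> : \sum_(d <- divisors n | (p %| d)%N) mu d =
          \sum_(d <- divisors (n %/ p)) mu (p * d).
  rewrite -big_filter -(big_map (fun d => p * d)%N predT mu).
  apply: perm_big; apply: uniq_perm; first by rewrite filter_uniq// divisors_uniq.
    rewrite map_inj_in_uniq ?divisors_uniq// => x y _ _ /eqP.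
    by rewrite eqn_pmul2l// => /eqP.
  move=> d; rewrite mem_filter -dvdn_divisors//; apply/andP/mapP.
    move=> [/dvdnP[e ->] epn]; exists e; last by rewrite mulnC.
    by rewrite -dvdn_divisors// dvdn_divRL.
  move=> [e]; rewrite -dvdn_divisors// => en ->; split; first exact: dvdn_mulr.
  by rewrite mulnC -dvdn_divRL.
have -> : \sum_(d <- divisors n | ~~ (p %| d)%N) mu d =
          \sum_(d <- divisors (n %/ p) | ~~ (p %| d)%N) mu d.
  rewrite -[LHS]big_filter -[RHS]big_filter.
  apply: perm_big; apply: uniq_perm; try by rewrite filter_uniq// divisors_uniq.
  move=> d; rewrite !mem_filter -!dvdn_divisors//.
  case: (boolP (p %| d)%N) => //= pd; rewrite -{1}(divnK pn) Gauss_dvdl//.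
  by rewrite coprime_sym prime_coprime.
rewrite [X in _ + X]big_mkcond -big_split/= big_seq big1// => d.
rewrite -dvdn_divisors// => dn; rewrite mobiusM_prime// ?(dvdn_gt0 np0 dn)//.
by case: ifP => _ /=; rewrite ?addr0 ?addNr.
Qed.

Lemma mangoldt_ge0 n : 0 <= Lam n.
Proof.
rewrite /Lam; case: (primes n) (@mem_primes ^~ n) => [|p [|//]] // mp.
have := mp p; rewrite inE eqxx => /esym/and3P[pp _ _].
by apply: ln_ge0; rewrite ler1n prime_gt0.
Qed.

Lemma mangoldt_prime p : prime p -> Lam p = ln p%:R.
Proof. by move=> pp; rewrite /Lam primes_prime. Qed.

Lemma mangoldt1 : Lam 1 = 0. Proof. by []. Qed.

Lemma ln_prod_primes n : (0 < n)%N ->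
  ln n%:R = \sum_(p <- primes n) (logn p n)%:R * ln p%:R :> R.
Proof.
move=> n0; rewrite [in LHS](prod_prime_decomp n0) prime_decompE big_map/=.
have : all prime (primes n) by exact: all_prime_primes.
elim: (primes n) => [|p s IH]/=; first by rewrite !big_nil ln1.
move=> /andP[pp sp]; rewrite !big_cons natrM lnM ?posrE; last 2 first.
- by rewrite ltr0n expn_gt0 prime_gt0.
- rewrite ltr0n big_seq; by elim/big_ind : _ => // x y x0 y0; rewrite muln_gt0 x0.
by rewrite IH// natrX lnXn ?ltr0n ?prime_gt0// mulr_natl.
Qed.

(** The divisors of [n] with single prime factor [p] are [p ^ j] for [1 <= j <= logn p n], so their
    contributions reproduce the prime factorisation of [n]. *)
Lemma sum_mangoldt n : (0 < n)%N ->
  \sum_(d <- divisors n) Lam d = ln n%:R.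
Proof.
move=> n0; rewrite ln_prod_primes//.
have -> : \sum_(d <- divisors n) Lam d = \sum_(d <- divisors n)
    \sum_(p <- primes n) (if primes d == [:: p] then ln p%:R else 0).
  rewrite !big_seq; apply: eq_bigr => d; rewrite -dvdn_divisors// => dn.
  rewrite /Lam; case E : (primes d) => [|p [|q s]].
  - by rewrite big1.
  - rewrite (bigD1_seq p) ?primes_uniq//=; last first.
      have : p \in primes d by rewrite E inE.
      rewrite !mem_primes => /and3P[-> _ pd]; rewrite n0 (dvdn_trans pd dn)//.
    by rewrite eqxx big1 ?addr0// => q qp; rewrite eqseq_cons andbT eq_sym (negbTE qp).
  - by rewrite big1// => r _; rewrite eqseq_cons andbF.
rewrite exchange_big/=; rewrite !big_seq; apply: eq_bigr => p.
rewrite mem_primes => /and3P[pp _ pn].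
rewrite -big_mkcond/= -big_filter.
rewrite (perm_big [seq (p ^ j)%N | j <- iota 1 (logn p n)]) /=.
  by rewrite big_map big_const_seq count_predT size_iota iter_addr_0 mulr_natl.
apply: uniq_perm; first by rewrite filter_uniq// divisors_uniq.
  rewrite map_inj_in_uniq ?iota_uniq// => x y _ _ /eqP.
  by rewrite eqn_exp2l ?prime_gt1// => /eqP.
move=> d; rewrite mem_filter -dvdn_divisors//; apply/andP/mapP.
  move=> [/eqP pE dn]; have d0 := dvdn_gt0 n0 dn.
  have dE : d = (p ^ logn p d)%N.
    by rewrite {1}(prod_prime_decomp d0) prime_decompE pE big_seq1.
  exists (logn p d) => //; rewrite mem_iota add1n ltnS dvdn_leq_log// andbT.
  by rewrite logn_gt0 pE inE.
move=> [j]; rewrite mem_iota add1n ltnS => /andP[j0 jl] ->.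
by rewrite primesX// primes_prime// pfactor_dvdn.
Qed.

(** Moebius inversion: [ln] is [mangoldt] convolved with 1, and convolving with [mobius] cancels the
    1. *)
Lemma sum_mobius_ln n : (0 < n)%N ->
  \sum_(d <- divisors n) mu d * ln (n %/ d)%:R = Lam n.
Proof.
move=> n0.
transitivity (\sum_(d <- divisors n) \sum_(e <- divisors (n %/ d)%N)
   mu d * Lam e).
  rewrite !big_seq; apply: eq_bigr => d; rewrite -dvdn_divisors// => dn.
  by rewrite -sum_mangoldt ?mulr_sumr// divn_gt0 ?(dvdn_gt0 n0 dn)// dvdn_leq.
have H := sum_divisors_assoc (fun d e c : nat => mu d * Lam c) n0.
have -> : \sum_(d <- divisors n) \sum_(e <- divisors (n %/ d)) mu d * Lam e =
    \sum_(d <- divisors n) \sum_(e <- divisors (n %/ d))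
      mu d * Lam (n %/ d %/ e)%N.
  rewrite !big_seq; apply: eq_bigr => d; rewrite -dvdn_divisors// => dn.
  have nd0 : (0 < n %/ d)%N by rewrite divn_gt0 ?(dvdn_gt0 n0 dn)// dvdn_leq.
  exact: sum_codivisors.
rewrite -H.
transitivity (\sum_(a <- divisors n) (a == 1%N)%:R * Lam (n %/ a)%N).
  rewrite !big_seq; apply: eq_bigr => a; rewrite -dvdn_divisors// => an.
  by rewrite -mulr_suml sum_mobius// (dvdn_gt0 n0 an).
rewrite (bigD1_seq 1%N) ?divisors_uniq ?divisor1//= mul1r divn1 big1 ?addr0//.
by move=> a /negbTE ->; rewrite mul0r.
Qed.

End ArithmeticFunctions.

(** * Logarithms, harmonic sums and summation by parts *)

Section Estimates.
Variable R : realType.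
Implicit Types (a f g : nat -> R) (N : nat).

Lemma natr_gt0 n : (0 < n)%N -> 0 < n%:R :> R.
Proof. by rewrite ltr0n. Qed.

Lemma natr_ge1 n : (0 < n)%N -> 1 <= n%:R :> R.
Proof. by rewrite ler1n. Qed.

Lemma lnn_ge0 n : 0 <= ln n%:R :> R.
Proof. by case: n => [|n]; [rewrite ln0|rewrite ln_ge0// ler1n]. Qed.

Lemma lnn_le m n : (m <= n)%N -> ln m%:R <= ln n%:R :> R.
Proof.
case: m => [|m] mn; first by rewrite ln0// lnn_ge0.
by rewrite ler_ln ?posrE ?ltr0n ?ler_nat// (leq_trans _ mn).
Qed.

Lemma lnnM m n : (0 < m)%N -> (0 < n)%N ->
  ln (m * n)%:R = ln m%:R + ln n%:R :> R.
Proof. by move=> m0 n0; rewrite natrM lnM ?posrE ?ltr0n. Qed.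

Lemma ln_sub_le (x y : R) : 0 < x -> 0 < y -> ln y - ln x <= (y - x) / x.
Proof.
move=> x0 y0; rewrite -ln_div ?posrE//.
have -> : y / x = 1 + (y - x) / x by field; rewrite gt_eqF.
by apply: le_ln1Dx; rewrite mulrBl divff ?gt_eqF// ltrBrDr addNr divr_gt0.
Qed.

Lemma ln_le_sub1 (x : R) : 0 < x -> ln x <= x - 1.
Proof. by move=> x0; have := ln_sub_le ltr01 x0; rewrite ln1 subr0 divr1. Qed.

Lemma lnS_le n : (0 < n)%N -> ln n.+1%:R - ln n%:R <= n%:R^-1 :> R.
Proof.
move=> n0; have := ln_sub_le (natr_gt0 n0) (natr_gt0 (ltn0Sn n)).
by rewrite -(natr1 n) addrAC subrr add0r div1r.
Qed.

Lemma lnS_ge n : (0 < n)%N -> n.+1%:R^-1 <= ln n.+1%:R - ln n%:R :> R.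
Proof.
move=> n0; have := ln_sub_le (natr_gt0 (ltn0Sn n)) (natr_gt0 n0).
by rewrite -(natr1 n) opprD addrA subrr add0r mulN1r => H; lra.
Qed.

Lemma sum_ln N : (0 < N)%N ->
  N%:R * ln N%:R - N%:R <= \sum_(1 <= k < N.+1) ln k%:R :> R /\
  \sum_(1 <= k < N.+1) ln k%:R <= N%:R * ln N%:R - N%:R + 1 + ln N%:R :> R.
Proof.
elim: N => // -[_ _|N IH _]; first by rewrite big_nat1 ln1; split; lra.
have [IH1 IH2] := IH isT; rewrite big_nat_recr//=.
have n0 : (0 < N.+1)%N by [].
have := lnS_le n0; have := lnS_ge n0.
set l' := ln N.+2%:R; set l := ln N.+1%:R in IH1 IH2 *.
rewrite -[N.+2%:R]natr1; have x0 := natr_gt0 n0 => H1 H2; split.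
  have : N.+1%:R * (l' - l) <= 1 by rewrite -ler_pdivlMl// mulr1.
  by lra.
have : 1 <= (N.+1%:R + 1) * (l' - l) by rewrite -ler_pdivrMl ?addr_gt0// mulr1.
by lra.
Qed.

(** Replacing [N] by a larger real [Y] costs [N (ln Y - ln N) <= Y - N], so the bound stays [Y]. It
    is applied with quotients [N / K] that need not be integers. *)
Lemma sum_ln_div (Y : R) N : N%:R <= Y ->
  \sum_(1 <= k < N.+1) ln (Y / k%:R) <= Y.
Proof.
case: N => [|N] NY; first by rewrite big_nil.
have x0 : 0 < N.+1%:R :> R by rewrite ltr0n.
have Y0 : 0 < Y by exact: lt_le_trans NY.
have -> : \sum_(1 <= k < N.+2) ln (Y / k%:R) =
    N.+1%:R * ln Y - \sum_(1 <= k < N.+2) ln k%:R.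
  rewrite mulr_natl -[N.+1 in RHS]/(N.+2 - 1)%N -sumr_const_nat -sumrB.
  by apply: eq_big_nat => k /andP[k0 _]; rewrite ln_div ?posrE ?ltr0n.
have [H _] := sum_ln (ltn0Sn N).
have := ln_sub_le x0 Y0; rewrite ler_pdivlMr// => ?; lra.
Qed.

Lemma Abel_sum g a N :
  \sum_(1 <= k < N.+1) g k * a k =
  (\sum_(1 <= k < N.+1) g k) * a N.+1 +
  \sum_(1 <= k < N.+1) (\sum_(1 <= j < k.+1) g j) * (a k - a k.+1).
Proof.
elim: N => [|N IH]; first by rewrite !big_nil; ring.
rewrite big_nat_recr//= IH [in RHS]big_nat_recr//= [X in _ = _ + X]big_nat_recr//=.
rewrite [X in _ = _ + (_ + X * _)]big_nat_recr//=; ring.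
Qed.

Lemma norm_Abel_sum g a N (B : R) :
  (forall n, `|\sum_(1 <= k < n.+1) g k| <= B) ->
  `|\sum_(1 <= k < N.+1) g k * a k| <=
    B * (`|a N.+1| + \sum_(1 <= k < N.+1) `|a k - a k.+1|).
Proof.
move=> gB; rewrite Abel_sum (le_trans (ler_normD _ _))// mulrDr lerD//.
  by rewrite normrM ler_wpM2r.
rewrite (le_trans (ler_norm_sum _ _ _))// mulr_sumr ler_sum// => k _.
by rewrite normrM ler_wpM2r.
Qed.

Lemma telescope_sumrN a N :
  \sum_(1 <= k < N.+1) (a k - a k.+1) = a 1%N - a N.+1.
Proof.
rewrite -[RHS]opprB -telescope_sumr// -sumrN.
by apply: eq_bigr => k _; rewrite opprB.
Qed.

Lemma invM_succ n : (0 < n)%N ->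
  (n%:R * n.+1%:R)^-1 = n%:R^-1 - n.+1%:R^-1 :> R.
Proof.
move=> n0; have x0 := natr_gt0 n0; rewrite -natr1; field.
by rewrite gt_eqF ?addr_gt0// gt_eqF.
Qed.

(** Since [C / (k (k + 1))] telescopes, the partial sums minus [C / (N + 1)] increase and the
    partial sums plus [C / (N + 1)] decrease. The supremum of the former is the limit, and the rate
    comes with it. *)
Lemma sum_inv_tail a (C : R) :
  (forall k, (0 < k)%N -> `|a k| <= C / (k%:R * k.+1%:R)) ->
  exists l : R, forall N, `|\sum_(1 <= k < N.+1) a k - l| <= C / N.+1%:R.
Proof.
move=> aC; pose u N := \sum_(1 <= k < N.+1) a k.
have uS N : u N.+1 = u N + a N.+1 by rewrite /u big_nat_recr.
have aCS N : `|a N.+1| <= C / N.+1%:R - C / N.+2%:R.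
  by apply: le_trans (aC _ _) _ => //; rewrite -mulrBr -invM_succ.
pose v N := u N - C / N.+1%:R; pose w N := u N + C / N.+1%:R.
have vS N : v N <= v N.+1.
  by rewrite /v uS; have := aCS N; rewrite ler_norml => /andP[H1 H2]; lrai.
have wS N : w N.+1 <= w N.
  by rewrite /w uS; have := aCS N; rewrite ler_norml => /andP[H1 H2]; lrai.
have vm : {homo v : m n / (m <= n)%N >-> m <= n} by apply: homo_leq => // x y z; apply: le_trans.
have wm : {homo w : m n / (m <= n)%N >-> n <= m}.
  by apply: homo_leq => // x y z; move=> /[swap]; apply: le_trans.
have C0 : 0 <= C.
  have := le_trans (normr_ge0 _) (aC 1%N isT); by rewrite pmulr_lge0// invr_gt0 ?mul1r ?ltr0n.
have vw m n : v m <= w n.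
  apply: (@le_trans _ _ (v (maxn m n))); first by rewrite vm// leq_maxl.
  apply: (@le_trans _ _ (w (maxn m n))); last by rewrite wm// leq_maxr.
  rewrite /v /w lerD2l; have : 0 <= C / (maxn m n).+1%:R by rewrite divr_ge0.
  by move=> ?; lrai.
have hs : has_sup (range v).
  by split; [exists (v 0%N); exists 0%N|exists (w 0%N) => _ [n _ <-]; exact: vw].
exists (sup (range v)) => N; rewrite ler_norml.
have H1 : v N <= sup (range v) by apply: sup_upper_bound => //; exists N.
have H2 : sup (range v) <= w N.
  by apply: sup_le_ub; [case: hs|move=> _ [n _ <-]; exact: vw].
by move: H1 H2; rewrite /v /w /u => H1 H2; apply/andP; split; lrai.
Qed.

Lemma sum_inv : exists gam : R, forall N, (0 < N)%N ->
  `|\sum_(1 <= k < N.+1) k%:R^-1 - ln N%:R - gam| <= 3 / N%:R.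
Proof.
have [k k0|l lP] := @sum_inv_tail (fun k => k%:R^-1 - (ln k.+1%:R - ln k%:R)) 1.
  have := lnS_le k0; have := lnS_ge k0 => H1 H2.
  rewrite div1r invM_succ//.
  by rewrite ger0_norm; lrai.
exists l => N N0; have := lP N; rewrite sumrB telescope_sumr// ln1 subr0.
have := lnS_le N0; have := lnS_ge N0.
have : N.+1%:R^-1 <= N%:R^-1 :> R by rewrite lef_pV2 ?posrE ?ltr0n// ler_nat.
have : 0 < N.+1%:R^-1 :> R by rewrite invr_gt0 ltr0n.
rewrite div1r !ler_norml => H1 H2 H3 H4 /andP[H5 H6].
by apply/andP; split; lrai.
Qed.

Lemma sum_inv_le N : \sum_(1 <= k < N.+1) k%:R^-1 <= 1 + ln N%:R :> R.
Proof.
elim: N => [|[|N] IH]; first by rewrite big_nil ln0// addr0.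
  by rewrite big_nat1 ln1 invr1 addr0.
by rewrite big_nat_recr//=; have := lnS_ge (ltn0Sn N) => ?; lrai.
Qed.

Lemma sum_sqrt_inv N : \sum_(1 <= k < N.+1) Num.sqrt k%:R^-1 <= 2 * Num.sqrt N%:R :> R.
Proof.
elim: N => [|N IH]; first by rewrite big_nil sqrtr0 mulr0.
rewrite big_nat_recr//=; apply: le_trans (lerD IH (lexx _)) _.
rewrite sqrtrV//.
have s0 : 0 < Num.sqrt N.+1%:R :> R by rewrite sqrtr_gt0 ltr0n.
have t0 : 0 <= Num.sqrt N%:R :> R by rewrite sqrtr_ge0.
have sE : Num.sqrt N.+1%:R ^+ 2 = N.+1%:R :> R by rewrite sqr_sqrtr.
have tE : Num.sqrt N%:R ^+ 2 = N%:R :> R by rewrite sqr_sqrtr.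
move: s0 t0 sE tE; move: (Num.sqrt N.+1%:R) (Num.sqrt N%:R) => s t.
rewrite -natr1 => s0 t0 sE tE; rewrite -(ler_pM2r s0) mulrDl mulVf ?gt_eqF//.
by have := sqr_ge0 (s - t); nra.
Qed.

(** With [x = t ^ 4] the tangent bound gives [ln x <= 4 (t - 1)], hence [1 + ln x <= 4 t]. *)
Lemma ln_sqrt_bound (x : R) : 1 <= x -> (1 + ln x) ^+ 2 <= 16 * Num.sqrt x.
Proof.
move=> x1; have x0 : 0 < x by lra.
set s := Num.sqrt x; set t := Num.sqrt s.
have s0 : 0 < s by rewrite sqrtr_gt0.
have t0 : 0 < t by rewrite sqrtr_gt0.
have sE : s = t ^+ 2 by rewrite sqr_sqrtr// ltW.
have xE : x = t ^+ 4 by rewrite -[4%N]/(2 * 2)%N exprM -sE sqr_sqrtr// ltW.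
have : ln x <= 4 * (t - 1).
  by rewrite xE lnXn//; have := ln_le_sub1 t0 => ?; lra.
have := ln_ge0 x1; rewrite sE => H1 H2.
have : 1 + ln x <= 4 * t by lra.
by move=> H3; nra.
Qed.

(** One logarithm will come from the weight [ln (N / d)], the other from a remainder that is
    logarithmic in [N / d]. That their product still sums to [O(N)] makes the error in Selberg's
    formula linear. *)
Lemma sum_ln_sqr N : \sum_(1 <= k < N.+1) (1 + ln (N%:R / k%:R)) ^+ 2 <= 32 * N%:R :> R.
Proof.
apply: (@le_trans _ _ (\sum_(1 <= k < N.+1) 16 * (Num.sqrt N%:R * Num.sqrt k%:R^-1))).
  apply: ler_sum_nat => k /andP[k0 kN].
  rewrite -sqrtrM//; apply: ln_sqrt_bound.
  by rewrite ler_pdivlMr ?ltr0n// mul1r ler_nat.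
rewrite -!mulr_sumr; have := sum_sqrt_inv N.
have := sqr_sqrtr (ler0n R N); have := sqrtr_ge0 (N%:R : R).
by move: (Num.sqrt N%:R) (\sum_(_ <= _ < _) _) => s S; nra.
Qed.

Lemma ln_divn N d : (0 < d <= N)%N ->
  0 <= ln (N%:R / d%:R : R) - ln (N %/ d)%:R <= (N %/ d)%:R^-1 .
Proof.
move=> /andP[d0 dN]; have N0 := leq_trans d0 dN.
have Y0 : 0 < (N %/ d)%:R :> R by rewrite ltr0n divn_gt0.
have y0 : 0 < N%:R / d%:R :> R by rewrite divr_gt0// ltr0n.
have Yy : (N %/ d)%:R <= N%:R / d%:R :> R.
  by rewrite ler_pdivlMr ?ltr0n// -natrM ler_nat leq_divM.
have yY : N%:R / d%:R <= (N %/ d)%:R + 1 :> R.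
  by rewrite ler_pdivrMr ?ltr0n// natr1 -natrM ler_nat ltnW// ltn_ceil.
apply/andP; split; first by rewrite subr_ge0 ler_ln.
apply: le_trans (ln_sub_le Y0 y0) _.
by rewrite ler_pdivrMr// mulVf ?gt_eqF//; lra.
Qed.

End Estimates.

Section DirichletConvolution.
Variable R : realType.
Local Notation mu := (@mobius R).
Local Notation Lam := (@mangoldt R).

Lemma sum_dirichlet (f h u g : nat -> R) N :
  (forall k, (0 < k)%N -> \sum_(d <- divisors k) f d * h (k %/ d)%N = u k) ->
  \sum_(1 <= k < N.+1) u k * g k =
  \sum_(1 <= d < N.+1) f d * \sum_(1 <= n < (N %/ d).+1) h n * g (d * n)%N.
Proof.
move=> fhu; have := sum_hyperbola N (fun d n => f d * (h n * g (d * n)%N)).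
under eq_bigr do rewrite -mulr_sumr.
move=> ->; apply: eq_big_nat => k /andP[k0 _].
rewrite -fhu// mulr_suml !big_seq; apply: eq_bigr => d.
by rewrite -dvdn_divisors// => dk; rewrite mulrA mulnC divnK.
Qed.

Lemma sum_dirichlet1 (f u g : nat -> R) N :
  (forall k, (0 < k)%N -> \sum_(d <- divisors k) f d = u k) ->
  \sum_(1 <= k < N.+1) u k * g k =
  \sum_(1 <= d < N.+1) f d * \sum_(1 <= n < (N %/ d).+1) g (d * n)%N.
Proof.
move=> fu; rewrite (@sum_dirichlet f (fun=> 1) u).
  by apply: eq_bigr => d _; congr (_ * _); apply: eq_bigr => n _; rewrite mul1r.
by move=> k k0; rewrite -fu//; apply: eq_bigr => d _; rewrite mulr1.
Qed.

Lemma sum_delta1 (g : nat -> R) N : (0 < N)%N ->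
  \sum_(1 <= k < N.+1) (k == 1%N)%:R * g k = g 1%N.
Proof.
move=> N0; rewrite (bigD1_seq 1%N) ?iota_uniq ?mem_index_iota//= mul1r big1 ?addr0//.
by move=> k /negbTE ->; rewrite mul0r.
Qed.

(** Write [ln d = ln k - ln (k %/ d)]; the part with [ln k] vanishes, by [sum_mobius] for [k > 1]
    and by [ln 1 = 0] for [k = 1]. *)
Lemma sum_mobius_ln_self k : (0 < k)%N ->
  \sum_(d <- divisors k) mu d * ln d%:R = - Lam k.
Proof.
move=> k0; rewrite -sum_mobius_ln// -sumrN.
have : \sum_(d <- divisors k) mu d * ln k%:R = 0.
  rewrite -mulr_suml sum_mobius//; case: eqP => [->|]; last by rewrite mul0r.
  by rewrite ln1 mulr0.
move=> H; rewrite -[LHS]subr0 -[X in _ - X]H -sumrB !big_seq.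
apply: eq_bigr => d; rewrite -dvdn_divisors// => dk.
have -> : ln k%:R = ln (k %/ d)%:R + ln d%:R :> R.
  rewrite -{1}(divnK dk) lnnM// ?(dvdn_gt0 k0 dk)//.
  by rewrite divn_gt0 ?(dvdn_gt0 k0 dk)// dvdn_leq.
by ring.
Qed.

(** By [sum_mobius_ln_self], convolving [d |-> mu d * ln d] with 1 gives [- Lam]; convolving once
    more with [mu] removes the 1. *)
Lemma sum_mangoldt_mobius k : (0 < k)%N ->
  \sum_(d <- divisors k) Lam d * mu (k %/ d)%N = - (mu k * ln k%:R).
Proof.
move=> k0.
have := sum_divisors_assoc (fun d e c : nat => mu d * ln d%:R * mu c) k0.
have -> : \sum_(a <- divisors k) \sum_(d <- divisors a)
     mu d * ln d%:R * mu (k %/ a)%N =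
   - \sum_(d <- divisors k) Lam d * mu (k %/ d)%N.
  rewrite -sumrN !big_seq; apply: eq_bigr => a; rewrite -dvdn_divisors// => ak.
  by rewrite -mulr_suml sum_mobius_ln_self ?(dvdn_gt0 k0 ak)// mulNr.
move=> /(congr1 -%R); rewrite opprK => ->; congr (- _).
rewrite (bigD1_seq k) ?divisors_uniq ?divisors_id//=.
rewrite divnn k0 -mulr_sumr -sum_codivisors// sum_mobius// mulr1 big_seq_cond big1 ?addr0//.
move=> d; rewrite -dvdn_divisors// => /andP[dk dnk].
have d0 := dvdn_gt0 k0 dk.
have kd0 : (0 < k %/ d)%N by rewrite divn_gt0// dvdn_leq.
rewrite -mulr_sumr -(sum_codivisors mu kd0) sum_mobius//.
rewrite (_ : (k %/ d == 1)%N = false) ?mulr0//.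
by apply: contra_neqF dnk => /eqP kd; rewrite -[RHS](divnK dk) kd mul1n.
Qed.

(** The Tatuzawa-Iseki weight: besides [Lam], its divisor sums see only [k = 1], with the factor
    [ln y]. *)
Lemma sum_mobius_ln_div (y : R) k : (0 < k)%N -> 0 < y ->
  \sum_(d <- divisors k) mu d * ln (y / d%:R) = (k == 1%N)%:R * ln y + Lam k.
Proof.
move=> k0 y0; rewrite -sum_mobius// mulr_suml -[Lam k]opprK -sum_mobius_ln_self//.
rewrite -sumrB !big_seq; apply: eq_bigr => d; rewrite -dvdn_divisors// => dk.
have d0 := dvdn_gt0 k0 dk.
by rewrite ln_div ?posrE ?ltr0n// mulrBr.
Qed.

End DirichletConvolution.

(** * Periodic functions and Selberg's formula *)

Section PeriodicFunctions.
Variables (R : realType) (q : nat).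
Hypothesis q_gt0 : (0 < q)%N.
Implicit Types (g h : nat -> R) (b : R).

Definition periodic g := forall n, g (n %% q)%N = g n.
(** Together with [periodic] this describes the functions on the unit group modulo [q], extended by
    0. *)
Definition coprime_supported g := forall n, ~~ coprime q n -> g n = 0.
(** For [c] coprime to [q], translation by [c] on the unit group: the indicator of the class [a]
    becomes that of [a / c]. Any other [c] annihilates the functions supported on units. *)
Definition dilate c g : nat -> R := fun n => g (c * n)%N.
Definition total g : R := \sum_(0 <= r < q) g r.
Definition coprime_ind n : R := (coprime q n)%:R.
Definition class_ind (a n : nat) : R := (n == a %[mod q])%:R.

Lemma q_ge1 : 1 <= q%:R :> R. Proof. by rewrite ler1n. Qed.
Lemma qr_gt0 : 0 < q%:R :> R. Proof. by rewrite ltr0n. Qed.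

Lemma coprime_eqmodl c m n : coprime q c ->
  (c * m == c * n %[mod q])%N = (m == n %[mod q])%N.
Proof.
move=> cq; wlog mn : m n / (n <= m)%N.
  move=> H; case: (leqP n m) => [|/ltnW] /H//.
  by rewrite eq_sym => ->; rewrite eq_sym.
by rewrite !eqn_mod_dvd ?leq_mul// -mulnBr Gauss_dvdr.
Qed.

Lemma periodic_dilate c g : periodic g -> periodic (dilate c g).
Proof. by move=> gp n; rewrite /dilate -gp modnMmr gp. Qed.

Lemma supported_dilate c g :
  coprime_supported g -> coprime_supported (dilate c g).
Proof.
by move=> gs n nq; apply: gs; rewrite coprimeMr (negbTE nq) andbF.
Qed.

Lemma dilate_dilate c d g : dilate c (dilate d g) = dilate (d * c) g.
Proof. by apply/funext => n; rewrite /dilate mulnA. Qed.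

Lemma dilate_not_coprime c g : coprime_supported g -> ~~ coprime q c ->
  dilate c g = fun=> 0.
Proof.
move=> gs cq; apply/funext => n; apply: gs.
by rewrite coprimeMr (negbTE cq).
Qed.

Lemma dilate_modn c g : periodic g -> dilate (c %% q) g = dilate c g.
Proof.
by move=> gp; apply/funext => n; rewrite /dilate -gp modnMml gp.
Qed.

Lemma periodic_cst (x : R) : periodic (fun=> x). Proof. by []. Qed.

Lemma periodic_coprime_ind : periodic coprime_ind.
Proof. by move=> n; rewrite /coprime_ind coprime_modr. Qed.

Lemma supported_coprime_ind : coprime_supported coprime_ind.
Proof. by move=> n /negbTE; rewrite /coprime_ind => ->. Qed.

Lemma coprime_indM m n : coprime_ind (m * n) = coprime_ind m * coprime_ind n.
Proof. by rewrite /coprime_ind coprimeMr -mulnb natrM. Qed.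

Lemma periodic_class_ind a : periodic (class_ind a).
Proof. by move=> n; rewrite /class_ind modn_mod. Qed.

Lemma supported_class_ind a : coprime q a -> coprime_supported (class_ind a).
Proof.
move=> aq n; rewrite /class_ind; case: eqP => //= na.
by rewrite -coprime_modr na coprime_modr aq.
Qed.

Lemma total_coprime_ind : total coprime_ind = (totient q)%:R.
Proof.
rewrite totient_count_coprime natr_sum.
by apply: eq_bigr => i _.
Qed.

Lemma total_class_ind a : total (class_ind a) = 1.
Proof.
rewrite /total (bigD1_seq (a %% q)%N) ?iota_uniq//=; last first.
  by rewrite mem_index_iota ltn_mod.
rewrite /class_ind modn_mod eqxx big_seq_cond big1 ?addr0// => r.
rewrite mem_index_iota => /andP[/= rq ra].
by rewrite (modn_small rq) (negbTE ra).
Qed.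

Lemma total_dilate c g : periodic g -> coprime q c -> total (dilate c g) = total g.
Proof.
move=> gp cq; rewrite /total !big_mkord.
pose p (i : 'I_q) : 'I_q := Ordinal (ltn_pmod (c * i) q_gt0).
have pinj : injective p.
  move=> i j /(congr1 val)/= /eqP; rewrite coprime_eqmodl// => /eqP.
  by rewrite !modn_small// => /val_inj.
rewrite [RHS](reindex_inj pinj); apply: eq_bigr => i _.
by rewrite /dilate /= gp.
Qed.

Lemma norm_total g b : (forall n, `|g n| <= b) -> `|total g| <= q%:R * b.
Proof.
move=> gb; apply: le_trans (ler_norm_sum _ _ _) _.
apply: le_trans (ler_sum _ (fun i _ => gb i)) _.
by rewrite sumr_const_nat subn0 mulr_natl.
Qed.

Lemma periodic_bounded g : periodic g -> exists2 b : R, 0 <= b & forall n, `|g n| <= b.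
Proof.
move=> gp; exists (\sum_(0 <= r < q) `|g r|); first by rewrite sumr_ge0.
move=> n; rewrite -gp (bigD1_seq (n %% q)%N) ?iota_uniq//=; last first.
  by rewrite mem_index_iota ltn_mod.
by rewrite lerDl sumr_ge0.
Qed.

Lemma total_sub_mean g : total (fun n => g n - total g / q%:R) = 0.
Proof.
rewrite {1}/total sumrB sumr_const_nat subn0 -[_ *+ q]mulr_natr divfK ?subrr//.
by rewrite gt_eqF// qr_gt0.
Qed.

Lemma class_expansion g n : periodic g ->
  g n = \sum_(0 <= r < q) g r * class_ind r n.
Proof.
move=> gp.
rewrite (bigD1_seq (n %% q)%N) ?iota_uniq//=; last by rewrite mem_index_iota ltn_mod.
rewrite /class_ind modn_mod eqxx mulr1 gp big_seq_cond big1 ?addr0// => r.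
rewrite mem_index_iota => /andP[/= rq nr].
by rewrite (modn_small rq) eq_sym (negbTE nr) mulr0.
Qed.

Lemma sum_zero_mean g b N : periodic g -> total g = 0 ->
  (forall n, `|g n| <= b) ->
  `|\sum_(1 <= k < N.+1) g k| <= 2 * q%:R * b.
Proof.
move=> gp g0 gb; have b0 : 0 <= b := le_trans (normr_ge0 _) (gb 0%N).
have qP m : \sum_(0 <= k < m * q) g k = 0.
  elim: m => [|m IH]; first by rewrite big_nil.
  rewrite mulSn addnC (big_cat_nat _ (leq_addr q (m * q)))//= IH add0r.
  rewrite -{1}[(m * q)%N]add0n big_addn addnC addnK -[RHS]g0.
  by apply: eq_bigr => i _; rewrite -gp addnC modnMDl gp.
have bound M : `|\sum_(0 <= k < M) g k| <= q%:R * b.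
  rewrite (divn_eq M q) (big_cat_nat _ (leq_addr (M %% q) (M %/ q * q)))//= qP add0r.
  apply: le_trans (ler_norm_sum _ _ _) _.
  apply: le_trans (ler_sum _ (fun i _ => gb i)) _.
  rewrite sumr_const_nat addKn -[b *+ _]mulr_natl ler_wpM2r// ler_nat.
  by rewrite ltnW// ltn_mod.
(* Full periods start at 0 and the sum at 1: removing [g 0] costs another [b], whence the factor
   2. *)
have := bound N.+1; rewrite big_nat_recl// => H.
have -> : \sum_(1 <= k < N.+1) g k = (g 0%N + \sum_(0 <= k < N) g k.+1) - g 0%N.
  by rewrite big_add1 /= addrC addKr.
apply: le_trans (ler_normB _ _) _.
by have := gb 0%N; have := q_ge1; nra.
Qed.

Lemma sum_periodic g b N : periodic g -> (forall n, `|g n| <= b) ->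
  `|\sum_(1 <= k < N.+1) g k - total g / q%:R * N%:R| <= 4 * q%:R * b.
Proof.
move=> gp gb; pose h n := g n - total g / q%:R.
have hp : periodic h by move=> n; rewrite /h gp.
have h0 : total h = 0 := total_sub_mean g.
have hb n : `|h n| <= 2 * b.
  apply: le_trans (ler_normB _ _) _; have := gb n.
  have := norm_total gb; rewrite normrM normfV (ger0_norm (ler0n _ q)) => H1 H2.
  have : `|total g| / q%:R <= b by rewrite ler_pdivrMr ?qr_gt0// mulrC.
  by lra.
have := sum_zero_mean N hp h0 hb.
rewrite sumrB sumr_const_nat subn1/= -[_ *+ N]mulr_natr; lra.
Qed.

End PeriodicFunctions.

(** * Partial sums of periodic functions and Dirichlet series at 1 *)

Section PeriodicSums.
Variables (R : realType) (q : nat).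
Hypothesis q_gt0 : (0 < q)%N.
Implicit Types (g h : nat -> R) (b l C : R).

Lemma le0_of_inv_bound (x C : R) : (forall N : nat, x <= C / N.+1%:R) -> x <= 0.
Proof.
move=> xC; rewrite leNgt; apply/negP => x0.
have C0 : 0 <= C / x.
  by rewrite divr_ge0 ?(ltW x0)//; have := xC 0%N; rewrite divr1; lra.
have := archi_boundP C0; set M := Num.bound _ => CM.
have := xC M; rewrite ler_pdivlMr ?ltr0n//.
move: CM; rewrite ltr_pdivrMr// -natr1 => CM; nra.
Qed.

Lemma inv_limit_unique (u : nat -> R) (l l' C C' : R) :
  (forall N, `|u N - l| <= C / N.+1%:R) ->
  (forall N, `|u N - l'| <= C' / N.+1%:R) -> l = l'.
Proof.
move=> ul ul'; apply/eqP; rewrite -subr_eq0 -normr_le0.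
apply: (@le0_of_inv_bound _ (C + C')) => N; rewrite mulrDl.
have := ul N; have := ul' N; rewrite !ler_norml.
by move=> /andP[? ?] /andP[? ?]; apply/andP; split; lrai.
Qed.

Lemma zero_mean_inv_limit g b : periodic q g -> total q g = 0 ->
  (forall n, `|g n| <= b) ->
  exists l : R, forall N,
    `|\sum_(1 <= k < N.+1) g k * k%:R^-1 - l| <= 4 * q%:R * b / N.+1%:R.
Proof.
move=> gp g0 gb; pose G n := \sum_(1 <= j < n.+1) g j.
have GB n : `|G n| <= 2 * q%:R * b by exact: sum_zero_mean.
have [k k0|l lP] := @sum_inv_tail R (fun k => G k * (k%:R^-1 - k.+1%:R^-1))
    (2 * q%:R * b).
  rewrite -invM_succ// normrM ler_pM// ger0_norm// invr_ge0 -natrM ler0n//.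
exists l => N; rewrite Abel_sum.
have := lP N; rewrite /= -/(G N); set S := \sum_(_ <= _ < _) _ => HS.
have : `|G N * N.+1%:R^-1| <= 2 * q%:R * b / N.+1%:R.
  by rewrite normrM ler_pM// ger0_norm// invr_ge0.
move: HS; rewrite !ler_norml => /andP[? ?] /andP[? ?].
by apply/andP; split; lrai.
Qed.

(** The value at 1 of the Dirichlet series of [g]. The rate is part of the specification, so that
    uniqueness is [inv_limit_unique]. The default 0 is taken when no such limit exists; for periodic
    [g] of mean zero it exists. *)
Definition Lser g : R := xget 0 [set l : R | exists C : R, forall N,
  `|\sum_(1 <= k < N.+1) g k * k%:R^-1 - l| <= C / N.+1%:R].

Lemma Lser_eq g l C :
  (forall N, `|\sum_(1 <= k < N.+1) g k * k%:R^-1 - l| <= C / N.+1%:R) ->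
  Lser g = l.
Proof.
move=> gl; have : exists x, [set l : R | exists C : R, forall N,
  `|\sum_(1 <= k < N.+1) g k * k%:R^-1 - l| <= C / N.+1%:R] x.
  by exists l, C.
by move=> /(xgetPex 0)[C' gC']; exact: inv_limit_unique gC' gl.
Qed.

Lemma Lser_bound g b N : periodic q g -> total q g = 0 ->
  (forall n, `|g n| <= b) ->
  `|\sum_(1 <= k < N.+1) g k * k%:R^-1 - Lser g| <= 4 * q%:R * b / N.+1%:R.
Proof.
by move=> gp g0 gb; have [l lP] := zero_mean_inv_limit gp g0 gb; rewrite (Lser_eq lP).
Qed.

Lemma Lser0 : Lser (fun=> 0) = 0.
Proof.
apply: (@Lser_eq _ _ 0) => N.
by rewrite big1 ?subr0 ?normr0 ?mul0r// => k _; rewrite mul0r.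
Qed.

Lemma Lser_lin (x : R) g h : periodic q g -> total q g = 0 ->
  periodic q h -> total q h = 0 ->
  Lser (fun n => x * g n + h n) = x * Lser g + Lser h.
Proof.
move=> gp g0 hp h0.
have [b b0 gb] := periodic_bounded q_gt0 gp; have [c c0 hc] := periodic_bounded q_gt0 hp.
apply: (@Lser_eq _ _ (`|x| * (4 * q%:R * b) + 4 * q%:R * c)) => N.
have := Lser_bound N gp g0 gb; have := Lser_bound N hp h0 hc.
set S := \sum_(_ <= _ < _) _ => hS; set T := \sum_(_ <= _ < _) _ => gT.
have -> : \sum_(1 <= k < N.+1) (x * g k + h k) / k%:R = x * T + S.
  by rewrite /T mulr_sumr -big_split/=; apply: eq_bigr => k _; rewrite mulrDl mulrA.
rewrite opprD addrACA -mulrBr (le_trans (ler_normD _ _))// mulrDl lerD//.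
by rewrite normrM -[leRHS]mulrA ler_wpM2l.
Qed.

Lemma sum_periodic_inv g : periodic q g ->
  exists c : R, exists2 C : R, 0 <= C & forall N, (0 < N)%N ->
  `|\sum_(1 <= k < N.+1) g k * k%:R^-1 - total q g / q%:R * ln N%:R - c| <= C / N%:R.
Proof.
move=> gp; have [b b0 gb] := periodic_bounded q_gt0 gp.
pose s := total q g / q%:R; pose h n := g n - s.
have hp : periodic q h by move=> n; rewrite /h gp.
have h0 : total q h = 0 := total_sub_mean q_gt0 g.
have [c c0 hc] := periodic_bounded q_gt0 hp.
have [l lP] := zero_mean_inv_limit hp h0 hc; have [gam gamP] := sum_inv R.
exists (l + s * gam), (4 * q%:R * c + `|s| * 3).
  by rewrite addr_ge0 ?mulr_ge0.
move=> N N0.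
have -> : \sum_(1 <= k < N.+1) g k * k%:R^-1 =
   \sum_(1 <= k < N.+1) h k * k%:R^-1 + s * \sum_(1 <= k < N.+1) k%:R^-1.
  rewrite mulr_sumr -big_split/=; apply: eq_bigr => k _.
  by rewrite /h mulrBl subrK.
have := lP N; have := gamP N N0; rewrite -/s.
set S := \sum_(1 <= k < N.+1) k%:R^-1; set T := \sum_(1 <= k < N.+1) _ => H1 H2.
have -> : T + s * S - s * ln N%:R - (l + s * gam) =
   (T - l) + s * (S - ln N%:R - gam) by ring.
apply: le_trans (ler_normD _ _) _; rewrite mulrDl lerD//.
  apply: le_trans H2 _; rewrite ler_wpM2l ?mulr_ge0//.
  by rewrite lef_pV2 ?posrE ?ltr0n// ler_nat.
by rewrite normrM -[leRHS]mulrA ler_wpM2l.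
Qed.

Lemma sum_zero_mean_ln h b N : (0 < N)%N -> periodic q h -> total q h = 0 ->
  (forall n, `|h n| <= b) ->
  `|\sum_(1 <= k < N.+1) h k * ln k%:R| <= 4 * q%:R * b * (1 + ln N%:R).
Proof.
move=> N0 hp h0 hb; have b0 : 0 <= b := le_trans (normr_ge0 _) (hb 0%N).
have := @norm_Abel_sum R h (fun k => ln k%:R) N _ (fun n => sum_zero_mean q_gt0 n hp h0 hb).
have -> : \sum_(1 <= k < N.+1) `|ln k%:R - ln k.+1%:R| = ln N.+1%:R :> R.
  have := telescope_sumr (fun k => ln k%:R : R) (ltn0Sn N).
  rewrite ln1 subr0 => <-.
  apply: eq_bigr => k _; rewrite distrC ger0_norm// subr_ge0.
  exact: lnn_le.
rewrite (ger0_norm (lnn_ge0 _ _)) => /le_trans -> //.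
have := lnS_le R N0; have := natr_ge1 R N0 => N1.
have : N%:R^-1 <= 1 :> R by rewrite invf_le1// ltr0n.
move=> H1 H2; have H3 : ln N.+1%:R <= 1 + ln N%:R :> R by lra.
have : 0 <= 2 * q%:R * b by rewrite !mulr_ge0.
by nra.
Qed.

Lemma sum_periodic_ln g b N : (0 < N)%N -> periodic q g ->
  (forall n, `|g n| <= b) ->
  `|\sum_(1 <= k < N.+1) g k * ln k%:R -
     total q g / q%:R * (N%:R * ln N%:R - N%:R)| <= 9 * q%:R * b * (1 + ln N%:R).
Proof.
move=> N0 gp gb; have b0 : 0 <= b := le_trans (normr_ge0 _) (gb 0%N).
pose s := total q g / q%:R; pose h n := g n - s.
have hp : periodic q h by move=> n; rewrite /h gp.
have h0 : total q h = 0 := total_sub_mean q_gt0 g.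
have sb : `|s| <= b.
  have := norm_total q gb; rewrite normrM normfV (ger0_norm (ler0n _ q)).
  by rewrite ler_pdivrMr ?ltr0n// mulrC.
have hb n : `|h n| <= 2 * b.
  by apply: le_trans (ler_normB _ _) _; have := gb n; lra.
have := sum_zero_mean_ln N0 hp h0 hb; have [] := sum_ln R N0.
have -> : \sum_(1 <= k < N.+1) g k * ln k%:R =
   \sum_(1 <= k < N.+1) h k * ln k%:R + s * \sum_(1 <= k < N.+1) ln k%:R.
  rewrite mulr_sumr -big_split/=; apply: eq_bigr => k _.
  by rewrite /h mulrBl subrK.
rewrite -/s; set S := \sum_(1 <= k < N.+1) ln k%:R; set T := \sum_(1 <= k < N.+1) _.
move=> H1 H1' H2.
have -> : T + s * S - s * (N%:R * ln N%:R - N%:R) = T + s * (S - (N%:R * ln N%:R - N%:R)) by ring.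
apply: le_trans (ler_normD _ _) _; rewrite normrM.
have H3 : `|S - (N%:R * ln N%:R - N%:R)| <= 1 + ln N%:R by rewrite ger0_norm; lra.
have : `|s| * `|S - (N%:R * ln N%:R - N%:R)| <= b * (1 + ln N%:R) by rewrite ler_pM.
have q1 := q_ge1 R q_gt0; have l0 := lnn_ge0 R N.
have : b * (1 + ln N%:R) <= q%:R * (b * (1 + ln N%:R)).
  by rewrite ler_peMl// mulr_ge0// addr_ge0.
by lra.
Qed.

End PeriodicSums.

(** * Chebyshev's bound and Mertens' estimate *)

Section ChebyshevMertens.
Variables (R : realType).
Local Notation Lam := (@mangoldt R).

Definition psi (N : nat) : R := \sum_(1 <= n < N.+1) Lam n.

Lemma psi_ge0 N : 0 <= psi N.
Proof. by apply: sumr_ge0 => n _; exact: mangoldt_ge0. Qed.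

Lemma sum_ln_mangoldt N :
  \sum_(1 <= k < N.+1) ln k%:R = \sum_(1 <= d < N.+1) Lam d * (N %/ d)%:R.
Proof.
have := sum_dirichlet1 (fun=> 1) N (@sum_mangoldt R).
under eq_bigr do rewrite mulr1.
by move=> ->; apply: eq_bigr => d _; rewrite sumr_const_nat subn1.
Qed.

(** Chebyshev's argument: [ln N! - 2 ln h!] is the sum of [Lam d] times [N %/ d - 2 (h %/ d)], a
    coefficient that is never negative and is at least 1 for [h < d <= N]. *)
Lemma psi_half N : (1 < N)%N -> psi N - psi N./2 <= 4 * N%:R.
Proof.
move=> N1; set h := N./2.
have N0 : (0 < N)%N by exact: ltnW.
have h0 : (0 < h)%N by rewrite half_gt0.
have hN : (h <= N)%N by rewrite /h -divn2 leq_div.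
have -> : psi N - psi h = \sum_(h.+1 <= d < N.+1) Lam d.
  by rewrite /psi (@big_cat_nat _ _ _ h.+1 1 N.+1)//= addrAC subrr add0r.
have ext : \sum_(1 <= d < h.+1) Lam d * (h %/ d)%:R =
           \sum_(1 <= d < N.+1) Lam d * (h %/ d)%:R.
  rewrite [RHS](@big_cat_nat _ _ _ h.+1 1 N.+1)//= [X in _ = _ + X]big_nat.
  rewrite [X in _ = _ + X]big1 ?addr0// => d /andP[hd _].
  by rewrite divn_small// mulr0.
have : \sum_(h.+1 <= d < N.+1) Lam d <=
  \sum_(1 <= k < N.+1) ln k%:R - 2 * \sum_(1 <= k < h.+1) ln k%:R.
  rewrite !sum_ln_mangoldt ext mulr_sumr -sumrB.
  have pos d : (0 < d)%N -> (2 * (h %/ d) <= N %/ d)%N.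
    move=> d0; rewrite leq_divRL// -mulnA (leq_trans (leq_mul (leqnn 2) (leq_divM h d)))//.
    by rewrite /h mul2n -{2}(odd_double_half N) leq_addl.
  rewrite [leRHS](@big_cat_nat _ _ _ h.+1 1 N.+1)//=.
  (* The terms with [d <= h] are dropped, being nonnegative; those with [d > h] are compared one by
     one. *)
  have -> : forall x y z : R, 0 <= y -> x <= z -> x <= y + z by move=> *; lra.
  - by [].
  - rewrite big_nat sumr_ge0// => d /andP[d0 _].
    rewrite mulrCA -mulrBr mulr_ge0 ?mangoldt_ge0// subr_ge0 -natrM ler_nat.
    exact: pos.
  - apply: ler_sum_nat => d /andP[hd dN].
    rewrite (divn_small hd) mulr0 mulr0 subr0 ler_peMr ?mangoldt_ge0//.
    by rewrite ler1n divn_gt0// (leq_ltn_trans _ hd).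
have [_] := sum_ln R N0; have [+ _] := sum_ln R h0 => H1 H2 H3.
have hr := natr_gt0 R h0; have Nr := natr_gt0 R N0.
have := ln_sub_le hr Nr; rewrite ler_pdivlMr// => H4.
have H5 := ln_le_sub1 Nr.
have H6 : N%:R <= 2 * h%:R + 1 :> R.
  rewrite -natrM natr1 ler_nat.
  by have := odd_double_half N; rewrite -mul2n -/h; case: odd; lia.
have H7 : 2 * h%:R <= N%:R :> R.
  by rewrite -natrM ler_nat; have := odd_double_half N; rewrite -mul2n -/h; lia.
have H8 := lnn_ge0 R N; have h1 := natr_ge1 R h0.
have : 0 <= (2 * h%:R + 1 - N%:R) * ln N%:R :> R.
  by rewrite mulr_ge0// subr_ge0.
by lra.
Qed.

(** The constant solves [C = 4 + C / 2], as [psi_half] is applied along successive halvings. *)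
Lemma psi_le N : psi N <= 8 * N%:R.
Proof.
elim/ltn_ind: N => -[|[|N]] IH; first by rewrite /psi big_nil mulr0.
  by rewrite /psi big_nat1 mangoldt1 mulr1.
have := @psi_half N.+2 isT; have := IH N.+2./2 _.
have hN : (N.+2./2 < N.+2)%N by rewrite -divn2 ltn_Pdiv.
move=> /(_ hN) H1 H2.
have H7 : 2 * (N.+2./2)%:R <= N.+2%:R :> R.
  by rewrite -natrM ler_nat; have := odd_double_half N.+2; rewrite -mul2n; lia.
by lra.
Qed.

Variable q : nat.
Hypothesis q_gt0 : (0 < q)%N.
Local Notation cop := (@coprime_ind R q).

(** The sum of [cop k * ln k] is evaluated twice: by [sum_periodic_ln], and through [ln] as [Lam]
    convolved with 1, where [cop] factors by complete multiplicativity. Replacing each count of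
    coprime integers up to [N %/ d] by [(ph / q) N / d] costs [O(psi N) = O(N)]; then [N] is divided
    out. *)
Lemma mertens_coprime : exists2 C : R, 0 <= C & forall N, (0 < N)%N ->
  `|\sum_(1 <= n < N.+1) cop n * Lam n / n%:R - ln N%:R| <= C.
Proof.
pose ph : R := (totient q)%:R; have ph0 : 0 < ph by rewrite ltr0n totient_gt0.
have ph1 : 1 <= ph by rewrite ler1n totient_gt0.
have qr0 : 0 < q%:R :> R by rewrite ltr0n.
have copb n : `|cop n| <= 1.
  by rewrite /coprime_ind normr_nat lern1 leq_b1.
exists (q%:R / ph * (ph / q%:R + 18 * q%:R + 8 * (4 * q%:R + ph / q%:R))).
  have r0 : 0 <= ph / q%:R by rewrite divr_ge0// ltW.
  by rewrite mulr_ge0 ?divr_ge0 ?(ltW ph0)//; lra.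
move=> N N0; have Nr := natr_gt0 R N0; have N1 := natr_ge1 R N0.
have := sum_periodic_ln q_gt0 N0 (@periodic_coprime_ind R q) copb.
rewrite total_coprime_ind -/ph.
have -> : \sum_(1 <= k < N.+1) cop k * ln k%:R =
  \sum_(1 <= d < N.+1) Lam d * cop d * \sum_(1 <= n < (N %/ d).+1) cop n.
  under eq_bigr do rewrite mulrC.
  rewrite (sum_dirichlet1 _ _ (@sum_mangoldt R)); apply: eq_bigr => d _.
  by rewrite -mulrA; congr (_ * _); rewrite mulr_sumr; apply: eq_bigr => n _; rewrite coprime_indM.
set A := \sum_(1 <= d < N.+1) _ => HA.
pose S := \sum_(1 <= n < N.+1) cop n * Lam n / n%:R.
have HB : `|A - ph / q%:R * N%:R * S| <= (4 * q%:R + ph / q%:R) * psi N.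
  rewrite /A /S mulr_sumr -sumrB /psi mulr_sumr.
  apply: le_trans (ler_norm_sum _ _ _) _.
  apply: ler_sum_nat => d /andP[d0 dN].
  have dr := natr_gt0 R d0.
  have := sum_periodic q_gt0 (N %/ d) (@periodic_coprime_ind R q) copb.
  rewrite total_coprime_ind -/ph mulr1; set T := \sum_(_ <= _ < _) _ => HT.
  have -> : Lam d * cop d * T - ph / q%:R * N%:R * (cop d * Lam d / d%:R) =
     (Lam d * cop d) * ((T - ph / q%:R * (N %/ d)%:R) + ph / q%:R * ((N %/ d)%:R - N%:R / d%:R)).
    by ring.
  rewrite normrM mulrC ler_pM//; last first.
    by rewrite normrM (ger0_norm (mangoldt_ge0 _ _)) ler_piMr// mangoldt_ge0.
  apply: le_trans (ler_normD _ _) _; rewrite lerD//.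
  rewrite normrM ger0_norm ?divr_ge0 ?(ltW ph0) ?(ltW qr0)//.
  rewrite ler_piMr ?divr_ge0 ?(ltW ph0) ?(ltW qr0)//.
  have Yy : (N %/ d)%:R <= N%:R / d%:R :> R.
    by rewrite ler_pdivlMr// -natrM ler_nat leq_divM.
  have yY : N%:R / d%:R <= (N %/ d)%:R + 1 :> R.
    by rewrite ler_pdivrMr// natr1 -natrM ler_nat ltnW// ltn_ceil.
  by rewrite ler_norml; apply/andP; split; lra.
have HP := psi_le N; have Hl := ln_le_sub1 Nr.
have c0 : 0 <= 4 * q%:R + ph / q%:R.
  by rewrite addr_ge0 ?mulr_ge0 ?invr_ge0 ?(ltW ph0) ?(ltW qr0).
have : `|ph / q%:R * N%:R * (S - ln N%:R)| <=
   (ph / q%:R + 18 * q%:R + 8 * (4 * q%:R + ph / q%:R)) * N%:R.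
  have -> : ph / q%:R * N%:R * (S - ln N%:R) =
    (A - ph / q%:R * (N%:R * ln N%:R - N%:R)) - (A - ph / q%:R * N%:R * S) - ph / q%:R * N%:R by ring.
  apply: le_trans (ler_normB _ _) _; apply: le_trans (lerD (ler_normB _ _) (lexx _)) _.
  have -> : `|ph / q%:R * N%:R| = ph / q%:R * N%:R.
    by rewrite ger0_norm// !mulr_ge0 ?invr_ge0 ?(ltW ph0) ?(ltW qr0).
  have : (4 * q%:R + ph / q%:R) * psi N <= (4 * q%:R + ph / q%:R) * (8 * N%:R).
    by rewrite ler_wpM2l.
  have : q%:R * (1 + ln N%:R) <= q%:R * (2 * N%:R) :> R.
    by rewrite ler_pM2l//; lra.
  by lra.
rewrite normrM ger0_norm; last by rewrite !mulr_ge0 ?invr_ge0 ?(ltW ph0) ?(ltW qr0).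
have k0 : 0 < ph / q%:R by rewrite divr_gt0.
rewrite mulrAC ler_pM2r// => HH.
by rewrite -[q%:R / ph]invf_div ler_pdivlMl.
Qed.

End ChebyshevMertens.

(** * Selberg's formula, uniformly in the class function *)

Section Selberg.
Variables (R : realType) (q : nat).
Hypothesis q_gt0 : (0 < q)%N.
Local Notation mu := (@mobius R).
Local Notation Lam := (@mangoldt R).
Local Notation cop := (@coprime_ind R q).
Local Notation ph := ((totient q)%:R : R).
Implicit Types (g h : nat -> R).

Definition psi_of g (N : nat) : R := \sum_(1 <= n < N.+1) Lam n * g n.

(** The normalisation by 1 lets one constant in Selberg's formula serve [g] and all its dilates. *)
Definition class_fun g :=
  [/\ periodic q g, coprime_supported q g & forall n, `|g n| <= 1].

Lemma class_fun_dilate c g : class_fun g -> class_fun (dilate c g).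
Proof.
case=> gp gs gb; split; [exact: periodic_dilate|exact: supported_dilate|].
by move=> n; exact: gb.
Qed.

Lemma coprime_ind_le1 n : `|cop n| <= 1.
Proof. by rewrite /coprime_ind normr_nat lern1 leq_b1. Qed.

Lemma class_fun_class_ind a : coprime q a -> class_fun (class_ind R q a).
Proof.
split; [exact: periodic_class_ind|exact: supported_class_ind|].
by move=> n; rewrite /class_ind normr_nat lern1 leq_b1.
Qed.

Lemma totient_ge1 : 1 <= ph. Proof. by rewrite ler1n totient_gt0. Qed.
Lemma totientr_gt0 : 0 < ph. Proof. by rewrite ltr0n totient_gt0. Qed.

Lemma norm_total_div g : (forall n, `|g n| <= 1) -> `|total q g / ph| <= q%:R.
Proof.
move=> gb; rewrite normrM normfV (ger0_norm (ler0n _ _)).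
rewrite ler_pdivrMr ?totientr_gt0//; have := norm_total q gb.
have := totient_ge1; have := q_ge1 R q_gt0; nra.
Qed.

Lemma coprime_ind_mul g n m : coprime_supported q g ->
  cop n * g (n * m)%N = g (n * m)%N.
Proof.
move=> gs; rewrite /coprime_ind; case: (boolP (coprime q n)) => nq; first by rewrite mul1r.
by rewrite mul0r gs// coprimeMr (negbTE nq).
Qed.

(* Tatuzawa-Iseki: the constant [kap] makes the three main terms
   [y ln y], [y] and [ln y] cancel, for every [g] at once. *)
Lemma selberg_inner : exists kap : R, exists2 K : R, 0 <= K &
  forall g (y : R) Y, class_fun g -> (0 < Y)%N -> Y%:R <= y <= Y%:R + 1 ->
  `|\sum_(1 <= n < Y.+1) cop n * (psi_of (dilate n g) (Y %/ n) -
       total q g / ph * (y / n%:R - kap))| <= K * (1 + ln Y%:R).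
Proof.
have [c [C C0 cC]] := sum_periodic_inv q_gt0 (@periodic_coprime_ind R q).
have q0 : 0 < q%:R :> R by rewrite ltr0n.
have p0 := totientr_gt0.
have q1 := q_ge1 R q_gt0.
(* With [c] the constant term in the sum of [cop n / n], this is the value for which the terms
   linear in [y] cancel, see [kE]; those in [y ln y] cancel by [sE]. *)
pose kap : R := 1 + c * q%:R / ph.
exists kap; exists (9 * q%:R + q%:R * (2 * C) + q%:R * `|kap| * (4 * q%:R) + 1 + `|kap - 1|).
  by rewrite !addr_ge0 ?mulr_ge0 ?(ltW q0)// mulr_ge0.
move=> g y Y gc Y0 /andP[Yy yY]; have [gp gs gb] := gc.
have Yr := natr_gt0 R Y0; have Y1 := natr_ge1 R Y0; have lY := lnn_ge0 R Y.
have := cC Y Y0; rewrite total_coprime_ind.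
set I := \sum_(1 <= k < Y.+1) _ => HI.
have := sum_periodic q_gt0 Y (@periodic_coprime_ind R q) coprime_ind_le1.
rewrite total_coprime_ind; set J := \sum_(1 <= k < Y.+1) _ => HJ.
have := sum_periodic_ln q_gt0 Y0 gp gb.
pose s := total q g; rewrite -/s.
have -> : \sum_(1 <= k < Y.+1) g k * ln k%:R =
  \sum_(1 <= n < Y.+1) cop n * psi_of (dilate n g) (Y %/ n).
  have H k : (0 < k)%N -> \sum_(d <- divisors k) (fun=> 1) d * Lam (k %/ d)%N = ln k%:R.
    move=> k0; rewrite -sum_mangoldt// [RHS]sum_codivisors//.
    by apply: eq_bigr => d _; rewrite mul1r.
  under eq_bigr do rewrite mulrC.
  rewrite (@sum_dirichlet R (fun=> 1) Lam (fun k => ln k%:R) g Y H).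
  apply: eq_bigr => n _; rewrite mul1r /psi_of mulr_sumr.
  by apply: eq_bigr => m _; rewrite mulrCA /dilate coprime_ind_mul.
set P := \sum_(1 <= n < Y.+1) cop n * _ => HP.
have -> : \sum_(1 <= n < Y.+1) cop n * (psi_of (dilate n g) (Y %/ n) -
       s / ph * (y / n%:R - kap)) = P - s / ph * y * I + s / ph * kap * J.
  rewrite /P /I /J mulr_sumr mulr_sumr -sumrB -big_split/=.
  by apply: eq_bigr => n _; ring.
have sE : s / ph * (ph / q%:R) = s / q%:R.
  by field; rewrite !gt_eqF.
have sb : `|s / q%:R| <= 1.
  rewrite normrM normfV (ger0_norm (ltW q0)) ler_pdivrMr// mul1r.
  by have := norm_total q gb; rewrite mulr1.
have spb := norm_total_div gb; rewrite -/s in spb.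
have kE : s / ph * c = s / q%:R * (kap - 1).
  by rewrite /kap; field; rewrite !gt_eqF.
have -> : P - s / ph * y * I + s / ph * kap * J =
  (P - s / q%:R * (Y%:R * ln Y%:R - Y%:R)) - s / ph * (y * (I - ph / q%:R * ln Y%:R - c))
  + s / ph * kap * (J - ph / q%:R * Y%:R)
  + s / q%:R * ((Y%:R - y) * ln Y%:R) + s / q%:R * ((kap - 1) * (Y%:R - y)).
  transitivity ((P - s / q%:R * (Y%:R * ln Y%:R - Y%:R)) - s / ph * (y * (I - ph / q%:R * ln Y%:R - c))
  + s / ph * kap * (J - ph / q%:R * Y%:R)
  - (s / ph * (ph / q%:R)) * y * ln Y%:R - (s / ph * c) * y + s / ph * (ph / q%:R) * kap * Y%:R
  + s / q%:R * (Y%:R * ln Y%:R - Y%:R)).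
    by ring.
  by rewrite sE kE; ring.
have H1 : `|s / ph * (y * (I - ph / q%:R * ln Y%:R - c))| <= q%:R * (2 * C).
  rewrite normrM ler_pM// normrM ger0_norm; last by lra.
  apply: le_trans (ler_wpM2l _ HI) _; first by lra.
  by rewrite mulrA ler_pdivrMr//; nra.
have H2 : `|s / ph * kap * (J - ph / q%:R * Y%:R)| <= q%:R * `|kap| * (4 * q%:R).
  rewrite normrM ler_pM//; first by rewrite normrM ler_wpM2r.
  by rewrite mulr1 in HJ.
have H3 : `|s / q%:R * ((Y%:R - y) * ln Y%:R)| <= ln Y%:R.
  rewrite normrM -[leRHS]mul1r ler_pM// normrM (ger0_norm lY) ler_piMl//.
  by rewrite ler_norml; apply/andP; split; lra.
have H4 : `|s / q%:R * ((kap - 1) * (Y%:R - y))| <= `|kap - 1|.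
  rewrite normrM -[leRHS]mul1r ler_pM// normrM ler_piMr//.
  by rewrite ler_norml; apply/andP; split; lra.
have kk : 0 <= `|kap - 1| by [].
have kq : 0 <= q%:R * `|kap| * (4 * q%:R) by rewrite !mulr_ge0// ltW.
have kC : 0 <= q%:R * (2 * C) by rewrite !mulr_ge0// ltW.
apply: le_trans (ler_normD _ _) _; apply: le_trans (lerD (ler_normD _ _) (lexx _)) _.
apply: le_trans (lerD (lerD (ler_normD _ _) (lexx _)) (lexx _)) _.
apply: le_trans (lerD (lerD (lerD (ler_normB _ _) (lexx _)) (lexx _)) (lexx _)) _.
move: HP; rewrite mulr1 => HP.
move: H1 H2 H3 H4 HP.
set a1 := `|_|; set a2 := `|_|; set a3 := `|_|; set a4 := `|_|; set a5 := `|_|.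
move: (q%:R * _) (q%:R * _ * _) kq kC (`|kap - 1|) kk => u v v0 u0 w w0 H1 H2 H3 H4 H5.
by nra.
Qed.

Lemma sum_mangoldt_ln_div N : (0 < N)%N ->
  \sum_(1 <= n < N.+1) Lam n * ln (N%:R / n%:R) <= 8 * N%:R.
Proof.
move=> N0; have Nr := natr_gt0 R N0.
have -> : \sum_(1 <= n < N.+1) Lam n * ln (N%:R / n%:R) =
   \sum_(1 <= n < N.+1) Lam n * (ln N%:R - ln n%:R).
  apply: eq_big_nat => n /andP[n0 _].
  by rewrite ln_div ?posrE ?ltr0n.
rewrite Abel_sum -[leRHS]add0r lerD//.
  by rewrite mulr_ge0_le0 ?psi_ge0// subr_le0 lnn_le.
have -> : 8 * N%:R = \sum_(1 <= k < N.+1) 8 :> R.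
  by rewrite sumr_const_nat subn1 mulr_natr.
apply: ler_sum_nat => k /andP[k0 _].
have kr := natr_gt0 R k0.
have -> : ln N%:R - ln k%:R - (ln N%:R - ln k.+1%:R) = ln k.+1%:R - ln k%:R :> R by ring.
apply: (@le_trans _ _ (8 * k%:R * k%:R^-1)); last by rewrite mulfK ?gt_eqF.
apply: ler_pM; rewrite ?psi_ge0 ?psi_le ?lnS_le// subr_ge0 lnn_le//.
Qed.

(** Selberg's function, the convolution of [mu] with [ln ^ 2], in the form that shows its
    nonnegativity. *)
Definition mangoldt2 n : R :=
  Lam n * ln n%:R + \sum_(d <- divisors n) Lam d * Lam (n %/ d)%N.

Lemma mangoldt2_ge0 n : 0 <= mangoldt2 n.
Proof.
rewrite addr_ge0 ?mulr_ge0 ?mangoldt_ge0 ?lnn_ge0//.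
by rewrite sumr_ge0// => d _; rewrite mulr_ge0 ?mangoldt_ge0.
Qed.

Lemma sum_mangoldt2 g N :
  \sum_(1 <= n < N.+1) mangoldt2 n * g n =
  \sum_(1 <= n < N.+1) Lam n * ln n%:R * g n +
  \sum_(1 <= k < N.+1) Lam k * psi_of (dilate k g) (N %/ k).
Proof.
have H k : (0 < k)%N -> \sum_(d <- divisors k) Lam d * Lam (k %/ d)%N =
  (fun n => \sum_(d <- divisors n) Lam d * Lam (n %/ d)%N) k by [].
rewrite -(@sum_dirichlet R Lam Lam _ g N H) -big_split/=.
by apply: eq_bigr => n _; rewrite /mangoldt2 mulrDl.
Qed.

(** The sums of [selberg_inner] at [y = N / d], weighted by [mu d * ln (N / d)], are added over [d].
    Bounding each of them gives [O(N)] by [sum_ln_sqr]. Regrouped by [k = d * n], the weight is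
    [ln N] at [k = 1] and [Lam k] elsewhere, by [sum_mobius_ln_div]; this yields [psi_of g N * ln N]
    plus the convolution term minus two copies of the main term, the second of which comes from
    [mertens_coprime]. *)
Theorem selberg : exists2 C : R, 0 <= C & forall g N, class_fun g -> (0 < N)%N ->
  `|\sum_(1 <= n < N.+1) mangoldt2 n * g n - 2 * (total q g / ph) * (N%:R * ln N%:R)|
    <= C * N%:R.
Proof.
have [kap [K K0 HK]] := selberg_inner; have [M M0 HM] := mertens_coprime R q_gt0.
have q0 : 0 < q%:R :> R by rewrite ltr0n.
exists (8 + 32 * K + q%:R * (M + 9 * `|kap|)).
  by rewrite !addr_ge0 ?mulr_ge0 ?addr_ge0 ?mulr_ge0 ?(ltW q0).
move=> g N gc N0; have [gp gs gb] := gc; rewrite sum_mangoldt2.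
have Nr := natr_gt0 R N0; have N1 := natr_ge1 R N0.
pose s := total q g; rewrite -/s.
have spb := norm_total_div gb; rewrite -/s in spb.
pose Phi k := cop k * (psi_of (dilate k g) (N %/ k) - s / ph * (N%:R / k%:R - kap)).
pose f d := mu d * ln (N%:R / d%:R).
pose u k := (k == 1%N)%:R * ln N%:R + Lam k.
have fu k : (0 < k)%N -> \sum_(d <- divisors k) f d = u k.
  by move=> k0; rewrite /u -sum_mobius_ln_div.
have := sum_dirichlet1 Phi N fu.
set T := \sum_(1 <= d < N.+1) _ => T'E.
have HT : `|T| <= 32 * K * N%:R.
  rewrite T'E; apply: le_trans (ler_norm_sum _ _ _) _.
  apply: (@le_trans _ _ (K * \sum_(1 <= k < N.+1) (1 + ln (N%:R / k%:R)) ^+ 2)).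
    rewrite mulr_sumr; apply: ler_sum_nat => d /andP[d0 dN].
    have dN' : (0 < d <= N)%N by rewrite d0.
    have /andP[L0 L1] := ln_divn R dN'.
    have Y0 : (0 < N %/ d)%N by rewrite divn_gt0.
    have dr := natr_gt0 R d0.
    have l0 : 0 <= ln (N%:R / d%:R : R) by have := lnn_ge0 R (N %/ d); lra.
    have -> : \sum_(1 <= n < (N %/ d).+1) Phi (d * n)%N =
      cop d * \sum_(1 <= n < (N %/ d).+1) cop n * (psi_of (dilate n (dilate d g)) (N %/ d %/ n)
       - s / ph * (N%:R / d%:R / n%:R - kap)).
      rewrite mulr_sumr; apply: eq_bigr => n _.
      by rewrite /Phi coprime_indM dilate_dilate divnMA natrM invfM -!mulrA.
    rewrite /f 2!normrM.
    case: (boolP (coprime q d)) => dq; last first.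
      rewrite normrM /coprime_ind (negbTE dq) normr0 mul0r mulr0.
      by rewrite mulr_ge0// sqr_ge0.
    have yy : (N %/ d)%:R <= (N%:R / d%:R : R) <= (N %/ d)%:R + 1.
      apply/andP; split; first by rewrite ler_pdivlMr// -natrM ler_nat leq_divM.
      by rewrite ler_pdivrMr// natr1 -natrM ler_nat ltnW// ltn_ceil.
    have := HK (dilate d g) _ _ (class_fun_dilate d gc) Y0 yy.
    rewrite (total_dilate q_gt0 gp dq) -/s; set Z := \sum_(1 <= n < _) _ => HZ.
    have m1 := normr_mobius R d; have c1 := coprime_ind_le1 d.
    have : `|mu d| * `|ln (N%:R / d%:R)| <= ln (N%:R / d%:R : R).
      by rewrite (ger0_norm l0) ler_piMl.
    have HZ2 : `|cop d * Z| <= K * (1 + ln (N%:R / d%:R)).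
      rewrite normrM; apply: (@le_trans _ _ `|Z|); first by rewrite ler_piMl.
      by apply: le_trans HZ _; rewrite ler_wpM2l//; lra.
    move=> H1; apply: le_trans (ler_pM _ _ H1 HZ2) _; rewrite ?mulr_ge0//.
    have : 0 <= K * (1 + ln (N%:R / d%:R)) by rewrite mulr_ge0//; lra.
    by nra.
  by have := sum_ln_sqr R N; move: (\sum_(_ <= _ < _) _) => S HS; nra.
have TE : T = (psi_of g N - s / ph * (N%:R - kap)) * ln N%:R +
   \sum_(1 <= k < N.+1) Lam k * psi_of (dilate k g) (N %/ k) -
   s / ph * (N%:R * (\sum_(1 <= k < N.+1) cop k * Lam k / k%:R)
      - kap * \sum_(1 <= k < N.+1) cop k * Lam k).
  rewrite /T /u; under eq_bigr do rewrite mulrDl.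
  rewrite big_split/=; under eq_bigr do rewrite -mulrA.
  rewrite sum_delta1// [ln _ * _]mulrC.
  have -> : Phi 1%N = psi_of g N - s / ph * (N%:R - kap).
    rewrite /Phi /coprime_ind coprimen1 mul1r divn1 divr1; congr (psi_of _ _ - _).
    by apply/funext => n; rewrite /dilate mul1n.
  rewrite -addrA; congr (_ + _).
  rewrite mulr_sumr mulr_sumr -sumrB mulr_sumr -sumrB; apply: eq_bigr => k _.
  have -> : Phi k = psi_of (dilate k g) (N %/ k) - s / ph * (cop k * (N%:R / k%:R - kap)).
    rewrite /Phi mulrBr [cop k * (_ / _ * _)]mulrCA; congr (_ - _).
    rewrite /coprime_ind; case: (boolP (coprime q k)) => qk; first by rewrite mul1r.
    by rewrite mul0r (dilate_not_coprime gs qk) /psi_of big1// => n _; rewrite mulr0.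
  by ring.
have := HM N N0; move: TE.
set S := \sum_(1 <= k < N.+1) Lam k * psi_of _ _.
set A := \sum_(1 <= k < N.+1) cop k * Lam k / k%:R.
set B := \sum_(1 <= k < N.+1) cop k * Lam k.
set D := \sum_(1 <= k < N.+1) Lam k * ln _ * _ => TE HA.
have HB : `|B| <= 8 * N%:R.
  apply: le_trans (ler_norm_sum _ _ _) _; apply: le_trans (psi_le R N).
  apply: ler_sum => k _; rewrite normrM (ger0_norm (mangoldt_ge0 _ _)).
  by rewrite ler_piMl ?mangoldt_ge0// coprime_ind_le1.
have HD : `|psi_of g N * ln N%:R - D| <= 8 * N%:R.
  rewrite /psi_of /D mulr_suml -sumrB; apply: le_trans (sum_mangoldt_ln_div N0).
  apply: le_trans (ler_norm_sum _ _ _) _.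
  apply: ler_sum_nat => n /andP[n0 nN]; rewrite ln_div ?posrE ?ltr0n//.
  have -> : Lam n * g n * ln N%:R - Lam n * ln n%:R * g n =
    g n * (Lam n * (ln N%:R - ln n%:R)) by ring.
  have p0 : 0 <= Lam n * (ln N%:R - ln n%:R).
    by rewrite mulr_ge0 ?mangoldt_ge0// subr_ge0 lnn_le.
  by rewrite normrM (ger0_norm p0) ler_piMl.
have -> : D + S - 2 * (s / ph) * (N%:R * ln N%:R) =
   T - (psi_of g N * ln N%:R - D) + s / ph * (N%:R * (A - ln N%:R) - kap * ln N%:R - kap * B).
  by rewrite TE; ring.
have Hl := ln_le_sub1 Nr; have l0 := lnn_ge0 R N.
have : `|s / ph * (N%:R * (A - ln N%:R) - kap * ln N%:R - kap * B)| <=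
   q%:R * ((M + 9 * `|kap|) * N%:R).
  rewrite normrM ler_pM//.
  apply: le_trans (ler_normB _ _) _; apply: le_trans (lerD (ler_normB _ _) (lexx _)) _.
  rewrite !normrM (ger0_norm l0) (gtr0_norm Nr).
  have : N%:R * `|A - ln N%:R| <= N%:R * M by rewrite ler_pM2l.
  have : `|kap| * ln N%:R <= `|kap| * N%:R by rewrite ler_wpM2l//; lra.
  have : `|kap| * `|B| <= `|kap| * (8 * N%:R) by rewrite ler_wpM2l.
  by lra.
move=> H; apply: le_trans (ler_normD _ _) _.
by apply: le_trans (lerD (ler_normB _ _) (lexx _)) _; lra.
Qed.

End Selberg.

(** * Nonvanishing of Dirichlet series at 1 *)

Section LogDerivative.
Variables (R : realType) (q : nat).
Hypothesis q_gt0 : (0 < q)%N.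
Local Notation mu := (@mobius R).
Local Notation Lam := (@mangoldt R).
Local Notation cop := (@coprime_ind R q).
Implicit Types (g v w : nat -> R) (b C : R).

Lemma eq0_of_ln_bound (x C : R) :
  (forall N, (0 < N)%N -> `|x * ln N%:R| <= C) -> x = 0.
Proof.
move=> xC; apply/eqP; rewrite -normr_le0.
have l2 : 0 < ln 2 :> R by rewrite ln_gt0// ltr1n.
have x2 : `|x| * ln 2 <= 0.
  apply: (@le0_of_inv_bound _ _ C) => N.
  rewrite ler_pdivlMr ?ltr0n//; have := xC (2 ^ N.+1)%N (expn_gt0 _ _).
  by rewrite natrX lnXn ?ltr0n// -[ln 2 *+ _]mulr_natr mulrA normrM (ger0_norm (ler0n _ _)) normrM (gtr0_norm l2).
by rewrite pmulr_lle0 in x2.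
Qed.

Lemma total_dilate0 g c : periodic q g -> coprime_supported q g -> total q g = 0 ->
  total q (dilate c g) = 0.
Proof.
move=> gp gs g0; case: (boolP (coprime q c)) => qc; first by rewrite total_dilate.
by rewrite (dilate_not_coprime gs qc) /total big1.
Qed.

(** The tail of the series of [dilate m g] beyond [N %/ m] is [O(m / N)]; the factor [1 / m] makes
    the error independent of [m], so that it can be summed over all [m <= N]. *)
Lemma Lser_dilate_bound g b N m : periodic q g -> coprime_supported q g ->
  total q g = 0 -> (forall n, `|g n| <= b) -> (0 < m)%N -> (0 < N)%N ->
  `|m%:R^-1 * \sum_(1 <= k < (N %/ m).+1) g (m * k)%N * k%:R^-1 -
    m%:R^-1 * Lser (dilate m g)| <= 4 * q%:R * b / N%:R.
Proof.
move=> gp gs g0 gb m0 N0; have b0 : 0 <= b := le_trans (normr_ge0 _) (gb 0%N).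
have mr := natr_gt0 R m0; have Nr := natr_gt0 R N0.
have := Lser_bound q_gt0 (N %/ m) (periodic_dilate m gp) (total_dilate0 m gp gs g0)
  (fun n => gb (m * n)%N).
rewrite -mulrBr normrM normfV (ger0_norm (ler0n _ _)) => H.
rewrite ler_pdivrMl//; apply: le_trans H _.
have k0 : 0 <= 4 * q%:R * b by rewrite !mulr_ge0.
rewrite mulrCA ler_wpM2l// -invf_div lef_pV2 ?posrE ?ltr0n ?divr_gt0//.
by rewrite ler_pdivrMr// -natrM ler_nat ltnW// ltn_ceil.
Qed.

(** The sum of [g k * ln k / k] is bounded, being a partial sum of minus the derivative of the
    series at 1. With [ln] written as [Lam] convolved with 1, its inner sums become L-values of
    dilates, up to a total error [O(psi N / N)]. *)
Lemma sum_mangoldt_Lser g b N : periodic q g -> coprime_supported q g ->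
  total q g = 0 -> (forall n, `|g n| <= b) -> (0 < N)%N ->
  `|\sum_(1 <= m < N.+1) Lam m * (m%:R^-1 * Lser (dilate m g))| <= 40 * q%:R * b.
Proof.
move=> gp gs g0 gb N0; have b0 : 0 <= b := le_trans (normr_ge0 _) (gb 0%N).
have Nr := natr_gt0 R N0; set C := 4 * q%:R * b.
have C0 : 0 <= C by rewrite !mulr_ge0.
pose h k := g k * k%:R^-1.
pose V n := \sum_(1 <= k < n.+1) h k.
have VL n : `|V n - Lser g| <= C / n.+1%:R by exact: Lser_bound.
have HA : `|\sum_(1 <= k < N.+1) ln k%:R * h k| <= 2 * C.
  under eq_bigr do rewrite mulrC.
  rewrite Abel_sum -/(V N).
  have lE : ln N.+1%:R = - \sum_(1 <= k < N.+1) (ln k%:R - ln k.+1%:R) :> R.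
    by rewrite (telescope_sumrN (fun k => ln k%:R : R)) ln1 sub0r opprK.
  have -> : V N * ln N.+1%:R + \sum_(1 <= k < N.+1) (\sum_(1 <= j < k.+1) h j) * (ln k%:R - ln k.+1%:R)
    = (V N - Lser g) * ln N.+1%:R + \sum_(1 <= k < N.+1) (V k - Lser g) * (ln k%:R - ln k.+1%:R).
    have lL : Lser g * ln N.+1%:R = - (Lser g * \sum_(1 <= k < N.+1) (ln k%:R - ln k.+1%:R)).
      by rewrite lE mulrN.
    rewrite mulrBl lL opprK mulr_sumr -addrA -big_split/=; congr (_ + _).
    by apply: eq_bigr => k _; rewrite -mulrDl [Lser g + _]addrC subrK.
  have -> : 2 * C = C + C by ring.
  apply: le_trans (ler_normD _ _) _; apply: lerD.
    rewrite normrM (ger0_norm (lnn_ge0 _ _)).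
    apply: le_trans (ler_wpM2r (lnn_ge0 _ _) (VL N)) _.
    rewrite -mulrA ler_piMr// ler_pdivrMl ?ltr0n// mulr1.
    by have := @ln_le_sub1 R N.+1%:R (natr_gt0 R (ltn0Sn N)); lra.
  apply: le_trans (ler_norm_sum _ _ _) _.
  apply: (@le_trans _ _ (\sum_(1 <= k < N.+1) (C * k%:R^-1 - C * k.+1%:R^-1))).
    apply: ler_sum_nat => k /andP[k0 _].
    rewrite -mulrBr -invM_succ// invfM [_^-1 * _]mulrC mulrA normrM ler_pM//.
    by rewrite distrC ger0_norm ?lnS_le// subr_ge0 lnn_le.
  rewrite (telescope_sumrN (fun k => C * k%:R^-1)) invr1 mulr1.
  by rewrite lerBlDr lerDl divr_ge0.
move: HA; rewrite (sum_dirichlet1 _ _ (@sum_mangoldt R)).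
set A := \sum_(1 <= d < N.+1) _ => HA; set B := \sum_(1 <= m < N.+1) _.
have HB : `|A - B| <= 8 * C.
  rewrite /A /B -sumrB; apply: le_trans (ler_norm_sum _ _ _) _.
  apply: (@le_trans _ _ (\sum_(1 <= m < N.+1) Lam m * (C / N%:R))); last first.
    have := psi_le R N; rewrite /psi => HP.
    by rewrite -mulr_suml mulrA ler_pdivrMr// [leRHS]mulrAC ler_wpM2r.
  apply: ler_sum_nat => m /andP[m0 _].
  rewrite -mulrBr normrM (ger0_norm (mangoldt_ge0 _ _)) ler_wpM2l ?mangoldt_ge0//.
  have := Lser_dilate_bound gp gs g0 gb m0 N0.
  by rewrite mulr_sumr; under eq_bigr do rewrite mulrCA -invfM -natrM.
have := ler_normB A (A - B); rewrite subKr => /le_trans -> //.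
by rewrite /C in HA HB *; lra.
Qed.

(** With all L-values zero the inner sums are tails of size [O(1 / N)], and the weights [ln (N / d)]
    add up to at most [N]. Regrouping by [sum_mobius_ln_div] produces the left side: [- v 1 * ln N]
    is what a zero contributes to the logarithmic derivative. *)
Lemma sum_mangoldt_vanishing v b N : periodic q v -> coprime_supported q v ->
  total q v = 0 -> (forall n, `|v n| <= b) -> (forall c, Lser (dilate c v) = 0) ->
  (0 < N)%N ->
  `|\sum_(1 <= n < N.+1) Lam n * (v n / n%:R) + v 1%N * ln N%:R| <= 4 * q%:R * b.
Proof.
move=> vp vs v0 vb vL N0; have b0 : 0 <= b := le_trans (normr_ge0 _) (vb 0%N).
have Nr := natr_gt0 R N0; set C := 4 * q%:R * b.
have C0 : 0 <= C by rewrite !mulr_ge0.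
pose h k := v k / k%:R.
pose f d := mu d * ln (N%:R / d%:R).
pose u k := (k == 1%N)%:R * ln N%:R + Lam k.
have fu k : (0 < k)%N -> \sum_(d <- divisors k) f d = u k.
  by move=> k0; rewrite /u -sum_mobius_ln_div.
have := sum_dirichlet1 h N fu.
have -> : \sum_(1 <= k < N.+1) u k * h k =
  \sum_(1 <= n < N.+1) Lam n * (v n / n%:R) + v 1%N * ln N%:R.
  rewrite /u; under eq_bigr do rewrite mulrDl.
  rewrite big_split/= addrC; congr (_ + _).
  under eq_bigr do rewrite -mulrA.
  by rewrite sum_delta1// mulrC /h divr1.
move=> ->; apply: le_trans (ler_norm_sum _ _ _) _.
apply: (@le_trans _ _ (\sum_(1 <= d < N.+1) ln (N%:R / d%:R) * (C / N%:R))); last first.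
  rewrite -mulr_suml mulrA ler_pdivrMr// mulrC ler_wpM2l//.
  exact: sum_ln_div.
apply: ler_sum_nat => d /andP[d0 dN].
have dr := natr_gt0 R d0.
have l0 : 0 <= ln (N%:R / d%:R : R).
  by rewrite ln_ge0// ler_pdivlMr// mul1r ler_nat.
rewrite normrM ler_pM//.
  by rewrite /f normrM (ger0_norm l0) ler_piMl// normr_mobius.
have := Lser_dilate_bound vp vs v0 vb d0 N0.
by rewrite vL mulr0 subr0 mulr_sumr; under eq_bigr do rewrite mulrCA -invfM -natrM.
Qed.

End LogDerivative.

(** * Nonvanishing at 1 for a real character *)

Section RealCharacter.
Variables (R : realType) (q : nat).
Hypothesis q_gt0 : (0 < q)%N.
Local Notation Lam := (@mangoldt R).
Local Notation cop := (@coprime_ind R q).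
Variable eps : nat -> R.
Hypothesis eps_periodic : periodic q eps.
Hypothesis eps_supp : coprime_supported q eps.
Hypothesis eps_total : total q eps = 0.
Hypothesis eps1 : eps 1%N = 1.
Hypothesis epsM : forall m n, eps (m * n)%N = eps m * eps n.
Hypothesis eps_sqr : forall n, coprime q n -> eps n * eps n = 1.

Let h (n : nat) : R := \sum_(d <- divisors n) eps d.

Lemma eps_cases n : coprime q n -> eps n = 1 \/ eps n = -1.
Proof.
move=> nq; have /eqP := eps_sqr nq; rewrite -expr2 sqrf_eq1 => /orP[] /eqP ->.
  by left.
by right.
Qed.

Lemma norm_eps_le1 n : `|eps n| <= 1.
Proof.
case: (boolP (coprime q n)) => nq; last by rewrite eps_supp// normr0.
by case: (eps_cases nq) => ->; rewrite ?normrN normr1.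
Qed.

(* The logarithmic derivative of the Dirichlet series of [h] has the
   nonnegative coefficients [Lam * (1 + eps)]; this yields [h_ge0] by
   induction. *)
Lemma h_ln n : (0 < n)%N ->
  h n * ln n%:R = \sum_(d <- divisors n) Lam d * (1 + eps d) * h (n %/ d)%N.
Proof.
move=> n0.
have A1 : \sum_(d <- divisors n) eps d * ln d%:R =
  \sum_(d <- divisors n) Lam d * eps d * h (n %/ d)%N.
  transitivity (\sum_(a <- divisors n) \sum_(d <- divisors a) Lam d * eps (d * (a %/ d))%N).
    rewrite !big_seq; apply: eq_bigr => a; rewrite -dvdn_divisors// => an.
    have a0 := dvdn_gt0 n0 an.
    rewrite mulrC -sum_mangoldt// mulr_suml !big_seq; apply: eq_bigr => d.
    by rewrite -dvdn_divisors// => da; rewrite [(d * _)%N]mulnC divnK.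
  rewrite (sum_divisors_assoc (fun d e c => Lam d * eps (d * e)%N) n0).
  apply: eq_bigr => d _; rewrite -mulrA -mulr_sumr; congr (_ * _).
  by rewrite /h mulr_sumr; apply: eq_bigr => e _.
have A2 : \sum_(d <- divisors n) eps d * ln (n %/ d)%:R =
  \sum_(d <- divisors n) Lam d * h (n %/ d)%N.
  transitivity (\sum_(d <- divisors n) \sum_(e <- divisors (n %/ d)) eps d * Lam e).
    rewrite !big_seq; apply: eq_bigr => a; rewrite -dvdn_divisors// => an.
    have a0 := dvdn_gt0 n0 an.
    by rewrite -sum_mangoldt ?mulr_sumr// divn_gt0// dvdn_leq.
  rewrite -(sum_divisors_assoc (fun d e c => eps d * Lam e) n0).
  under [RHS]eq_bigr do rewrite /h mulr_sumr.
  rewrite -(sum_divisors_assoc (fun d e c => Lam d * eps e) n0).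
  rewrite !big_seq; apply: eq_bigr => a; rewrite -dvdn_divisors// => an.
  have a0 := dvdn_gt0 n0 an.
  rewrite sum_codivisors// !big_seq; apply: eq_bigr => d.
  by rewrite -dvdn_divisors// => da; rewrite divnA// mulKn// mulrC.
have -> : \sum_(d <- divisors n) Lam d * (1 + eps d) * h (n %/ d)%N =
  \sum_(d <- divisors n) Lam d * h (n %/ d)%N + \sum_(d <- divisors n) Lam d * eps d * h (n %/ d)%N.
  by rewrite -big_split; apply: eq_bigr => d _; rewrite mulrDr mulr1 mulrDl.
rewrite -A1 -A2 -big_split/= /h mulr_suml !big_seq; apply: eq_bigr => d.
rewrite -dvdn_divisors// => dn; rewrite -mulrDr; congr (_ * _).
have d0 := dvdn_gt0 n0 dn.
by rewrite -lnnM ?divnK// divn_gt0// dvdn_leq.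
Qed.

Lemma h_ge0 n : (0 < n)%N -> 0 <= h n.
Proof.
elim/ltn_ind: n => n IH n0; case: (ltnP 1 n) => n1; last first.
  have -> : n = 1%N by apply/eqP; rewrite eqn_leq n1.
  by rewrite /h /divisors/= big_seq1 eps1.
have l0 : 0 < ln n%:R :> R by rewrite ln_gt0// ltr1n.
rewrite -(pmulr_lge0 _ l0) h_ln//.
rewrite big_seq sumr_ge0// => d; rewrite -dvdn_divisors// => dn.
have d0 := dvdn_gt0 n0 dn.
case: (ltnP 1 d) => d1; last first.
  have -> : d = 1%N by apply/eqP; rewrite eqn_leq d1.
  by rewrite mangoldt1 !mul0r.
rewrite mulr_ge0 ?mulr_ge0 ?mangoldt_ge0//.
  by have := norm_eps_le1 d; rewrite ler_norml => /andP[]; lra.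
by apply: IH; rewrite ?ltn_Pdiv// divn_gt0// dvdn_leq.
Qed.

(** The involution [d |-> n ^ 2 / d] preserves [eps], because [eps (n ^ 2) = 1] and the values are
    signs. So [h (n ^ 2) = 2 S + eps n] with an integer [S]: an odd integer, which [h_ge0] forces to
    be at least 1. *)
Lemma h_sqr_ge1 n : (0 < n)%N -> coprime q n -> 1 <= h (n * n)%N.
Proof.
move=> n0 nq; have nn0 : (0 < n * n)%N by rewrite muln_gt0 n0.
have copd d : (d %| n * n)%N -> coprime q d.
  by move=> dn; apply: coprime_dvdr dn _; rewrite coprimeMr nq.
pose S := \sum_(d <- divisors (n * n) | (d < n)%N) eps d.
have hE : h (n * n)%N = S + eps n + S.
  rewrite /h (bigD1_seq n) ?divisors_uniq//=; last by rewrite -dvdn_divisors// dvdn_mulr.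
  rewrite [S + _]addrC -addrA; congr (_ + _); rewrite (bigID (fun d => d < n)%N)/=.
  congr (_ + _).
    by rewrite /S; apply: eq_bigl => d; case: ltngtP.
  transitivity (\sum_(d <- divisors (n * n)) if (n < d)%N then eps d else 0).
    by rewrite -big_mkcond; apply: eq_bigl => d; case: ltngtP.
  rewrite sum_codivisors// /S [RHS]big_mkcond !big_seq; apply: eq_bigr => d.
  rewrite -dvdn_divisors// => dn; have d0 := dvdn_gt0 nn0 dn.
  have [e nE] := dvdnP dn; rewrite nE mulnK//.
  have -> : (n < e)%N = (d < n)%N.
    by apply/idP/idP => H; rewrite ltnNge; apply/negP => H'; nia.
  case: ifP => // _; have de : eps e * eps d = 1.
    by rewrite -epsM -nE epsM eps_sqr.
  have dd := eps_sqr (copd d dn).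
  by rewrite -[eps e]mulr1 -dd mulrA de mul1r.
have Sint : S \is a Num.int.
  rewrite /S big_seq_cond rpred_sum// => d /andP[]; rewrite -dvdn_divisors// => dn _.
  by case: (eps_cases (copd _ dn)) => ->; rewrite ?rpredN rpred1.
have := h_ge0 nn0; rewrite hE.
have /intrP[z zE] := Sint; rewrite zE => H.
case: (eps_cases nq) H => -> H.
- have : 0 <= z.
    rewrite leNgt; apply/negP => z0.
    have : z%:~R <= -1 :> R by rewrite -[-1]/((-1)%:~R) ler_int; lia.
    by lra.
  by rewrite -(ler_int R) => ?; lra.
- have : 1 <= z.
    rewrite leNgt; apply/negP => z0.
    have : z%:~R <= 0 :> R by rewrite (ler_int R z 0); lia.
    by lra.
  by rewrite -(ler_int R) => ?; lra.
Qed.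

Lemma parabola_lipschitz (y z : R) (k l : nat) : z <= y ->
  k%:R <= y -> y <= k%:R + 1 -> l%:R <= z -> z <= l%:R + 1 -> (l <= k)%N ->
  `|(y - k%:R) * (k%:R + 1 - y) - (z - l%:R) * (l%:R + 1 - z)| <= y - z.
Proof.
move=> zy ky yk lz zl; rewrite leq_eqVlt => /orP[/eqP lk|lk].
  rewrite -lk in ky yk *.
  have -> : (y - l%:R) * (l%:R + 1 - y) - (z - l%:R) * (l%:R + 1 - z) =
     (y - z) * (2 * l%:R + 1 - y - z) by ring.
  rewrite normrM ger0_norm ?subr_ge0// ler_piMr ?subr_ge0//.
  by rewrite ler_norml; apply/andP; split; lra.
have : l%:R + 1 <= k%:R :> R by rewrite natr1 ler_nat.
by move=> lk'; rewrite ler_norml; apply/andP; split; nra.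
Qed.

(** This is [{t} (1 - {t})] at [t = N / d], the fluctuating part of the sum of [1 - d m / N] over
    [m <= N / d]. The linear weight is chosen to make it continuous in [t]: a sharp cutoff would
    leave the jumps of the integer part. *)
Let bump N d : R := (N%:R / d%:R - (N %/ d)%:R) * ((N %/ d)%:R + 1 - N%:R / d%:R).

Lemma floor_bounds N d : (0 < d)%N ->
  (N %/ d)%:R <= N%:R / d%:R :> R /\ N%:R / d%:R <= (N %/ d)%:R + 1 :> R.
Proof.
move=> d0; split; first by rewrite ler_pdivlMr ?ltr0n// -natrM ler_nat leq_divM.
by rewrite ler_pdivrMr ?ltr0n// natr1 -natrM ler_nat ltnW// ltn_ceil.
Qed.

Lemma bump_bounds N d : (0 < d)%N -> 0 <= bump N d /\ bump N d <= 1.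
Proof. by move=> d0; have [] := floor_bounds N d0; rewrite /bump; nra. Qed.

Lemma bump_variation N d : (0 < d)%N ->
  `|bump N d - bump N d.+1| <= N%:R / d%:R - N%:R / d.+1%:R.
Proof.
move=> d0; have [a1 a2] := floor_bounds N d0.
have [b1 b2] := floor_bounds N (ltn0Sn d).
apply: parabola_lipschitz => //; last by apply: leq_div2l.
by rewrite ler_wpM2l// lef_pV2 ?posrE ?ltr0n// ler_nat.
Qed.

Lemma sum_linear_weight N d : (0 < N)%N -> (0 < d)%N ->
  \sum_(1 <= m < (N %/ d).+1) (1 - (d * m)%:R / N%:R) =
  N%:R / 2 * d%:R^-1 - 1 / 2 + d%:R / (2 * N%:R) * bump N d.
Proof.
move=> N0 d0; have Nr := natr_gt0 R N0; have dr := natr_gt0 R d0.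
have sumE k : \sum_(1 <= m < k.+1) (1 - (d * m)%:R / N%:R) =
   k%:R - d%:R / N%:R * (k%:R * (k%:R + 1) / 2) :> R.
  elim: k => [|k IH]; first by rewrite big_nil !mul0r mulr0 subr0.
  by rewrite big_nat_recr//= IH natrM -[k.+1%:R]natr1; field; rewrite gt_eqF.
rewrite sumE /bump; move: (N %/ d)%N => k; field.
by rewrite !gt_eqF.
Qed.

(** The partial sums of [eps] are bounded, so only the total variation of the weights matters, and
    [bump_variation] bounds it by a harmonic sum. *)
Lemma sum_eps_bump N : (0 < N)%N ->
  `|\sum_(1 <= d < N.+1) eps d * (d%:R / (2 * N%:R) * bump N d)| <=
  2 * q%:R * (3 + ln N%:R).
Proof.
move=> N0; have Nr := natr_gt0 R N0; have N1 := natr_ge1 R N0.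
apply: le_trans (norm_Abel_sum _ _
  (fun n => sum_zero_mean q_gt0 n eps_periodic eps_total norm_eps_le1)) _.
rewrite mulr1 ler_wpM2l ?mulr_ge0//.
have -> : 3 + ln N%:R = 1 + (1 + ln N%:R + 1) :> R by ring.
apply: lerD.
  have [u0 u1] := bump_bounds N (ltn0Sn N).
  have p0 : 0 <= N.+1%:R / (2 * N%:R) :> R by rewrite divr_ge0// mulr_ge0.
  rewrite ger0_norm; last exact: mulr_ge0.
  rewrite mulr_ile1//.
  by rewrite ler_pdivrMr ?mulr_gt0// -natr1; lra.
apply: (@le_trans _ _ (\sum_(1 <= k < N.+1) (k%:R^-1 + N%:R^-1))); last first.
  rewrite big_split/=; apply: lerD; first exact: sum_inv_le.
  by rewrite sumr_const_nat subn1/= -[_ *+ N]mulr_natr mulVf// gt_eqF.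
apply: ler_sum_nat => d /andP[d0 dN].
have dr := natr_gt0 R d0; have d1 := natr_ge1 R d0.
have [u0 u1] := bump_bounds N (ltn0Sn d); have := bump_variation N d0.
rewrite -mulrBr -invM_succ//.
set x := bump N d; set y := bump N d.+1 => xy.
have -> : d%:R / (2 * N%:R) * x - d.+1%:R / (2 * N%:R) * y =
  d%:R / (2 * N%:R) * (x - y) - (2 * N%:R)^-1 * y.
  by rewrite -natr1; field; rewrite gt_eqF.
apply: le_trans (ler_normB _ _) _; apply: lerD.
  rewrite normrM ger0_norm ?divr_ge0 ?mulr_ge0//.
  apply: le_trans (ler_wpM2l _ xy) _; first by rewrite divr_ge0 ?mulr_ge0.
  have -> : d%:R / (2 * N%:R) * (N%:R * (d%:R * d.+1%:R)^-1) = (2 * (d%:R + 1))^-1 :> R.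
    by rewrite -natr1; field; rewrite !gt_eqF// addr_gt0.
  rewrite lef_pV2 ?posrE ?mulr_gt0 ?addr_gt0//.
  by lra.
rewrite normrM (ger0_norm u0) ger0_norm ?invr_ge0 ?mulr_ge0//.
rewrite (@le_trans _ _ (2 * N%:R)^-1) ?ler_piMr ?invr_ge0 ?mulr_ge0//.
by rewrite lef_pV2 ?posrE ?mulr_gt0//; lra.
Qed.

(** By [sum_linear_weight] three sums arise: [N / 2] times a partial sum of the series, which is
    [O(1)] when its value is 0; half a partial sum of [eps]; and the sum with [bump], the only
    source of a logarithm. *)
Lemma sum_h_upper N : (0 < N)%N -> Lser eps = 0 ->
  \sum_(1 <= n < N.+1) h n * (1 - n%:R / N%:R) <= 2 * q%:R * (3 + ln N%:R) + 3 * q%:R.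
Proof.
move=> N0 L0; have Nr := natr_gt0 R N0.
rewrite (@sum_dirichlet1 R eps h)//.
have -> : \sum_(1 <= d < N.+1) eps d *
     (\sum_(1 <= n < (N %/ d).+1) (1 - (d * n)%:R / N%:R)) =
  N%:R / 2 * (\sum_(1 <= d < N.+1) eps d * d%:R^-1) - 1 / 2 * (\sum_(1 <= d < N.+1) eps d)
   + \sum_(1 <= d < N.+1) eps d * (d%:R / (2 * N%:R) * bump N d).
  rewrite !mulr_sumr -sumrB -big_split/=; apply: eq_big_nat => d /andP[d0 _].
  by rewrite sum_linear_weight//; ring.
have := sum_eps_bump N0.
have := sum_zero_mean q_gt0 N eps_periodic eps_total norm_eps_le1.
have := Lser_bound q_gt0 N eps_periodic eps_total norm_eps_le1.
rewrite L0 subr0 !mulr1.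
set A := \sum_(1 <= d < N.+1) eps d * d%:R^-1; set B := \sum_(1 <= k < N.+1) eps k.
set C := \sum_(1 <= d < N.+1) _ * (_ * _) => HA HB HC.
have HA' : N%:R / 2 * A <= 2 * q%:R.
  have : `|A| * N%:R <= 4 * q%:R.
    rewrite -ler_pdivlMr//; apply: le_trans HA _.
    by rewrite ler_wpM2l ?mulr_ge0// lef_pV2 ?posrE ?ltr0n// ler_nat.
  have : A * N%:R <= `|A| * N%:R by rewrite ler_wpM2r// ler_norm.
  by lra.
by move: HB HC; rewrite !ler_norml => /andP[? ?] /andP[? ?]; lra.
Qed.

Lemma ler_sum_subset (r s : seq nat) (F : nat -> R) : uniq s -> uniq r ->
  {subset s <= r} -> {in r, forall n, 0 <= F n} ->
  \sum_(n <- s) F n <= \sum_(n <- r) F n.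
Proof.
move=> us ur sr F0; rewrite [leRHS](bigID (fun n => n \in s))/=.
have -> : \sum_(n <- r | n \in s) F n = \sum_(n <- s) F n.
  rewrite -big_filter; apply: perm_big; apply: uniq_perm => //.
    by rewrite filter_uniq.
  move=> n; rewrite mem_filter; case: (boolP (n \in s)) => //= ns.
  by rewrite (sr _ ns).
by rewrite lerDl big_seq_cond sumr_ge0// => n /andP[nr _]; exact: F0.
Qed.

Lemma sum_h_lower J : (0 < J)%N ->
  J%:R / 2 <= \sum_(1 <= n < (2 * (q * J) ^ 2).+1) h n * (1 - n%:R / (2 * (q * J) ^ 2)%:R).
Proof.
move=> J0; set N := (2 * (q * J) ^ 2)%N.
have N0 : (0 < N)%N by rewrite muln_gt0/= expn_gt0 muln_gt0 q_gt0 J0.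
have Nr := natr_gt0 R N0.
(* The squares of [q j + 1] are coprime to [q], and [q j + 1 <= q J] keeps them within [N / 2],
   where the linear weight is at least [1 / 2]. *)
pose sq j := ((q * j + 1) * (q * j + 1))%N.
have sqN j : (j < J)%N -> (2 * sq j <= N)%N.
  by move=> jJ; rewrite /N /sq leq_mul2l/= -mulnn leq_mul//; nia.
apply: le_trans (@ler_sum_subset _ [seq sq j | j <- iota 0 J] _ _ _ _ _).
- rewrite big_map; apply: (@le_trans _ _ (\sum_(j <- iota 0 J) (1 / 2))).
    rewrite big_const_seq count_predT size_iota iter_addr_0.
    by have -> : (1 / 2) *+ J = J%:R / 2 :> R by rewrite -[LHS]mulr_natr mul1r mulrC.
  rewrite big_seq [leRHS]big_seq; apply: ler_sum => j; rewrite mem_iota => /andP[_ jJ].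
  have h1 : 1 <= h (sq j).
    apply: h_sqr_ge1; first by rewrite addn1.
    by rewrite /coprime mulnC gcdnMDl gcdn1.
  have : (sq j)%:R / N%:R <= 1 / 2 :> R.
    have := sqN j jJ; rewrite -(ler_nat R) natrM => sN.
    by rewrite ler_pdivrMr//; lra.
  by move=> H2; nra.
- rewrite map_inj_uniq ?iota_uniq// => i j /eqP.
  by rewrite /sq !mulnn eqn_sqr eqn_add2r eqn_pmul2l// => /eqP.
- exact: iota_uniq.
- move=> n /mapP[j]; rewrite mem_iota => /andP[_ jJ] ->.
  rewrite mem_index_iota ltnS; apply/andP; split; first by rewrite /sq addn1.
  by have := sqN j jJ; lia.
- move=> n; rewrite mem_index_iota ltnS => /andP[n0 nN].
  by rewrite mulr_ge0 ?h_ge0// subr_ge0 ler_pdivrMr// mul1r ler_nat.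
Qed.

(* A zero would make the weighted sum of [h] up to [N] of order [ln N],
   whereas its square arguments alone contribute order [sqrt N]. *)
Theorem Lser_real_character_neq0 : Lser eps != 0.
Proof.
apply/negP => /eqP L0.
pose A : R := 9 * q%:R + 2 * q%:R * (1 + 2 * ln q%:R).
have A0 : 0 <= A.
  by rewrite /A addr_ge0 ?mulr_ge0 ?addr_ge0 ?mulr_ge0// lnn_ge0.
(* With [J = M ^ 2] the lower bound is quadratic in [M], while [ln M <= M - 1] makes the upper one
   linear. *)
have key M : (0 < M)%N -> M%:R ^+ 2 / 2 <= A + 8 * q%:R * M%:R.
  move=> M0; have J0 : (0 < M ^ 2)%N by rewrite expn_gt0 M0.
  have N0 : (0 < 2 * (q * M ^ 2) ^ 2)%N.
    by rewrite muln_gt0/= expn_gt0 muln_gt0 q_gt0 J0.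
  have := le_trans (sum_h_lower J0) (sum_h_upper N0 L0); rewrite natrX => /le_trans -> //.
  have Mr := natr_gt0 R M0; have qr := natr_gt0 R q_gt0.
  have -> : ln (2 * (q * M ^ 2) ^ 2)%:R = ln 2 + 2 * ln q%:R + 4 * ln M%:R :> R.
    rewrite natrM natrX natrM natrX lnM ?posrE ?exprn_gt0 ?mulr_gt0 ?exprn_gt0//.
    rewrite lnXn ?mulr_gt0 ?exprn_gt0// lnM ?posrE ?exprn_gt0//.
    by rewrite lnXn//; ring.
  have l2 : ln 2 <= 1 :> R by have := ln_le_sub1 (ltr0n R 2); lra.
  have lM := ln_le_sub1 Mr.
  have : q%:R * ln M%:R <= q%:R * M%:R :> R by rewrite ler_pM2l//; lra.
  have : q%:R * ln 2 <= q%:R * 1 :> R by rewrite ler_pM2l.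
  rewrite /A; lra.
have := archi_boundP (addr_ge0 A0 (mulr_ge0 (ler0n R 16) (ler0n R q))).
set M := Num.bound _ => AM.
have M0 : (0 < M)%N by rewrite -(ltr0n R); apply: le_lt_trans AM; rewrite addr_ge0 ?mulr_ge0.
have := key (2 * M)%N; rewrite muln_gt0 M0 natrM => /(_ isT).
have M1 := natr_ge1 R M0; have q1 := q_ge1 R q_gt0.
by nra.
Qed.

End RealCharacter.

(** * Reduction of the general case to a real character *)

Section NonVanishing.
Variables (R : realType) (q : nat).
Hypothesis q_gt0 : (0 < q)%N.
Local Notation Lam := (@mangoldt R).
Local Notation cop := (@coprime_ind R q).
Implicit Types (F v w : nat -> R).

(** Which classes these are is not known at this point; all the others contribute [O(1)] and are
    invisible against [ln N]. *)
Definition log_dense b := coprime q b /\ ~ exists C : R, forall N, (0 < N)%N ->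
  \sum_(1 <= n < N.+1) Lam n * (class_ind R q b n / n%:R) <= C.

Lemma class_sum_ge0 b N :
  0 <= \sum_(1 <= n < N.+1) Lam n * (class_ind R q b n / n%:R).
Proof.
by apply: sumr_ge0 => n _; rewrite mulr_ge0 ?mangoldt_ge0// divr_ge0// /class_ind ler0n.
Qed.

Lemma sum_vanishing_on_dense F : periodic q F -> coprime_supported q F ->
  (forall b, log_dense b -> F b = 0) ->
  exists C : R, forall N, (0 < N)%N ->
    `|\sum_(1 <= n < N.+1) Lam n * (F n / n%:R)| <= C.
Proof.
move=> Fp Fs FB.
have FE n : F n = \sum_(0 <= r < q) F r * class_ind R q r n.
  exact: class_expansion.
suff H k : exists C : R, forall N, (0 < N)%N ->
    `|\sum_(1 <= n < N.+1) Lam n * ((\sum_(0 <= r < k) F r * class_ind R q r n) / n%:R)| <= C.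
  have [C HC] := H q; exists C => N N0; have := HC N N0.
  by under eq_bigr do rewrite -FE.
elim: k => [|k [C HC]].
  exists 0 => N _; rewrite big1 ?normr0// => n _.
  by rewrite big_nil mul0r mulr0.
have [D HD] : exists D : R, forall N, (0 < N)%N ->
   `|F k * \sum_(1 <= n < N.+1) Lam n * (class_ind R q k n / n%:R)| <= D.
  case: (eqVneq (F k) 0) => Fk; first by exists 0 => N _; rewrite Fk mul0r normr0.
  have kq : coprime q k by apply: contraNT Fk => /Fs ->.
  have [[D HD]|nD] := pselect (exists C : R, forall N, (0 < N)%N ->
    \sum_(1 <= n < N.+1) Lam n * (class_ind R q k n / n%:R) <= C); last first.
    by rewrite FB ?eqxx in Fk.
  exists (`|F k| * D) => N N0; rewrite normrM ler_wpM2l//.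
  by rewrite ger0_norm ?class_sum_ge0// HD.
exists (C + D) => N N0.
have -> : \sum_(1 <= n < N.+1) Lam n * ((\sum_(0 <= r < k.+1) F r * class_ind R q r n) / n%:R) =
  \sum_(1 <= n < N.+1) Lam n * ((\sum_(0 <= r < k) F r * class_ind R q r n) / n%:R) +
  F k * \sum_(1 <= n < N.+1) Lam n * (class_ind R q k n / n%:R).
  rewrite mulr_sumr -big_split/=; apply: eq_bigr => n _.
  by rewrite big_nat_recr//=; ring.
by apply: le_trans (ler_normD _ _) _; rewrite lerD ?HC ?HD.
Qed.

(** Invariance under the subgroup generated by the log-dense classes. *)
Definition dense_invariant w := forall b c, log_dense b -> w (c * b)%N = w c.

Lemma dense_invariant_dilate c w : dense_invariant w -> dense_invariant (dilate c w).
Proof. by move=> wi b d bB; rewrite /dilate mulnA wi. Qed.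

Lemma mertens_mul (x C : R) :
  (forall N, (0 < N)%N -> `|x * \sum_(1 <= n < N.+1) cop n * Lam n / n%:R| <= C) -> x = 0.
Proof.
move=> xC; have [M M0 HM] := mertens_coprime R q_gt0.
apply: (@eq0_of_ln_bound _ _ (C + `|x| * M)) => N N0.
have := xC N N0; have := HM N N0; set S := \sum_(_ <= _ < _) _ => H1 H2.
have -> : x * ln N%:R = x * S - x * (S - ln N%:R) by ring.
apply: le_trans (ler_normB _ _) _; rewrite lerD// normrM ler_wpM2l//.
Qed.

(** On log-dense classes [Lser (dilate m w)] equals [Lser w], so up to [O(1)] the sum in
    [sum_mangoldt_Lser] is [Lser w * ln N]; but that sum is bounded. *)
Lemma dense_invariant_Lser w : periodic q w -> coprime_supported q w ->
  total q w = 0 -> dense_invariant w -> Lser w = 0.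
Proof.
move=> wp ws w0 wi; have [b b0 wb] := periodic_bounded q_gt0 wp.
pose F m := Lser (dilate m w) - cop m * Lser w.
have Fp : periodic q F.
  by move=> n; rewrite /F dilate_modn// periodic_coprime_ind.
have Fs : coprime_supported q F.
  move=> n nq; rewrite /F (dilate_not_coprime ws nq) Lser0 sub0r.
  by rewrite supported_coprime_ind// mul0r oppr0.
have FB c : log_dense c -> F c = 0.
  move=> cB; have [cq _] := cB; rewrite /F /coprime_ind cq mul1r.
  have -> : dilate c w = w by apply/funext => n; rewrite /dilate mulnC wi.
  by rewrite subrr.
have [C HC] := sum_vanishing_on_dense Fp Fs FB.
apply: (@mertens_mul _ (40 * q%:R * b + C)) => N N0.
have := HC N N0; have := sum_mangoldt_Lser q_gt0 wp ws w0 wb N0.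
set A := \sum_(1 <= m < N.+1) _ => HA; set B := \sum_(1 <= m < N.+1) _ => HB.
have -> : Lser w * (\sum_(1 <= n < N.+1) cop n * Lam n / n%:R) = A - B.
  rewrite /A /B mulr_sumr -sumrB; apply: eq_bigr => n _; rewrite /F; ring.
by apply: le_trans (ler_normB _ _) _; rewrite lerD.
Qed.

(** The dilates of [w] are invariant too, so all L-values vanish. Then, up to [O(1)],
    [sum_mangoldt_vanishing] evaluates the weighted sum of [Lam] as [- w 1 * ln N], and invariance
    evaluates it as [w 1 * ln N]. *)
Lemma dense_invariant_eq0 w n : periodic q w -> coprime_supported q w ->
  total q w = 0 -> dense_invariant w -> w n = 0.
Proof.
move=> wp ws w0 wi; case: (boolP (coprime q n)) => nq; last exact: ws.
suff H u : periodic q u -> coprime_supported q u -> total q u = 0 ->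
    dense_invariant u -> u 1%N = 0.
  have := H (dilate n w) (periodic_dilate n wp) (supported_dilate n ws)
    (total_dilate0 q_gt0 n wp ws w0) (dense_invariant_dilate n wi).
  by rewrite /dilate muln1.
move=> {n nq w wp ws w0 wi} wp ws w0 wi.
have [b b0 wb] := periodic_bounded q_gt0 wp.
have uL c : Lser (dilate c u) = 0.
  apply: dense_invariant_Lser; [exact: periodic_dilate|exact: supported_dilate|
    exact: total_dilate0|exact: dense_invariant_dilate].
pose F n := u n - cop n * u 1%N.
have Fp : periodic q F by move=> n; rewrite /F wp periodic_coprime_ind.
have Fs : coprime_supported q F.
  by move=> n nq; rewrite /F ws// supported_coprime_ind// mul0r subr0.
have FB c : log_dense c -> F c = 0.
  move=> cB; have [cq _] := cB; rewrite /F /coprime_ind cq mul1r.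
  by rewrite -{1}[c]mul1n wi// subrr.
have [C HC] := sum_vanishing_on_dense Fp Fs FB.
have [M M0 HM] := mertens_coprime R q_gt0.
apply: (@mertens_mul _ (4 * q%:R * b + C + `|u 1%N| * M)) => N N0.
have := HC N N0; have := sum_mangoldt_vanishing q_gt0 wp ws w0 wb uL N0.
have := HM N N0.
set S := \sum_(1 <= m < N.+1) cop m * _ / _ => HS.
set A := \sum_(1 <= m < N.+1) _ => HA; set B := \sum_(1 <= m < N.+1) _ => HB.
have BE : B = A - u 1%N * S.
  by rewrite /A /B /S mulr_sumr -sumrB; apply: eq_bigr => n _; rewrite /F; ring.
have E : u 1%N * S + u 1%N * S = (A + u 1%N * ln N%:R) - B + u 1%N * (S - ln N%:R).
  by rewrite BE; ring.
have : `|u 1%N * S + u 1%N * S| <= 4 * q%:R * b + C + `|u 1%N| * M.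
  rewrite E; apply: le_trans (ler_normD _ _) _; rewrite lerD//; last first.
    by rewrite normrM ler_wpM2l.
  by apply: le_trans (ler_normB _ _) _; rewrite lerD.
apply: le_trans; rewrite -mulr2n normrMn mulr2n.
by have := normr_ge0 (u 1%N * S); lra.
Qed.

(** In other words, the log-dense classes generate the unit group. The mean over the units is
    subtracted to reach [dense_invariant_eq0]. *)
Lemma dense_invariant_const w n : periodic q w -> coprime_supported q w ->
  dense_invariant w -> coprime q n -> w n = w 1%N.
Proof.
move=> wp ws wi nq; pose t := total q w / (totient q)%:R.
pose u k := w k - t * cop k.
have H k : u k = 0.
  apply: dense_invariant_eq0.
  - by move=> m; rewrite /u wp periodic_coprime_ind.
  - by move=> m mq; rewrite /u ws// supported_coprime_ind// mulr0 subr0.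
  - rewrite /total sumrB -mulr_sumr -/(total q cop) total_coprime_ind /t divfK ?subrr//.
    by rewrite pnatr_eq0 -lt0n totient_gt0.
  - move=> b c bB; have [bq _] := bB; rewrite /u wi// coprime_indM.
    by rewrite [cop b](_ : _ = 1) ?mulr1// /coprime_ind bq.
have := H n; have := H 1%N; rewrite /u /coprime_ind nq coprimen1 !mulr1.
by move=> /subr0_eq -> /subr0_eq ->.
Qed.

(* If all L-values vanish, the log-derivative sum of [v] is [- v 1 ln N] up to
   a bounded error, so at a maximum of [|v|] the log-dense classes must all
   carry the opposite value. *)
Lemma dense_flip v b : periodic q v -> coprime_supported q v -> total q v = 0 ->
  (forall c, Lser (dilate c v) = 0) -> (forall n, `|v n| <= `|v 1%N|) ->
  log_dense b -> v b = - v 1%N.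
Proof.
move=> vp vs v0 vL vm bB; have [bq bD] := bB.
case: (eqVneq (v 1%N) 0) => v1.
  by apply/eqP; rewrite v1 oppr0 -normr_le0 (le_trans (vm b))// v1 normr0.
pose F n := cop n * v 1%N ^+ 2 + v n * v 1%N.
have Fge n : 0 <= F n.
  rewrite /F; case: (boolP (coprime q n)) => nq; last first.
    by rewrite (vs _ nq) supported_coprime_ind// !mul0r addr0.
  rewrite /coprime_ind nq mul1r expr2 -mulrDl.
  have := vm n; case: (ltP (v 1%N) 0) => s; rewrite ler_norml.
    by rewrite ltr0_norm// => /andP[? ?]; rewrite mulr_le0//; lra.
  by rewrite ger0_norm// => /andP[? ?]; rewrite mulr_ge0//; lra.
suff Fb : F b = 0.
  move: Fb; rewrite /F /coprime_ind bq mul1r expr2 -mulrDl => /eqP.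
  rewrite mulf_eq0 (negbTE v1) orbF => /eqP; lra.
apply/eqP; apply: contra_notT bD => Fb.
have Fp : periodic q F by move=> n; rewrite /F vp periodic_coprime_ind.
have Fb0 : 0 < F b by rewrite lt_neqAle eq_sym Fb Fge.
have [M M0 HM] := mertens_coprime R q_gt0.
exists ((F b)^-1 * (v 1%N ^+ 2 * M + `|v 1%N| * (4 * q%:R * `|v 1%N|))) => N N0.
rewrite ler_pdivlMl//.
apply: (@le_trans _ _ (\sum_(1 <= n < N.+1) Lam n * (F n / n%:R))).
  rewrite mulr_sumr ler_sum// => n _; rewrite mulrCA ler_wpM2l ?mangoldt_ge0//.
  rewrite mulrA ler_wpM2r ?invr_ge0// /class_ind.
  by case: eqP => nb; rewrite ?mulr0 ?Fge// mulr1 -Fp -nb Fp.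
have := HM N N0; have := sum_mangoldt_vanishing q_gt0 vp vs v0 vm vL N0.
set A := \sum_(1 <= m < N.+1) _ => HA; set S := \sum_(1 <= m < N.+1) _ => HS.
have -> : \sum_(1 <= n < N.+1) Lam n * (F n / n%:R) =
  v 1%N ^+ 2 * (S - ln N%:R) + v 1%N * (A + v 1%N * ln N%:R).
  transitivity (v 1%N ^+ 2 * S + v 1%N * A); last by ring.
  by rewrite /S /A !mulr_sumr -big_split; apply: eq_bigr => n _; rewrite /F /=; ring.
apply: lerD.
  by rewrite ler_wpM2l ?sqr_ge0//; apply: le_trans HS; exact: ler_norm.
by apply: le_trans (ler_norm _) _; rewrite normrM ler_wpM2l.
Qed.

Lemma periodic_max v : exists c, forall r, (r < q)%N -> `|v r| <= `|v c|.
Proof.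
elim: q => [|k [c Hc]]; first by exists 0%N.
case: (leP `|v k| `|v c|) => vk.
  by exists c => r; rewrite ltnS leq_eqVlt => /orP[/eqP ->|/Hc].
exists k => r; rewrite ltnS leq_eqVlt => /orP[/eqP ->//|/Hc H].
exact: le_trans H (ltW vk).
Qed.

(** Suppose [v c] is nonzero of maximal modulus. [dense_flip], applied to dilates, says that a
    log-dense factor changes the sign of [v] wherever [|v|] is maximal. Expressions blind to this
    sign are dense-invariant, hence constant on the units: first the set where [|v|] is maximal,
    which makes [|v|] constant, then [v (k e) v k], which makes [v / v 1] a real character. *)
Theorem Lser_nonvanishing v n : periodic q v -> coprime_supported q v ->
  total q v = 0 -> (forall c, Lser (dilate c v) = 0) -> v n = 0.
Proof.
move=> vp vs v0 vL; have [c cmax] := periodic_max v.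
have cm k : `|v k| <= `|v c| by rewrite -vp cmax// ltn_mod.
case: (eqVneq (v c) 0) => [vc0|vc].
  by apply/eqP; rewrite -normr_le0 (le_trans (cm n))// vc0 normr0.
exfalso; have cq : coprime q c by apply: contraNT vc => /vs ->.
have flip b d : log_dense b -> `|v d| = `|v c| -> v (d * b)%N = - v d.
  move=> bB dE.
  have H1 e : Lser (dilate e (dilate d v)) = 0 by rewrite dilate_dilate vL.
  have H2 k : `|dilate d v k| <= `|dilate d v 1| by rewrite /dilate muln1 dE cm.
  have := dense_flip (periodic_dilate d vp)
    (supported_dilate d vs) (total_dilate0 q_gt0 d vp vs v0) H1 H2 bB.
  by rewrite /dilate muln1.
pose top k : R := (`|v k| == `|v c|)%:R.
have topp : periodic q top by move=> k; rewrite /top vp.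
have tops : coprime_supported q top.
  move=> k kq; rewrite /top vs// normr0.
  by rewrite eq_sym normr_eq0 (negbTE vc).
have topi : dense_invariant top.
  move=> b d bB; have [bq _] := bB; rewrite /top; congr ((nat_of_bool _)%:R); apply/eqP/eqP => E.
    (* To return from [d * b] to [d], multiply by [b] further until its [totient q]-th power, which
       is 1 modulo [q]. *)
    have Ei k : `|v (d * b ^ k.+1)%N| = `|v c|.
      elim: k => [|k IH]; first by rewrite expn1.
      by rewrite expnSr mulnA flip// normrN.
    have := Ei (totient q).-1; rewrite prednK ?totient_gt0// -vp -modnMmr.
    rewrite Euler_exp_totient; last by rewrite coprime_sym.
    by rewrite modnMmr muln1 vp.
  by rewrite flip// normrN.
have mE k : coprime q k -> `|v k| = `|v c|.
  move=> kq; have := dense_invariant_const topp tops topi kq.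
  rewrite -(dense_invariant_const topp tops topi cq) /top eqxx => /eqP.
  by rewrite eqr_nat eqb1 => /eqP.
have v1 : v 1%N != 0 by rewrite -normr_eq0 mE ?normr_eq0 ?coprimen1.
have mult d e : coprime q d -> coprime q e -> v (d * e)%N * v d = v e * v 1%N.
  move=> dq eq; pose w k := v (k * e)%N * v k.
  have wp : periodic q w by move=> k; rewrite /w vp -[v (_ * e)%N]vp modnMml vp.
  have ws : coprime_supported q w by move=> k kq; rewrite /w vs// ?vs ?mulr0// coprimeMr (negbTE kq).
  (* A log-dense [b] flips both factors of [w], which leaves the product unchanged. *)
  have wi : dense_invariant w.
    move=> b k bB; have [bq _] := bB; rewrite /w.
    case: (boolP (coprime q k)) => kq; last first.
      by rewrite ![v (k * _)%N]vs ?(vs _ kq) ?mulr0// coprimeMr (negbTE kq).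
    have keq : coprime q (k * e) by rewrite coprimeMr kq.
    by rewrite mulnAC (flip b (k * e)%N bB (mE _ keq)) (flip b k bB (mE _ kq)) mulrNN.
  by have := dense_invariant_const wp ws wi dq; rewrite /w mul1n.
pose eps k := v k / v 1%N.
have e1 : eps 1%N = 1 by rewrite /eps divff.
have sq k : coprime q k -> eps k * eps k = 1.
  move=> kq; rewrite /eps mulrACA -invfM.
  have -> : v k * v k = v 1%N * v 1%N.
    by rewrite -!expr2 -[LHS]real_normK ?num_real// mE// -(mE 1%N) ?coprimen1// real_normK ?num_real.
  by rewrite divff// mulf_neq0.
have eM d e : eps (d * e)%N = eps d * eps e.
  case: (boolP (coprime q d)) => dq; last first.
    have deq : ~~ coprime q (d * e) by rewrite coprimeMr (negbTE dq).
    by rewrite /eps (vs _ dq) (vs _ deq) !mul0r.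
  case: (boolP (coprime q e)) => eq; last first.
    have deq : ~~ coprime q (d * e) by rewrite coprimeMr (negbTE eq) andbF.
    by rewrite /eps (vs _ eq) (vs _ deq) !mul0r mulr0.
  have E : eps (d * e)%N * eps d = eps e.
    by rewrite /eps mulrACA mult// -invfM; field.
  by rewrite -E mulrCA sq// mulr1.
have := @Lser_real_character_neq0 R q q_gt0 eps _ _ _ e1 eM sq.
have -> : Lser eps = 0.
  have := @Lser_lin R q q_gt0 (v 1%N)^-1 v (fun=> 0) vp v0 (periodic_cst _ _).
  rewrite /total big1// => /(_ erefl); rewrite Lser0 addr0.
  have -> : (fun n => (v 1%N)^-1 * v n + 0) = eps.
    by apply/funext => k; rewrite addr0 mulrC.
  move=> ->; have := vL 1%N; rewrite (_ : dilate 1 v = v) => [->|]; first by rewrite mulr0.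
  by apply/funext => k; rewrite /dilate mul1n.
rewrite eqxx => F; suff : false by []; apply: F.
- by move=> k; rewrite /eps vp.
- by move=> k kq; rewrite /eps vs// mul0r.
- by rewrite /total -mulr_suml -/(total q v) v0 mul0r.
Qed.

End NonVanishing.

(** * Moebius sums over residue classes *)

Section MobiusSums.
Variables (R : realType) (q : nat).
Hypothesis q_gt0 : (0 < q)%N.
Local Notation mu := (@mobius R).
Local Notation cop := (@coprime_ind R q).
Local Notation ph := ((totient q)%:R : R).
Implicit Types (g u : nat -> R).

(** The counterpart of [sum_mangoldt_Lser]: [mu] convolved with 1 is supported at 1, so the double
    sum is the single term [u 1]. *)
Lemma sum_mobius_Lser u b N : periodic q u -> coprime_supported q u ->
  total q u = 0 -> (forall n, `|u n| <= b) -> (0 < N)%N ->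
  `|\sum_(1 <= n < N.+1) mu n * (n%:R^-1 * Lser (dilate n u))| <= `|u 1%N| + 4 * q%:R * b.
Proof.
move=> up us u0 ub N0; have b0 : 0 <= b := le_trans (normr_ge0 _) (ub 0%N).
have Nr := natr_gt0 R N0.
pose h k := u k / k%:R.
have := sum_dirichlet1 h N (@sum_mobius R).
rewrite sum_delta1// {1}/h divr1.
set A := \sum_(1 <= d < N.+1) _ => HA; set B := \sum_(1 <= n < N.+1) _.
have HB : `|A - B| <= 4 * q%:R * b.
  rewrite /A /B -sumrB; apply: le_trans (ler_norm_sum _ _ _) _.
  apply: (@le_trans _ _ (\sum_(1 <= m < N.+1) (4 * q%:R * b / N%:R))); last first.
    by rewrite sumr_const_nat subn1/= -[_ *+ N]mulr_natr divfK// gt_eqF.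
  apply: ler_sum_nat => m /andP[m0 _].
  rewrite -mulrBr normrM -[leRHS]mul1r ler_pM ?normr_mobius//.
  have := Lser_dilate_bound q_gt0 up us u0 ub m0 N0.
  by rewrite mulr_sumr; under eq_bigr do rewrite mulrCA -invfM -natrM.
have := ler_normB A (A - B); rewrite subKr => /le_trans -> //.
by apply: lerD => //; rewrite HA.
Qed.

Lemma total_lin (x : R) g u : total q (fun n => x * g n + u n) = x * total q g + total q u.
Proof. by rewrite /total big_split/= mulr_sumr. Qed.

Lemma sum_dilates u n : periodic q u -> coprime_supported q u ->
  \sum_(0 <= c < q) cop c * u (c * n)%N = cop n * total q u.
Proof.
move=> up us.
have -> : \sum_(0 <= c < q) cop c * u (c * n)%N = total q (dilate n u).
  by apply: eq_bigr => c _; rewrite coprime_ind_mul// mulnC.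
rewrite /coprime_ind; case: (boolP (coprime q n)) => nq.
  by rewrite total_dilate// mul1r.
by rewrite (dilate_not_coprime us nq) /total big1// mul0r.
Qed.

(** The dilates of a mean-zero [u] by all units add up to the zero function, and [Lser] is linear on
    mean-zero functions. *)
Lemma sum_Lser_dilates u : periodic q u -> coprime_supported q u -> total q u = 0 ->
  \sum_(0 <= c < q) cop c * Lser (dilate c u) = 0.
Proof.
move=> up us u0.
pose S k n := \sum_(0 <= c < k) cop c * u (c * n)%N.
have Sp k : periodic q (S k).
  by move=> n; apply: eq_bigr => c _; rewrite -up modnMmr up.
have S0 k : total q (S k) = 0.
  rewrite /total exchange_big/= big1// => c _.
  by rewrite -mulr_sumr -/(total q (dilate c u)) total_dilate0// mulr0.
have H k : \sum_(0 <= c < k) cop c * Lser (dilate c u) = Lser (S k).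
  elim: k => [|k IH].
    rewrite big_nil (_ : S 0%N = fun=> 0) ?Lser0//.
    by apply/funext => n; rewrite /S big_nil.
  rewrite big_nat_recr//= IH addrC -(Lser_lin q_gt0)//.
  - by congr Lser; apply/funext => n; rewrite /S big_nat_recr//= addrC.
  - exact: periodic_dilate.
  - exact: total_dilate0.
rewrite H (_ : S q = fun=> 0) ?Lser0//.
by apply/funext => n; rewrite /S sum_dilates// u0 mulr0.
Qed.

(* [T] maps a zero-mean function [u] to its L-values [c |-> L(u(c .))] and is the
   identity on the constant functions and off the classes coprime to [q], so
   nonvanishing makes it injective, hence surjective. *)
Let ord_mod n : 'I_q := Ordinal (ltn_pmod n q_gt0).
Let Wf (w : 'rV[R]_q) n : R := cop n * w 0 (ord_mod n).
Let Wz (w : 'rV[R]_q) n : R := - (total q (Wf w) / ph) * cop n + Wf w n.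
Let T (w : 'rV[R]_q) : 'rV[R]_q := \row_c
  (cop c * (Lser (dilate c (Wz w)) + total q (Wf w) / ph) + (1 - cop c) * w 0 c).

Lemma Wf_periodic w : periodic q (Wf w).
Proof.
move=> n; rewrite /Wf periodic_coprime_ind; congr (_ * w _ _).
by apply: val_inj; rewrite /= modn_mod.
Qed.

Lemma Wf_supp w : coprime_supported q (Wf w).
Proof. by move=> n nq; rewrite /Wf supported_coprime_ind// mul0r. Qed.

Lemma Wz_periodic w : periodic q (Wz w).
Proof. by move=> n; rewrite /Wz Wf_periodic periodic_coprime_ind. Qed.

Lemma Wz_supp w : coprime_supported q (Wz w).
Proof.
by move=> n nq; rewrite /Wz Wf_supp// supported_coprime_ind// mulr0 add0r.
Qed.

Lemma Wz_total w : total q (Wz w) = 0.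
Proof.
by rewrite total_lin total_coprime_ind mulNr divfK ?addNr// gt_eqF// totientr_gt0.
Qed.

Lemma T_linear : linear T.
Proof.
move=> x u v; apply/rowP => c; rewrite !mxE.
have WfE : Wf (x *: u + v) = (fun n => x * Wf u n + Wf v n).
  by apply/funext => n; rewrite /Wf !mxE; ring.
have WzE : Wz (x *: u + v) = (fun n => x * Wz u n + Wz v n).
  apply/funext => n; rewrite /Wz WfE total_lin; ring.
have -> : Lser (dilate c (Wz (x *: u + v))) =
   x * Lser (dilate c (Wz u)) + Lser (dilate c (Wz v)).
  rewrite WzE -(Lser_lin q_gt0)//; try exact: periodic_dilate (Wz_periodic _).
    exact: total_dilate0 (Wz_periodic _) (Wz_supp _) (Wz_total _).
  exact: total_dilate0 (Wz_periodic _) (Wz_supp _) (Wz_total _).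
by rewrite WfE total_lin; ring.
Qed.

(** [T] preserves the total over the units. So kernel elements, and preimages of mean-zero
    functions, have mean zero themselves, which removes the correction by the mean. *)
Lemma total_of_T w : \sum_(0 <= c < q) cop c * T w 0 (ord_mod c) = total q (Wf w).
Proof.
transitivity (\sum_(0 <= c < q) (cop c * Lser (dilate c (Wz w)) +
    total q (Wf w) / ph * cop c)).
  apply: eq_big_nat => c /andP[_ cq].
  rewrite mxE /= (modn_small cq) /coprime_ind.
  by case: coprime; rewrite ?mul0r ?mulr0 ?addr0 ?mul1r ?mulr1 ?subrr ?mul0r ?addr0.
rewrite big_split/= sum_Lser_dilates ?add0r; last 3 first.
- exact: Wz_periodic.
- exact: Wz_supp.
- exact: Wz_total.
by rewrite -mulr_sumr -/(total q cop) total_coprime_ind divfK// gt_eqF// totientr_gt0.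
Qed.

Lemma T_inj w : T w = 0 -> w = 0.
Proof.
move=> Tw; have t0 : total q (Wf w) = 0.
  by rewrite -total_of_T Tw big1// => c _; rewrite mxE mulr0.
have Tc c : T w 0 c = 0 by rewrite Tw mxE.
have L0 c : Lser (dilate c (Wz w)) = 0.
  rewrite -(dilate_modn c (@Wz_periodic w)).
  case: (boolP (coprime q c)) => cq; last first.
    by rewrite (dilate_not_coprime (Wz_supp w)) ?Lser0// coprime_modr.
  have := Tc (ord_mod c); rewrite mxE /= t0 mul0r addr0 periodic_coprime_ind.
  by rewrite /coprime_ind cq mul1r subrr mul0r addr0.
apply/rowP => c; rewrite mxE.
have oc : ord_mod c = c by apply: val_inj; rewrite /= modn_small.
case: (boolP (coprime q c)) => cq; last first.
  by have := Tc c; rewrite mxE /coprime_ind (negbTE cq) mul0r add0r subr0 mul1r.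
have := Lser_nonvanishing q_gt0 c (@Wz_periodic w) (@Wz_supp w) (Wz_total w) L0.
by rewrite /Wz t0 mul0r oppr0 mul0r add0r /Wf oc /coprime_ind cq mul1r.
Qed.

(** This turns a sum of [mu n * g n / n] into the bounded sum of [sum_mobius_Lser]. *)
Lemma Lser_surjective g : periodic q g -> coprime_supported q g -> total q g = 0 ->
  exists u, [/\ periodic q u, coprime_supported q u, total q u = 0 &
    forall n, g n = Lser (dilate n u)].
Proof.
move=> gp gs g0.
pose f : {linear 'rV[R]_q -> 'rV[R]_q} :=
  HB.pack T (GRing.isLinear.Build R _ _ _ T T_linear).
have Aunit : lin1_mx f \in unitmx.
  rewrite -row_free_unit -kermx_eq0; apply/eqP/row_matrixP => i; rewrite row0.
  apply: T_inj; have -> : T (row i (kermx (lin1_mx f))) = row i (kermx (lin1_mx f)) *m lin1_mx f.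
    by rewrite mul_rV_lin1.
  by rewrite -row_mul mulmx_ker row0.
pose w := (\row_c g c) *m invmx (lin1_mx f).
have Tw : T w = \row_c g c.
  have -> : T w = w *m lin1_mx f by rewrite mul_rV_lin1.
  by rewrite /w mulmxKV.
have t0 : total q (Wf w) = 0.
  rewrite -total_of_T Tw -[RHS]g0; apply: eq_bigr => c _.
  by rewrite mxE /= gp; have := coprime_ind_mul c 1 gs; rewrite muln1.
exists (Wz w); split; [exact: Wz_periodic|exact: Wz_supp|exact: Wz_total|].
move=> n; rewrite -(dilate_modn n (@Wz_periodic w)) -gp.
have := congr1 (fun M : 'rV[R]_q => M 0 (ord_mod n)) Tw; rewrite !mxE /= t0 mul0r addr0.
rewrite /coprime_ind; case: (boolP (coprime q (n %% q))) => nq.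
  by rewrite mul1r subrr mul0r addr0.
by move=> _; rewrite gs// (dilate_not_coprime (Wz_supp w) nq) Lser0.
Qed.

(** The mean part, which L-values do not reach. Summing [sum_mobius] against [cop], the inner counts
    are [(ph / q) N / d + O(1)], so [N] times the wanted sum is [O(N)]. *)
Lemma sum_mobius_coprime N : (0 < N)%N ->
  `|\sum_(1 <= n < N.+1) mu n * (cop n / n%:R)| <= q%:R / ph * (2 + 5 * q%:R).
Proof.
move=> N0; have Nr := natr_gt0 R N0; have N1 := natr_ge1 R N0.
have qr := natr_gt0 R q_gt0; have q1 := q_ge1 R q_gt0.
have p0 := totientr_gt0 R q_gt0.
have pq : ph / q%:R <= 1.
  rewrite ler_pdivrMr// mul1r -(@total_coprime_ind R).
  by have := norm_total q (@coprime_ind_le1 R q); rewrite mulr1; apply: le_trans; exact: ler_norm.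
have := sum_dirichlet1 cop N (@sum_mobius R).
rewrite sum_delta1// {1}/coprime_ind coprimen1.
set A := \sum_(1 <= d < N.+1) _ => HA; set B := \sum_(1 <= n < N.+1) _.
have HB : `|A - ph / q%:R * N%:R * B| <= (4 * q%:R + 1) * N%:R.
  rewrite /A /B mulr_sumr -sumrB; apply: le_trans (ler_norm_sum _ _ _) _.
  apply: (@le_trans _ _ (\sum_(1 <= m < N.+1) (4 * q%:R + 1))); last first.
    by rewrite sumr_const_nat subn1/= -[_ *+ N]mulr_natr.
  apply: ler_sum_nat => d /andP[d0 _].
  have dr := natr_gt0 R d0.
  have := sum_periodic q_gt0 (N %/ d) (@periodic_coprime_ind R q) (@coprime_ind_le1 R q).
  rewrite total_coprime_ind mulr1; set S := \sum_(1 <= k < _) _ => HS.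
  have -> : \sum_(1 <= n < (N %/ d).+1) cop (d * n)%N = cop d * S.
    by rewrite /S mulr_sumr; apply: eq_bigr => n _; rewrite coprime_indM.
  have -> : mu d * (cop d * S) - ph / q%:R * N%:R * (mu d * (cop d / d%:R)) =
    (mu d * cop d) * ((S - ph / q%:R * (N %/ d)%:R) + ph / q%:R * ((N %/ d)%:R - N%:R / d%:R)).
    by ring.
  rewrite normrM -[leRHS]mul1r ler_pM//.
    by rewrite normrM mulr_ile1// ?normr_mobius ?coprime_ind_le1.
  apply: le_trans (ler_normD _ _) _; apply: lerD => //.
  rewrite normrM mulr_ile1//; first by rewrite ger0_norm// divr_ge0// ltW.
  have [? ?] := @floor_bounds R N d d0.
  by rewrite ler_norml; apply/andP; split; lra.
have : `|ph / q%:R * N%:R * B| <= (2 + 5 * q%:R) * N%:R.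
  have := ler_normB A (A - ph / q%:R * N%:R * B); rewrite subKr => /le_trans -> //.
  by move: HB; rewrite -HA normr1 => HB; nra.
rewrite normrM ger0_norm; last by rewrite !mulr_ge0 ?invr_ge0 ?(ltW p0).
rewrite mulrAC ler_pM2r// => HH.
by rewrite -[q%:R / ph]invf_div ler_pdivlMl// divr_gt0.
Qed.

Theorem mobius_sum_bounded g : periodic q g -> coprime_supported q g ->
  exists2 C : R, 0 <= C & forall N, (0 < N)%N ->
    `|\sum_(1 <= n < N.+1) mu n * (g n / n%:R)| <= C.
Proof.
move=> gp gs; pose t := total q g / ph.
pose u n := - t * cop n + g n.
have up : periodic q u by move=> n; rewrite /u gp periodic_coprime_ind.
have us : coprime_supported q u.
  by move=> n nq; rewrite /u gs// supported_coprime_ind// mulr0 addr0.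
have u0 : total q u = 0.
  by rewrite total_lin total_coprime_ind /t mulNr divfK ?addNr// gt_eqF// totientr_gt0.
have [w [wp ws w0 wE]] := Lser_surjective up us u0.
have [b b0 wb] := periodic_bounded q_gt0 wp.
have K0 : 0 <= q%:R / ph * (2 + 5 * q%:R).
  by rewrite mulr_ge0 ?divr_ge0 ?addr_ge0 ?mulr_ge0.
exists (`|t| * (q%:R / ph * (2 + 5 * q%:R)) + (`|w 1%N| + 4 * q%:R * b)).
  apply: addr_ge0; first exact: mulr_ge0.
  by apply: addr_ge0 => //; rewrite !mulr_ge0.
move=> N N0; have := sum_mobius_coprime N0; have := sum_mobius_Lser wp ws w0 wb N0.
set A := \sum_(1 <= n < N.+1) _ => HA; set B := \sum_(1 <= n < N.+1) _ => HB.
have -> : \sum_(1 <= n < N.+1) mu n * (g n / n%:R) = t * B + A.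
  rewrite /A /B mulr_sumr -big_split/=; apply: eq_bigr => n _.
  by rewrite -wE /u; ring.
by apply: le_trans (ler_normD _ _) _; rewrite lerD// normrM ler_wpM2l.
Qed.

End MobiusSums.

(** * Moebius sums bounded through Selberg's formula *)

Section MobiusInequality.
Variables (R : realType) (q : nat).
Hypothesis q_gt0 : (0 < q)%N.
Local Notation mu := (@mobius R).
Local Notation Lam := (@mangoldt R).
Local Notation cop := (@coprime_ind R q).
Local Notation ph := ((totient q)%:R : R).
Local Notation e_ := (class_ind R q).
Implicit Types (g : nat -> R).

Definition mertens_sum g N : R := \sum_(1 <= n < N.+1) mu n * g n.
Local Notation M := mertens_sum.

Lemma mertens_sum_lipschitz g m n : (forall k, `|g k| <= 1) -> (m <= n)%N ->
  `|M g n - M g m| <= n%:R - m%:R.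
Proof.
move=> gb mn; rewrite /M (@big_cat_nat _ _ _ m.+1 1 n.+1)//= addrAC subrr add0r.
apply: le_trans (ler_norm_sum _ _ _) _.
apply: (@le_trans _ _ (\sum_(m.+1 <= k < n.+1) 1)).
  by apply: ler_sum => k _; rewrite normrM mulr_ile1// normr_mobius.
by rewrite sumr_const_nat subSS natrB.
Qed.

Lemma mertens_sum0 g : M g 0 = 0.
Proof. by rewrite /M big_nil. Qed.

Lemma norm_mertens_sum g n : (forall k, `|g k| <= 1) -> `|M g n| <= n%:R.
Proof.
move=> gb; have := mertens_sum_lipschitz gb (leq0n n).
by rewrite mertens_sum0 !subr0.
Qed.

Lemma mertens_sum_ln g N : (forall k, `|g k| <= 1) -> (0 < N)%N ->
  `|M g N * ln N%:R + \sum_(1 <= k < N.+1) Lam k * M (dilate k g) (N %/ k)| <= N%:R.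
Proof.
move=> gb N0; have Nr := natr_gt0 R N0.
have E : \sum_(1 <= k < N.+1) - (mu k * ln k%:R) * g k =
    \sum_(1 <= k < N.+1) Lam k * M (dilate k g) (N %/ k).
  exact: (@sum_dirichlet R Lam mu (fun k => - (mu k * ln k%:R)) g N
    (fun k k0 => sum_mangoldt_mobius R k0)).
rewrite -E /M mulr_suml -big_split/=; apply: le_trans (sum_ln_div (lexx N%:R)).
apply: le_trans (ler_norm_sum _ _ _) _.
apply: ler_sum_nat => n /andP[n0 nN]; rewrite ln_div ?posrE ?ltr0n//.
have -> : mu n * g n * ln N%:R + - (mu n * ln n%:R) * g n =
  mu n * g n * (ln N%:R - ln n%:R) by ring.
have l0 : 0 <= ln N%:R - ln n%:R :> R by rewrite subr_ge0 lnn_le.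
rewrite normrM (ger0_norm l0) ler_piMl// normrM mulr_ile1// normr_mobius//.
Qed.

Lemma sum_divn_mangoldt N : (0 < N)%N ->
  \sum_(1 <= m < N.+1) Lam m * (N %/ m)%:R <= N%:R * ln N%:R.
Proof.
move=> N0; rewrite -sum_ln_mangoldt.
apply: (@le_trans _ _ (\sum_(1 <= k < N.+1) ln N%:R)).
  by apply: ler_sum_nat => k /andP[_ kN]; rewrite lnn_le.
by rewrite sumr_const_nat subn1/= -[_ *+ N]mulr_natl.
Qed.

(** [mertens_sum_ln] is applied twice, the second time at [N %/ m] after writing
    [ln N = ln m + ln (N / m)]. The terms with [Lam * ln] and with [Lam] convolved with itself have
    opposite signs; absolute values add them up to [mangoldt2], whose averages are known. *)
Lemma mertens_sum_ln_sqr g N : (forall k, `|g k| <= 1) -> (0 < N)%N ->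
  `|M g N| * ln N%:R ^+ 2 <=
  \sum_(1 <= n < N.+1) mangoldt2 R n * `|M (dilate n g) (N %/ n)| + 8 * N%:R * (1 + ln N%:R).
Proof.
move=> gb N0; have Nr := natr_gt0 R N0; have l0 := lnn_ge0 R N.
have := mertens_sum_ln gb N0.
set A := \sum_(1 <= k < N.+1) _ => HA.
pose Mm m := M (dilate m g) (N %/ m).
have gbd m k : `|dilate m g k| <= 1 by exact: gb.
pose D m := \sum_(1 <= k < (N %/ m).+1) Lam k * M (dilate (m * k) g) (N %/ (m * k)).
have step m : (0 < m <= N)%N ->
   `|Mm m * ln N%:R| <= `|Mm m| * ln m%:R + `|D m| + 1 + (N %/ m)%:R.
  move=> /andP[m0 mN]; have mr := natr_gt0 R m0.
  have Y0 : (0 < N %/ m)%N by rewrite divn_gt0.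
  have mN' : (0 < m <= N)%N by rewrite m0.
  have /andP[L0 L1] := ln_divn R mN'.
  have := mertens_sum_ln (gbd m) Y0.
  have -> : \sum_(1 <= k < (N %/ m).+1) Lam k * M (dilate k (dilate m g)) (N %/ m %/ k) = D m.
    by apply: eq_bigr => k _; rewrite dilate_dilate divnMA.
  rewrite -/(Mm m) => H1.
  have -> : Mm m * ln N%:R = Mm m * ln m%:R +
    Mm m * (ln (N%:R / m%:R) - ln (N %/ m)%:R) + (Mm m * ln (N %/ m)%:R + D m) - D m.
    by rewrite ln_div ?posrE//; ring.
  apply: le_trans (ler_normB _ _) _.
  apply: le_trans (lerD (ler_normD _ _) (lexx _)) _.
  apply: le_trans (lerD (lerD (ler_normD _ _) (lexx _)) (lexx _)) _.
  have : `|Mm m * ln m%:R| = `|Mm m| * ln m%:R.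
    by rewrite normrM [`|ln _|]ger0_norm// lnn_ge0.
  have : `|Mm m * (ln (N%:R / m%:R) - ln (N %/ m)%:R)| <= 1.
    rewrite normrM [X in _ * X]ger0_norm//.
    apply: le_trans (ler_pM _ _ (norm_mertens_sum _ (gbd m)) L1) _ => //.
    by rewrite divff// pnatr_eq0 -lt0n.
  lra.
have AN : `|A * ln N%:R| <= \sum_(1 <= m < N.+1) Lam m * (`|Mm m| * ln m%:R + `|D m| + 1 + (N %/ m)%:R).
  rewrite /A mulr_suml; apply: le_trans (ler_norm_sum _ _ _) _.
  apply: ler_sum_nat => m mN.
  by rewrite -mulrA normrM (ger0_norm (mangoldt_ge0 _ _)) ler_wpM2l ?mangoldt_ge0// step.
have E1 : \sum_(1 <= m < N.+1) Lam m * `|D m| <=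
   \sum_(1 <= n < N.+1) (\sum_(d <- divisors n) Lam d * Lam (n %/ d)%N) * `|Mm n|.
  have H k : (0 < k)%N -> \sum_(d <- divisors k) Lam d * Lam (k %/ d)%N =
    (fun n => \sum_(d <- divisors n) Lam d * Lam (n %/ d)%N) k by [].
  rewrite (@sum_dirichlet R Lam Lam _ (fun n => `|Mm n|) N H).
  apply: ler_sum => m _; rewrite ler_wpM2l ?mangoldt_ge0//.
  apply: le_trans (ler_norm_sum _ _ _) _; apply: ler_sum => k _.
  by rewrite normrM (ger0_norm (mangoldt_ge0 _ _)).
have E2 : \sum_(1 <= m < N.+1) Lam m * (`|Mm m| * ln m%:R + `|D m| + 1 + (N %/ m)%:R) <=
   \sum_(1 <= n < N.+1) mangoldt2 R n * `|Mm n| + 8 * N%:R + N%:R * ln N%:R.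
  have -> : \sum_(1 <= m < N.+1) Lam m * (`|Mm m| * ln m%:R + `|D m| + 1 + (N %/ m)%:R) =
    \sum_(1 <= m < N.+1) Lam m * ln m%:R * `|Mm m| + \sum_(1 <= m < N.+1) Lam m * `|D m| +
    psi R N + \sum_(1 <= m < N.+1) Lam m * (N %/ m)%:R.
    by rewrite /psi -!big_split/=; apply: eq_bigr => m _; ring.
  have -> : \sum_(1 <= n < N.+1) mangoldt2 R n * `|Mm n| =
    \sum_(1 <= m < N.+1) Lam m * ln m%:R * `|Mm m| +
    \sum_(1 <= n < N.+1) (\sum_(d <- divisors n) Lam d * Lam (n %/ d)%N) * `|Mm n|.
    by rewrite -big_split/=; apply: eq_bigr => m _; rewrite /mangoldt2 mulrDl.
  by have := psi_le R N; have := sum_divn_mangoldt N0; lra.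
have -> : `|M g N| * ln N%:R ^+ 2 = `|(M g N * ln N%:R + A) * ln N%:R - A * ln N%:R|.
  rewrite mulrDl addrK -mulrA normrM -expr2; congr (_ * _).
  by rewrite ger0_norm// sqr_ge0.
apply: le_trans (ler_normB _ _) _.
have : `|(M g N * ln N%:R + A) * ln N%:R| <= N%:R * ln N%:R.
  by rewrite normrM [X in _ * X]ger0_norm// ler_wpM2r.
have := mulr_ge0 (ltW Nr) l0.
by move: E2; rewrite -/(Mm _) => E2; rewrite -[X in _ <= X + _]/(\sum_(1 <= n < N.+1) mangoldt2 R n * `|Mm n|); lra.
Qed.

Lemma sum_hyperbola_sym (V : nmodType) N (F : nat -> nat -> V) :
  \sum_(1 <= d < N.+1) \sum_(1 <= n < (N %/ d).+1) F d n =
  \sum_(1 <= n < N.+1) \sum_(1 <= d < (N %/ n).+1) F d n.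
Proof.
rewrite sum_hyperbola (sum_hyperbola N (fun n d => F d n)).
apply: eq_big_nat => k /andP[k0 _].
rewrite sum_codivisors// !big_seq; apply: eq_bigr => d.
by rewrite -dvdn_divisors// => dk; rewrite divnA// mulKn.
Qed.

Lemma inverse_class a n : coprime q a -> coprime q n ->
  exists c, [/\ (c < q)%N, coprime q c & (n * c = a %[mod q])%N].
Proof.
move=> aq nq; exists ((a * n ^ (totient q).-1) %% q)%N; split.
- by rewrite ltn_mod.
- by rewrite coprime_modr coprimeMr aq coprimeXr.
rewrite modnMmr mulnCA -expnS prednK ?totient_gt0// -modnMmr.
by rewrite Euler_exp_totient ?modnMmr ?muln1// coprime_sym.
Qed.

(** For [n] coprime to [q] the dilate is the indicator of [c = a / n], which the sum singles out. In
    this form the dependence on [n] is carried by [dilate c (e_ a) n], a class function to which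
    Selberg's formula applies. *)
Lemma mertens_sum_dilate_class a n y : coprime q a ->
  `|M (dilate n (e_ a)) y| <=
  \sum_(0 <= c < q | coprime q c) dilate c (e_ a) n * `|M (e_ c) y|.
Proof.
move=> aq; have pos (P : pred nat) : 0 <= \sum_(0 <= c < q | P c) dilate c (e_ a) n * `|M (e_ c) y|.
  by apply: sumr_ge0 => c _; rewrite mulr_ge0// /dilate /class_ind.
case: (boolP (coprime q n)) => nq; last first.
  rewrite (dilate_not_coprime (supported_class_ind R aq) nq) /M big1 ?normr0//.
  by move=> k _; rewrite mulr0.
have [c [cq cc ncE]] := inverse_class aq nq.
have -> : dilate n (e_ a) = e_ c.
  apply/funext => k; rewrite /dilate /class_ind.
  by rewrite -ncE coprime_eqmodl.
rewrite big_mkcond (bigD1_seq c) ?iota_uniq ?mem_index_iota//= cc.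
rewrite {1}/dilate /class_ind mulnC ncE eqxx mul1r lerDl -big_mkcondr/=.
exact: pos.
Qed.

(* Abel summation against Selberg's formula: on average [mangoldt2 n] is
   [2 ln n / ph] on each class. *)
Lemma sum_differences_mangoldt2 : exists2 C : R, 0 <= C &
  forall (r : nat -> R) g, class_fun q g -> total q g = 1 ->
  r 0%N = 0 -> (forall k, `|r k.+1 - r k| <= 1) -> (forall k, 0 <= r k <= k%:R) ->
  forall N, (0 < N)%N ->
  \sum_(1 <= n < N.+1) mangoldt2 R n * g n * r (N %/ n)%N <=
  2 / ph * N%:R * \sum_(1 <= k < N.+1) r k / (k%:R * k.+1%:R) * (ln N%:R - ln k%:R) +
  C * N%:R * (1 + ln N%:R).
Proof.
have [C C0 HC] := selberg R q_gt0.
have p0 := @totientr_gt0 R q q_gt0; have p1 := @totient_ge1 R q q_gt0.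
have ph2 : 2 / ph <= 2 by rewrite ler_pdivrMr//; lra.
have ph20 : 0 < 2 / ph by rewrite divr_gt0.
exists (C + 6) => [|r g gc g1 r0 rlip rk N N0]; first by rewrite addr_ge0.
have Nr := natr_gt0 R N0; have N1 := natr_ge1 R N0.
pose Dl k := r k - r k.-1.
have Dl1 k : (0 < k)%N -> `|Dl k| <= 1 by case: k => // k _; exact: rlip.
have rE k : r k = \sum_(1 <= j < k.+1) Dl j.
  elim: k => [|k IH]; first by rewrite big_nil.
  by rewrite big_nat_recr//= -IH /Dl /= addrC subrK.
pose S y := \sum_(1 <= n < y.+1) mangoldt2 R n * g n.
(* Expanding [r (N %/ n)] into increments and exchanging the sums brings in the partial sums
   [S (N %/ k)], which are close to [(2 / ph) N w k]; [E3] sums by parts back to [r]. *)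
have E1 : \sum_(1 <= n < N.+1) mangoldt2 R n * g n * r (N %/ n)%N =
   \sum_(1 <= k < N.+1) Dl k * S (N %/ k)%N.
  under eq_bigr do rewrite rE mulr_sumr.
  rewrite sum_hyperbola_sym; apply: eq_bigr => k _.
  by rewrite /S mulr_sumr; apply: eq_bigr => n _; rewrite mulrC.
pose w k : R := (ln N%:R - ln k%:R) * k%:R^-1.
have Sb k : (0 < k <= N)%N -> `|S (N %/ k)%N - 2 / ph * (N%:R * w k)| <= (C + 2) * N%:R * k%:R^-1.
  move=> /andP[k0 kN]; have kr := natr_gt0 R k0.
  have Y0 : (0 < N %/ k)%N by rewrite divn_gt0.
  have kN' : (0 < k <= N)%N by rewrite k0.
  have /andP[L0 L1] := ln_divn R kN'.
  have [Yy yY] := @floor_bounds R N k k0.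
  have := HC g (N %/ k)%N gc Y0; rewrite g1 -/(S _) div1r => HS.
  have y0 : 0 < N%:R / k%:R :> R by rewrite divr_gt0.
  have ly := ln_le_sub1 y0.
  have Yr := natr_gt0 R Y0; have lY := lnn_ge0 R (N %/ k).
  have -> : N%:R * w k = N%:R / k%:R * ln (N%:R / k%:R).
    by rewrite /w ln_div ?posrE//; ring.
  rewrite -[(C + 2) * _ * _]mulrA.
  move: L0 L1 Yy yY HS y0 ly; set y := N%:R / k%:R; set Y := (N %/ k)%N in Y0 Yr lY *.
  move=> L0 L1 Yy yY HS y0 ly.
  have -> : S Y - 2 / ph * (y * ln y) = (S Y - 2 * ph^-1 * (Y%:R * ln Y%:R))
      - 2 / ph * (y * ln y - Y%:R * ln Y%:R) by ring.
  apply: le_trans (ler_normB _ _) _.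
  rewrite [leRHS]mulrDl; apply: lerD.
    by apply: le_trans HS _; rewrite ler_wpM2l.
  rewrite normrM (gtr0_norm ph20) ler_pM ?(ltW ph20)//.
  have -> : y * ln y - Y%:R * ln Y%:R = (y - Y%:R) * ln y + Y%:R * (ln y - ln Y%:R) by ring.
  have H1 : Y%:R * (ln y - ln Y%:R) <= 1.
    apply: (@le_trans _ _ (Y%:R * Y%:R^-1)); first by rewrite ler_pM2l.
    by rewrite divff// gt_eqF.
  have H2 : 0 <= Y%:R * (ln y - ln Y%:R) by rewrite mulr_ge0// ltW.
  have H3 : 0 <= (y - Y%:R) * ln y by rewrite mulr_ge0//; lra.
  have H4 : (y - Y%:R) * ln y <= ln y by rewrite ler_piMl//; lra.
  by rewrite ger0_norm; lra.
rewrite E1.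
have E2 : \sum_(1 <= k < N.+1) Dl k * S (N %/ k)%N <=
   2 / ph * N%:R * \sum_(1 <= k < N.+1) Dl k * w k + (C + 2) * N%:R * (1 + ln N%:R).
  apply: (@le_trans _ _ (2 / ph * N%:R * (\sum_(1 <= k < N.+1) Dl k * w k) +
     \sum_(1 <= k < N.+1) (C + 2) * N%:R * k%:R^-1)).
    rewrite mulr_sumr -big_split/=; apply: ler_sum_nat => k kN.
    have := Sb k kN; have : `|Dl k| <= 1 by apply: Dl1; case/andP: kN.
    set d := Dl k; set s := S _; set b := (C + 2) * _ * _ => H1 H2.
    have : `|d * (s - 2 / ph * (N%:R * w k))| <= b.
      by rewrite normrM; apply: le_trans H2; rewrite ler_piMl.
    rewrite ler_norml => /andP[_]; lra.
  rewrite lerD2l -mulr_sumr ler_wpM2l ?mulr_ge0 ?addr_ge0//; exact: sum_inv_le.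
apply: le_trans E2 _.
have E3 : \sum_(1 <= k < N.+1) Dl k * w k <=
   \sum_(1 <= k < N.+1) r k / (k%:R * k.+1%:R) * (ln N%:R - ln k%:R) + (1 + ln N%:R).
  rewrite Abel_sum -rE.
  have first : r N * w N.+1 <= 0.
    have /andP[rN _] := rk N; rewrite mulr_ge0_le0// mulr_le0_ge0 ?invr_ge0//.
    by rewrite subr_le0 lnn_le.
  apply: (@le_trans _ _ (0 + (\sum_(1 <= k < N.+1)
    (r k / (k%:R * k.+1%:R) * (ln N%:R - ln k%:R) + k%:R^-1)))).
    apply: lerD first _; apply: ler_sum_nat => k /andP[k0 kN].
    rewrite -rE; have kr := natr_gt0 R k0.
    have -> : w k - w k.+1 = (k%:R * k.+1%:R)^-1 * (ln N%:R - ln k%:R) +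
       (ln k.+1%:R - ln k%:R) * k.+1%:R^-1.
      by rewrite invM_succ// /w; ring.
    rewrite mulrDr [r k * (_^-1 * _)]mulrA lerD2l.
    have /andP[rk0 rkk] := rk k.
    have := lnS_le R k0; have : 0 <= ln k.+1%:R - ln k%:R :> R by rewrite subr_ge0 lnn_le.
    move=> H1 H2; apply: (@le_trans _ _ (k%:R * (k%:R^-1 * k.+1%:R^-1))).
      rewrite ler_pM ?mulr_ge0 ?invr_ge0// ler_wpM2r ?invr_ge0//.
    by rewrite mulrA divff ?gt_eqF// mul1r lef_pV2 ?posrE ?ltr0n// ler_nat.
  rewrite add0r big_split/= lerD2l; exact: sum_inv_le.
set X := \sum_(1 <= k < N.+1) Dl k * w k in E3 *.
set Z := \sum_(1 <= k < N.+1) _ in E3 *.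
have l0 := lnn_ge0 R N.
have : 2 / ph * N%:R * X <= 2 / ph * N%:R * (Z + (1 + ln N%:R)).
  by rewrite ler_wpM2l// mulr_ge0// ltW.
have : 2 / ph * (N%:R * (1 + ln N%:R)) <= 2 * (N%:R * (1 + ln N%:R)).
  by rewrite ler_wpM2r// mulr_ge0// ?ltW//; lra.
have : 0 <= N%:R * (1 + ln N%:R) :> R by rewrite mulr_ge0//; lra.
by lra.
Qed.

End MobiusInequality.

(** * Moebius sums over a class are [o(N)] *)

Section Iteration.
Variables (R : realType) (q : nat).
Hypothesis q_gt0 : (0 < q)%N.
Local Notation ph := ((totient q)%:R : R).
Local Notation e_ := (class_ind R q).

Let M c n : R := mertens_sum (e_ c) n.
Let r c n : R := `|M c n|.
(** A logarithmic average: [r c j <= b j] makes it grow at rate at most [b] in [ln N]. The iteration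
    lowers this rate and carries the gain back to [r]. *)
Let U c N : R := \sum_(1 <= j < N.+1) r c j / (j%:R * j.+1%:R).

Lemma uniform_bound (P : nat -> R -> Prop) k :
  (forall c (C D : R), C <= D -> P c C -> P c D) ->
  (forall c, exists C : R, P c C) ->
  exists2 C : R, 0 <= C & forall c, (c < k)%N -> P c C.
Proof.
move=> Pm PC; elim: k => [|k [C C0 HC]]; first by exists 0.
have [D HD] := PC k; exists (C + `|D|); first by rewrite addr_ge0.
move=> c; rewrite ltnS leq_eqVlt => /orP[/eqP ->|/HC].
  by apply: Pm HD; have := ler_norm D; lra.
by apply: Pm; rewrite lerDl.
Qed.

Lemma r_le c n : r c n <= n%:R.
Proof. by apply: norm_mertens_sum => k; rewrite /class_ind normr_nat lern1 leq_b1. Qed.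

Lemma class_ind_le1 c k : `|e_ c k| <= 1.
Proof. by rewrite /class_ind normr_nat lern1 leq_b1. Qed.

Lemma r_lip c m n : (m <= n)%N -> r c n <= r c m + (n%:R - m%:R).
Proof.
move=> mn; have := mertens_sum_lipschitz (class_ind_le1 c) mn.
rewrite -/(M c n) -/(M c m) /r.
have := ler_normD (M c n - M c m) (M c m); rewrite subrK; lra.
Qed.

Lemma U_term_ge0 c j : 0 <= r c j / (j%:R * j.+1%:R).
Proof. by apply: divr_ge0; [exact: normr_ge0|exact: mulr_ge0]. Qed.

Lemma U_le c m n : (m <= n)%N -> U c m <= U c n.
Proof.
move=> mn; rewrite /U [leRHS](@big_cat_nat _ _ _ m.+1 1 n.+1)//= lerDl.
by apply: sumr_ge0 => j _; exact: U_term_ge0.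
Qed.

(** If [U c k <= b ln k] for all [c], each inner sum is at most about [b (ln N) ^ 2 / 2], and the
    [ph] classes together give [b N (ln N) ^ 2]: the constants cancel exactly, so any gain for [U]
    is a gain for [r]. *)
Lemma mobius_inequality : exists2 C : R, 0 <= C & forall a N, (a < q)%N -> coprime q a ->
  (0 < N)%N -> r a N * ln N%:R ^+ 2 <=
  2 / ph * N%:R * \sum_(0 <= c < q | coprime q c)
    (\sum_(1 <= k < N.+1) U c k * (ln k.+1%:R - ln k%:R)) + C * N%:R * (1 + ln N%:R).
Proof.
have [C C0 HC] := sum_differences_mangoldt2 R q_gt0.
exists (q%:R * C + 8) => [|a N aq ac N0]; first by rewrite addr_ge0// mulr_ge0.
have Nr := natr_gt0 R N0; have l0 := lnn_ge0 R N.
have ea1 := class_ind_le1 a.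
apply: le_trans (mertens_sum_ln_sqr ea1 N0) _.
have E1 : \sum_(1 <= n < N.+1) mangoldt2 R n * `|mertens_sum (dilate n (e_ a)) (N %/ n)| <=
  \sum_(0 <= c < q | coprime q c) \sum_(1 <= n < N.+1)
     mangoldt2 R n * dilate c (e_ a) n * r c (N %/ n).
  rewrite exchange_big/=; apply: ler_sum => n _.
  have H := mertens_sum_dilate_class R q_gt0 n (N %/ n) ac.
  apply: (@le_trans _ _ _ _ _ (ler_wpM2l (mangoldt2_ge0 R n) H)).
  by rewrite mulr_sumr ler_sum// => c _; rewrite mulrA.
have E2 c : coprime q c -> \sum_(1 <= n < N.+1)
     mangoldt2 R n * dilate c (e_ a) n * r c (N %/ n) <=
   2 / ph * N%:R * \sum_(1 <= k < N.+1) U c k * (ln k.+1%:R - ln k%:R) + C * N%:R * (1 + ln N%:R).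
  move=> cq; have gc := class_fun_dilate c (class_fun_class_ind R ac).
  have g1 : total q (dilate c (e_ a)) = 1.
    by rewrite total_dilate ?total_class_ind//; exact: periodic_class_ind.
  have r0 : r c 0 = 0 by rewrite /r /M mertens_sum0 normr0.
  have rl k : `|r c k.+1 - r c k| <= 1.
    apply: le_trans (ler_dist_dist _ _) _.
    have := mertens_sum_lipschitz (class_ind_le1 c) (leqnSn k).
    by rewrite -natr1 addrAC subrr add0r.
  have rk k : 0 <= r c k <= k%:R by rewrite normr_ge0 r_le.
  apply: le_trans (HC _ _ gc g1 r0 rl rk N N0) _; rewrite lerD2r ler_wpM2l ?mulr_ge0 ?divr_ge0//.
  rewrite Abel_sum -[leRHS]add0r; apply: lerD.
    rewrite mulr_ge0_le0//; first by apply: sumr_ge0 => j _; exact: U_term_ge0.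
    by rewrite subr_le0 lnn_le.
  rewrite le_eqVlt; apply/orP; left; apply/eqP; apply: eq_bigr => k _.
  by rewrite /U; congr (_ * _); ring.
have E3 : \sum_(0 <= c < q | coprime q c) \sum_(1 <= n < N.+1)
     mangoldt2 R n * dilate c (e_ a) n * r c (N %/ n) <=
   2 / ph * N%:R * (\sum_(0 <= c < q | coprime q c) \sum_(1 <= k < N.+1) U c k * (ln k.+1%:R - ln k%:R)) +
   q%:R * (C * N%:R * (1 + ln N%:R)).
  apply: le_trans (ler_sum _ (fun c cq => E2 c cq)) _.
  rewrite big_split/= mulr_sumr lerD2l.
  have D0 : 0 <= C * N%:R * (1 + ln N%:R) by rewrite !mulr_ge0// addr_ge0.
  apply: (@le_trans _ _ (\sum_(0 <= c < q) (C * N%:R * (1 + ln N%:R)))).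
    by rewrite big_mkcond; apply: ler_sum => c _; case: ifP.
  by rewrite sumr_const_nat subn0 mulr_natl.
by lra.
Qed.

(** Abel summation applied to [mobius_sum_bounded]; the boundary term is at most 1 by [r_le]. *)
Lemma weighted_sum_bounded : exists2 B : R, 0 <= B & forall c, (c < q)%N ->
  coprime q c -> forall N, (0 < N)%N ->
  `|\sum_(1 <= n < N.+1) M c n / (n%:R * n.+1%:R)| <= B.
Proof.
apply: (@uniform_bound (fun c B => coprime q c -> forall N, (0 < N)%N ->
  `|\sum_(1 <= n < N.+1) M c n / (n%:R * n.+1%:R)| <= B)) => [c C D CD H cq N N0|c].
  exact: le_trans (H cq N N0) CD.
case: (boolP (coprime q c)) => cq; last by exists 0.
have [C C0 HC] := mobius_sum_bounded q_gt0 (@periodic_class_ind R q c) (supported_class_ind R cq).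
exists (C + 1) => _ N N0; have := HC N N0.
have -> : \sum_(1 <= n < N.+1) mobius R n * (e_ c n / n%:R) =
  M c N / N.+1%:R + \sum_(1 <= n < N.+1) M c n / (n%:R * n.+1%:R).
  under eq_bigr do rewrite mulrA.
  rewrite [LHS]Abel_sum; congr (_ + _); apply: eq_big_nat => n /andP[n0 _].
  by rewrite invM_succ.
have H : `|M c N / N.+1%:R| <= 1.
  rewrite normrM normfV (ger0_norm (ler0n _ _)) ler_pdivrMr ?ltr0n// mul1r.
  by apply: le_trans (r_le c N) _; rewrite ler_nat.
move: H; set x := M c N / _; set y := \sum_(1 <= n < N.+1) _ => H1 H2.
by have := ler_normB (x + y) x; rewrite addrAC subrr add0r; lra.
Qed.

Lemma M_int c n : M c n \is a Num.int.
Proof.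
rewrite /M /mertens_sum rpred_sum// => k _.
by rewrite rpredM ?mobius_int// /class_ind; apply: rpred_nat.
Qed.

Lemma sg_M_succ c n : 0 < r c n -> 0 < r c n.+1 -> Num.sg (M c n.+1) = Num.sg (M c n).
Proof.
rewrite /r !normr_gt0 => n0 n1.
have : 1 <= `|M c n| by apply: norm_intr_ge1 => //; exact: M_int.
have : 1 <= `|M c n.+1| by apply: norm_intr_ge1 => //; exact: M_int.
have := mertens_sum_lipschitz (class_ind_le1 c) (leqnSn n).
rewrite -/(M c n) -/(M c n.+1) -natr1 addrAC subrr add0r ler_norml => /andP[].
by case: (sgrP (M c n)) n0 => // s _; case: (sgrP (M c n.+1)) n1 => // t _; lra.
Qed.

(* [M c] is integer-valued with steps at most 1, so it cannot change sign
   without vanishing: if it stayed large on a long interval, the weighted sum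
   of [weighted_sum_bounded] would be large. *)
Lemma exists_small_mertens_sum (d : R) : 0 < d -> exists2 K, (0 < K)%N &
  forall c x, (c < q)%N -> coprime q c -> (0 < x)%N ->
  exists n, [/\ (x < n)%N, (n <= K * x)%N & r c n <= d * n%:R].
Proof.
move=> d0; have [B B0 HB] := weighted_sum_bounded.
have l2 : 0 < ln 2 :> R by rewrite ln_gt0// ltr1n.
have z0 : 0 <= (2 * B) / (d * ln 2) by rewrite divr_ge0 ?mulr_ge0// ltW// mulr_gt0.
have := archi_boundP z0; set T := Num.bound _; rewrite ltr_pdivrMr ?mulr_gt0// => HT.
(* Over [x < n <= K x] the sum of [1 / (n + 1)] is at least [ln (K x) - ln (3 x) = T ln 2], as
   [x + 2 <= 3 x]; times [d] this exceeds the bound [2 B]. *)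
exists (3 * 2 ^ T)%N; first by rewrite muln_gt0/= expn_gt0.
set K := (3 * 2 ^ T)%N => c x cq cc x0; apply: contrapT => nex.
have big n : (x < n)%N -> (n <= K * x)%N -> d * n%:R < r c n.
  by move=> xn nK; rewrite ltNge; apply/negP => H; apply: nex; exists n.
have K1 : (1 < K)%N by rewrite /K; have := expn_gt0 2 T; lia.
have xK : (x < K * x)%N by rewrite -{1}[x]mul1n ltn_pmul2r.
have rpos n : (x < n)%N -> (n <= K * x)%N -> 0 < r c n.
  by move=> xn nK; apply: le_lt_trans (big n xn nK); rewrite mulr_ge0// ltW.
pose S := \sum_(x.+1 <= n < (K * x).+1) M c n / (n%:R * n.+1%:R).
have Slow : d * (T%:R * ln 2) <= `|S|.
  have SE : `|S| = \sum_(x.+1 <= n < (K * x).+1) r c n / (n%:R * n.+1%:R).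
    have sgE j : (x.+1 + j <= K * x)%N -> Num.sg (M c (x.+1 + j)) = Num.sg (M c x.+1).
      elim: j => [|j IH]; first by rewrite addn0.
      rewrite addnS => H; rewrite -IH ?(ltnW H)//.
      by apply: sg_M_succ; apply: rpos; rewrite -?addnS ?leq_addr//; lia.
    have s1 : `|Num.sg (M c x.+1)| = 1 by rewrite normr_sg -normr_gt0 rpos.
    rewrite -[LHS]mulr1 -[X in _ * X = _]s1 -normrM mulr_suml ger0_norm; last first.
      rewrite big_nat sumr_ge0// => n /andP[xn nK].
      by rewrite -(sgE (n - x.+1)%N) subnKC// mulrAC [M c n * _]mulrC -normrEsg U_term_ge0.
    apply: eq_big_nat => n /andP[xn nK].
    by rewrite -(sgE (n - x.+1)%N) subnKC// mulrAC [M c n * _]mulrC -normrEsg.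
  rewrite SE; apply: (@le_trans _ _ (d * \sum_(x.+1 <= n < (K * x).+1) (ln n.+2%:R - ln n.+1%:R))).
    rewrite ler_pM2l// (@telescope_sumr _ x.+1 (K * x).+1 (fun n => ln n.+1%:R : R)) ?ltnS 1?ltnW//.
    have xr := natr_gt0 R x0.
    have : ln (K * x)%:R <= ln (K * x).+2%:R :> R by rewrite lnn_le// leqW.
    have : ln x.+2%:R <= ln (3 * x)%:R :> R by rewrite lnn_le//; lia.
    rewrite lnnM// lnnM ?(ltnW K1)// /K lnnM ?expn_gt0// natrX lnXn ?ltr0n// -[ln 2 *+ T]mulr_natl.
    by lra.
  rewrite mulr_sumr; apply: ler_sum_nat => n /andP[xn nK].
  have n0 : (0 < n)%N by apply: leq_trans xn.
  have nr := natr_gt0 R n0.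
  apply: (@le_trans _ _ (d * n.+1%:R^-1)); first by rewrite ler_pM2l// lnS_le.
  rewrite ler_pdivlMr ?mulr_gt0//; apply: le_trans (ltW (big n xn nK)).
  by rewrite [n%:R * _]mulrC mulrA divfK// pnatr_eq0.
have Sup : `|S| <= 2 * B.
  have -> : S = \sum_(1 <= n < (K * x).+1) M c n / (n%:R * n.+1%:R) -
    \sum_(1 <= n < x.+1) M c n / (n%:R * n.+1%:R).
    by rewrite (@big_cat_nat _ _ _ x.+1 1 (K * x).+1)//= ?ltnS 1?ltnW// addrAC subrr add0r.
  apply: le_trans (ler_normB _ _) _.
  have := HB c cq cc x x0; have := HB c cq cc (K * x)%N (ltn_trans x0 xK); lra.
by lra.
Qed.

Lemma sum_inv_succ_le x y : (0 < x)%N -> (x <= y)%N ->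
  \sum_(x.+1 <= j < y.+1) j.+1%:R^-1 <= ln y%:R - ln x%:R :> R.
Proof.
move=> x0 xy; apply: (@le_trans _ _ (\sum_(x.+1 <= j < y.+1) (ln j%:R - ln j.-1%:R))).
  apply: ler_sum_nat => -[|j]// /andP[xj _].
  have j0 : (0 < j)%N by apply: leq_trans x0 _; rewrite -ltnS.
  apply: le_trans (lnS_ge R j0); rewrite lef_pV2 ?posrE ?ltr0n// ler_nat//.
rewrite big_add1/=.
by rewrite (@telescope_sumr _ x y (fun j => ln j%:R : R)).
Qed.

(* After a value [r c m <= d m / 2] the Lipschitz bound keeps [r c j] below
   [(b - d / 4) j] for [m <= j <= m + d m / 4]. *)
Lemma block_saving (d : R) : 0 < d <= 1 -> exists2 Q, (1 < Q)%N & exists2 s : R, 0 < s &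
  forall c x (b : R), (c < q)%N -> coprime q c -> (0 < x)%N -> d <= b ->
  (forall n, (x <= n)%N -> r c n <= b * n%:R) ->
  U c (Q * x)%N <= U c x + b * ln Q%:R - s.
Proof.
move=> /andP[d0 d1]; have d20 : 0 < d / 2 by rewrite divr_gt0.
have [K K0 HK] := exists_small_mertens_sum d20.
(* The factor 2 leaves room for the block from [m] to [m + L], with [L <= m <= K x]. The gain below
   is [d / 4] times [d / 12], a lower bound for the sum of [1 / (j + 1)] over the block. *)
exists (2 * K)%N; first lia.
exists (d ^+ 2 / 48); first by rewrite divr_gt0// exprn_gt0.
move=> c x b cq cc x0 db rb; set Q := (2 * K)%N.
have [m [xm mK rm]] := HK c x cq cc x0.
have m0 : (0 < m)%N by apply: leq_trans xm.
have mr := natr_gt0 R m0; have m1 := natr_ge1 R m0.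
pose L := Num.truncn (d / 4 * m%:R).
have z0 : 0 <= d / 4 * m%:R by rewrite mulr_ge0// ltW// divr_gt0.
have /andP[L1 L2] := truncn_itv z0; rewrite -/L in L1 L2.
have Lm : (L <= m)%N by rewrite -(ler_nat R); nra.
have mLQ : (m + L <= Q * x)%N.
  by rewrite /Q -mulnA mul2n -addnn leq_add// (leq_trans Lm).
have xQ : (x <= Q * x)%N by rewrite leq_pmull// muln_gt0.
pose I j : R := ((m <= j) && (j <= m + L))%N%:R.
have -> : U c (Q * x)%N = U c x + \sum_(x.+1 <= j < (Q * x)%N.+1) r c j / (j%:R * j.+1%:R).
  by rewrite /U (@big_cat_nat _ _ _ x.+1 1 (Q * x).+1)// ltnS.
rewrite -addrA lerD2l.
apply: (@le_trans _ _ (\sum_(x.+1 <= j < (Q * x)%N.+1) (b * j.+1%:R^-1 - d / 4 * (I j * j.+1%:R^-1)))).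
  apply: ler_sum_nat => j /andP[xj jQ].
  have j0 : (0 < j)%N by apply: leq_trans xj.
  have jr := natr_gt0 R j0.
  have -> : b * j.+1%:R^-1 - d / 4 * (I j * j.+1%:R^-1) = (b - d / 4 * I j) * j.+1%:R^-1 by ring.
  rewrite invfM mulrA ler_wpM2r ?invr_ge0// ler_pdivrMr//.
  have rj : r c j <= b * j%:R by apply: rb; apply: ltnW.
  rewrite /I; case: (boolP ((m <= j) && (j <= m + L))%N) => [/andP[mj jm]|_] /=; last first.
    by rewrite mulr0 subr0.
  rewrite mulr1; have := r_lip c mj; rewrite -natrB// => H.
  have jL : (j - m)%:R <= L%:R :> R by rewrite ler_nat leq_subLR.
  have mj' : m%:R <= j%:R :> R by rewrite ler_nat.
  have : d * m%:R <= d * j%:R by rewrite ler_pM2l.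
  have : d * j%:R <= b * j%:R by rewrite ler_pM2r.
  lra.
rewrite sumrB -!mulr_sumr.
have b0 : 0 <= b by lra.
have H1 : b * (\sum_(x.+1 <= j < (Q * x)%N.+1) j.+1%:R^-1) <= b * ln Q%:R.
  rewrite ler_wpM2l//; apply: le_trans (sum_inv_succ_le x0 xQ) _.
  by rewrite lnnM ?addrK// /Q muln_gt0.
have H2 : d / 12 <= \sum_(x.+1 <= j < (Q * x)%N.+1) I j * j.+1%:R^-1.
  have Ige j : 0 <= I j * j.+1%:R^-1 by rewrite mulr_ge0// ?invr_ge0// /I ler0n.
  rewrite (@big_cat_nat _ _ _ m x.+1 (Q * x)%N.+1)//=; last first.
    by rewrite leqW// (leq_trans (leq_addr L m)).
  rewrite (@big_cat_nat _ _ _ (m + L).+1 m (Q * x)%N.+1)//=; last by rewrite leqW// leq_addr.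
  apply: (@le_trans _ _ (\sum_(m <= j < (m + L).+1) (3 * m%:R)^-1)).
    rewrite sumr_const_nat subSn ?leq_addr// addKn -[_ *+ L.+1]mulr_natl.
    rewrite ler_pdivlMr ?mulr_gt0//; lra.
  apply: (@le_trans _ _ (\sum_(m <= j < (m + L).+1) I j * j.+1%:R^-1)).
    apply: ler_sum_nat => j /andP[mj jL].
    rewrite /I mj -ltnS jL mul1r lef_pV2 ?posrE ?ltr0n ?mulr_gt0//.
    rewrite -natrM ler_nat; apply: leq_trans jL _.
    by rewrite -addn1 !mulSn mul0n addn0 addnA leq_add// leq_add.
  rewrite addrCA lerDl addr_ge0// sumr_ge0//.
set T := \sum_(_ <= j < _) I j * _ in H2 *.
have : d / 4 * (d / 12) <= d / 4 * T by rewrite ler_pM2l// divr_gt0.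
have -> : d / 4 * (d / 12) = d ^+ 2 / 48 by field.
lra.
Qed.

Definition eventually_le (b : R) := exists N0, forall N c, (N0 <= N)%N ->
  (c < q)%N -> coprime q c -> r c N <= b * N%:R.

(** Each passage from [x] to [Q x] saves [s], so the rate falls from [b] to [b - s / ln Q]. This
    gain depends on [d] alone, as the iteration requires. The new rate is nonnegative because [U] is
    nondecreasing. *)
Lemma U_growth (d : R) : 0 < d <= 1 -> exists2 e : R, 0 < e &
  forall b, d <= b <= 1 -> eventually_le b ->
  exists2 C : R, 0 <= C & forall c k, (c < q)%N -> coprime q c -> (0 < k)%N ->
  0 <= b - e /\ U c k <= (b - e) * ln k%:R + C.
Proof.
move=> d01; have /andP[d0 d1] := d01; have [Q Q1 [s s0 HQ]] := block_saving d01.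
have lQ : 0 < ln Q%:R :> R by rewrite ln_gt0// ltr1n.
exists (s / ln Q%:R); first by rewrite divr_gt0.
move=> b /andP[db b1] [N0' HN0]; pose N0 := N0'.+1.
have N00 : (0 < N0)%N by [].
have Q0 : (0 < Q)%N by apply: ltnW.
exists (1 + ln N0%:R + ln Q%:R); first by rewrite !addr_ge0 ?lnn_ge0.
move=> c k cq cc k0.
have UN0 : U c N0 <= 1 + ln N0%:R.
  apply: le_trans (sum_inv_le R N0); rewrite /U big_nat [leRHS]big_nat.
  apply: ler_sum => j /andP[j0 _]; have jr := natr_gt0 R j0.
  rewrite invfM mulrA.
  apply: (@le_trans _ _ (1 * j.+1%:R^-1)).
    by rewrite ler_wpM2r ?invr_ge0// ler_pdivrMr// mul1r r_le.
  by rewrite mul1r lef_pV2 ?posrE ?ltr0n// ler_nat.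
have step x : (N0 <= x)%N -> U c (Q * x)%N <= U c x + b * ln Q%:R - s.
  move=> Nx; apply: HQ => //; first by apply: leq_trans Nx.
  by move=> n xn; apply: HN0 => //; rewrite (leq_trans _ xn)// ltnW.
have iter i : U c (Q ^ i * N0)%N <= U c N0 + i%:R * (b * ln Q%:R - s).
  elim: i => [|i IH]; first by rewrite mul1n mul0r addr0.
  rewrite expnS -mulnA; have Nx : (N0 <= Q ^ i * N0)%N by rewrite leq_pmull// expn_gt0 Q0.
  by have := step _ Nx; rewrite -natr1; lra.
have eE : (b - s / ln Q%:R) * ln Q%:R = b * ln Q%:R - s.
  by rewrite mulrBl divfK// gt_eqF.
have pos : 0 <= b - s / ln Q%:R.
  rewrite -(pmulr_lge0 _ lQ) eE.
  have := step N0 (leqnn _); have := U_le c (leq_pmull N0 Q0); lra.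
have lk := lnn_ge0 R k; split=> //.
case: (ltnP k N0) => kN0.
  have := U_le c (ltnW kN0); have := mulr_ge0 pos lk; lra.
have kd : (0 < k %/ N0)%N by rewrite divn_gt0.
have /andP[t1 t2] := trunc_log_bounds Q1 kd; set i := trunc_log Q _ in t1 t2.
have kQ : (k <= Q ^ i.+1 * N0)%N by rewrite ltnW// -ltn_divLR.
have il : i%:R * ln Q%:R <= ln k%:R :> R.
  rewrite mulr_natl -lnXn ?ltr0n// -natrX; apply: lnn_le.
  exact: leq_trans t1 (leq_div _ _).
have := le_trans (U_le c kQ) (iter i.+1); rewrite -eE -natr1.
have : (b - s / ln Q%:R) * (i%:R * ln Q%:R) <= (b - s / ln Q%:R) * ln k%:R.
  by rewrite ler_wpM2l.
have : (b - s / ln Q%:R) * ln Q%:R <= 1 * ln Q%:R.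
  rewrite ler_pM2r//; have : 0 < s / ln Q%:R by rewrite divr_gt0.
  lra.
move: (b - s / ln Q%:R) => z; lra.
Qed.

Lemma sum_ln_dln N : \sum_(1 <= k < N.+1) ln k%:R * (ln k.+1%:R - ln k%:R) <=
  (ln N.+1%:R) ^+ 2 / 2 :> R.
Proof.
elim: N => [|N IH]; first by rewrite big_nil ln1 expr0n/= mul0r.
rewrite big_nat_recr//=.
by have := sqr_ge0 (ln N.+2%:R - ln N.+1%:R : R); lra.
Qed.

(** The rate [b - e] passes through [mobius_inequality] unchanged; the remaining terms are linear in
    [ln N] and are absorbed by giving up half of [e]. *)
Lemma eventually_le_improve (d : R) : 0 < d <= 1 -> exists2 e : R, 0 < e &
  forall b, d <= b <= 1 -> eventually_le b -> eventually_le (b - e).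
Proof.
move=> d01; have [e e0 He] := U_growth d01; exists (e / 2); first by rewrite divr_gt0.
move=> b b01 /(He b b01)[C C0 HC]; have [D D0 HD] := mobius_inequality.
have /andP[db b1] := b01; have /andP[d0 d1] := d01.
pose K := 4 * C + D.
have K0 : 0 <= K by rewrite /K; lra.
have l2 : 0 < ln 2 :> R by rewrite ln_gt0// ltr1n.
(* The linear terms are at most [(3 + 2 K) l], which is below [(e / 2) l ^ 2] once
   [l e >= 2 (3 + 2 K)]. *)
have z0 : 0 <= (2 * (3 + 2 * K) / e + 1) / ln 2.
  by rewrite divr_ge0 ?(ltW l2)// addr_ge0// divr_ge0 ?(ltW e0)//; lra.
have := archi_boundP z0; set T := Num.bound _; rewrite ltr_pdivrMr// => HT.
exists (2 ^ T)%N => N a TN aq ac.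
have N0 : (0 < N)%N by apply: leq_trans TN; rewrite expn_gt0.
have Nr := natr_gt0 R N0.
have lN : T%:R * ln 2 <= ln N%:R :> R.
  by rewrite mulr_natl -lnXn// -natrX; apply: lnn_le.
have HD' := HD a N aq ac N0.
have p0 := totientr_gt0 R q_gt0.
set l := ln N%:R : R in HD' lN.
have E1 c : (c < q)%N -> coprime q c ->
   \sum_(1 <= k < N.+1) U c k * (ln k.+1%:R - ln k%:R) <=
   (b - e) * ((1 + l) ^+ 2 / 2) + C * (1 + l).
  move=> cq cc; have [be _] := HC c 1%N cq cc isT.
  have H : \sum_(1 <= k < N.+1) U c k * (ln k.+1%:R - ln k%:R) <=
     (b - e) * (\sum_(1 <= k < N.+1) ln k%:R * (ln k.+1%:R - ln k%:R)) + C * ln N.+1%:R.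
    have -> : ln N.+1%:R = \sum_(1 <= k < N.+1) (ln k.+1%:R - ln k%:R) :> R.
      by rewrite (@telescope_sumr _ 1 N.+1 (fun j => ln j%:R : R))// ln1 subr0.
    rewrite !mulr_sumr -big_split/=; apply: ler_sum_nat => k /andP[k0 _].
    rewrite mulrA -mulrDl ler_wpM2r//; last by have [] := HC c k cq cc k0.
    by rewrite subr_ge0 lnn_le.
  have lS : ln N.+1%:R <= 1 + l :> R.
    have := lnS_le R N0; have : N%:R^-1 <= 1 :> R by rewrite invf_le1// ler1n.
    rewrite -/l; lra.
  have lS0 := lnn_ge0 R N.+1.
  have H3 : C * ln N.+1%:R <= C * (1 + l) by rewrite ler_wpM2l.
  have H4 : (ln N.+1%:R) ^+ 2 <= (1 + l) ^+ 2 by rewrite lerXn2r// nnegrE; lra.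
  have H5 := sum_ln_dln N.
  apply: le_trans H _; apply: lerD H3; rewrite ler_wpM2l//.
  lra.
have [be _] := HC a 1%N aq ac isT.
have l0 : 0 <= l by exact: lnn_ge0.
pose Z := (b - e) * ((1 + l) ^+ 2 / 2) + C * (1 + l).
have Z0 : 0 <= Z by rewrite addr_ge0 ?mulr_ge0 ?sqr_ge0//; lra.
have E2 : \sum_(0 <= c < q | coprime q c)
    (\sum_(1 <= k < N.+1) U c k * (ln k.+1%:R - ln k%:R)) <= ph * Z.
  apply: (@le_trans _ _ (\sum_(0 <= c < q) coprime_ind R q c * Z)); last first.
    by rewrite -mulr_suml -/(total q (coprime_ind R q)) total_coprime_ind.
  rewrite big_mkcond/=; apply: ler_sum_nat => c /andP[_ cq].
  rewrite /coprime_ind; case: ifP => cc; last by rewrite mul0r.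
  by rewrite mul1r E1.
have E3 : 2 / ph * N%:R * (ph * Z) = 2 * N%:R * Z by field; rewrite gt_eqF.
have E4 : r a N * l ^+ 2 <= N%:R * (2 * Z + D * (1 + l)).
  apply: le_trans HD' _.
  apply: (@le_trans _ _ (2 / ph * N%:R * (ph * Z) + D * N%:R * (1 + l))).
    by rewrite lerD2r ler_wpM2l// mulr_ge0// divr_ge0 ?(ltW p0).
  rewrite E3; lra.
have lbig : (2 * (3 + 2 * K) / e + 1) < l by exact: lt_le_trans lN.
have q0 : 0 <= 2 * (3 + 2 * K) / e by rewrite divr_ge0 ?(ltW e0)//; lra.
have l1 : 1 <= l by lra.
have le : 2 * (3 + 2 * K) <= l * e by rewrite -ler_pdivrMr//; lra.
have E5 : 2 * Z + D * (1 + l) <= (b - e / 2) * l ^+ 2.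
  have : 2 * (3 + 2 * K) * l <= l * e * l by rewrite ler_wpM2r.
  have : (b - e) * (1 + 2 * l) <= 1 * (3 * l).
    by apply: ler_pM => //; lra.
  have : K * (1 + l) <= K * (2 * l) by rewrite ler_wpM2l//; lra.
  have : 0 <= C * (1 + l) by rewrite mulr_ge0//; lra.
  by rewrite /Z /K; lra.
rewrite -(ler_pM2r (_ : 0 < l ^+ 2)); last by rewrite exprn_gt0//; lra.
apply: le_trans E4 _; rewrite [_ * N%:R]mulrC -mulrA ler_pM2l//.
Qed.

Lemma eventually_le_mono b b' : b <= b' -> eventually_le b -> eventually_le b'.
Proof.
move=> bb [N0 H]; exists N0 => N c NN cq cc.
by apply: le_trans (H N c NN cq cc) _; rewrite ler_wpM2r.
Qed.

(** As [e] depends on [d] alone, more than [1 / e] improvements lead from the trivial bound 1 down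
    to [d]; the maximum with [d] keeps [b] where an improvement is available. *)
Theorem mertens_class_o (d : R) : 0 < d -> exists N0, forall N c, (N0 <= N)%N ->
  (c < q)%N -> coprime q c -> `|mertens_sum (e_ c) N| <= d * N%:R.
Proof.
wlog d1 : d / d <= 1.
  move=> H d0; case: (lerP d 1) => d1; first exact: H.
  exact: (eventually_le_mono (ltW d1) (H 1 (lexx 1) ltr01)).
move=> d0; have d01 : 0 < d <= 1 by rewrite d0.
have [e e0 He] := eventually_le_improve d01.
have H i : eventually_le (Num.max d (1 - i%:R * e)).
  elim: i => [|i IH].
    rewrite mul0r subr0 (max_idPr d1); exists 0%N => N c _ _ _.
    by rewrite mul1r r_le.
  have := He _ _ IH; rewrite le_max lexx/= ge_max d1/= => /(_ _)H.
  have : eventually_le (Num.max d (1 - i%:R * e) - e).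
    by apply: H; rewrite gerBl mulr_ge0// ltW.
  apply: eventually_le_mono; rewrite -natr1 le_max lerBlDr.
  case: (lerP (1 - i%:R * e) d) => di; first by rewrite lerDl (ltW e0).
  by apply/orP; right; lra.
have z0 : 0 <= 1 / e by rewrite divr_ge0// ltW.
have := archi_boundP z0; set T := Num.bound _; rewrite ltr_pdivrMr// => HT.
by have := H T; rewrite (max_idPl _)//; lra.
Qed.

End Iteration.

(** * Primes in residue classes *)

Section PrimesInClasses.
Variables (R : realType) (q : nat).
Hypothesis q_gt0 : (0 < q)%N.
Local Notation mu := (@mobius R).
Local Notation Lam := (@mangoldt R).
Local Notation e_ := (class_ind R q).
Implicit Types (g : nat -> R).

Definition class_diff a b : nat -> R := fun n => e_ a n - e_ b n.

Lemma periodic_class_diff a b : periodic q (class_diff a b).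
Proof. by move=> n; rewrite /class_diff !periodic_class_ind. Qed.

Lemma class_diff_le1 a b n : `|class_diff a b n| <= 1.
Proof.
rewrite /class_diff /class_ind; case: (_ == _); case: (_ == _); rewrite ?subrr ?subr0 ?sub0r ?normrN ?normr1 ?normr0//.
Qed.

Lemma total_class_diff a b : total q (class_diff a b) = 0.
Proof.
rewrite /total /class_diff sumrB -/(total q (e_ a)) -/(total q (e_ b)).
by rewrite !total_class_ind// subrr.
Qed.

Lemma mertens_dilate_class_o (d : R) : 0 < d -> exists2 C : R, 0 <= C & forall a l y,
  coprime q a -> `|mertens_sum (dilate l (e_ a)) y| <= d * y%:R + C.
Proof.
move=> d0; have [N0 HN0] := mertens_class_o q_gt0 d0.
exists N0%:R => // a l y aq; case: (boolP (coprime q l)) => lq; last first.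
  rewrite (dilate_not_coprime (supported_class_ind R aq) lq) /mertens_sum big1 ?normr0.
    by rewrite addr_ge0// mulr_ge0// ltW.
  by move=> k _; rewrite mulr0.
have [c [cq cc ncE]] := inverse_class q_gt0 aq lq.
have -> : dilate l (e_ a) = e_ c.
  by apply/funext => k; rewrite /dilate /class_ind -ncE coprime_eqmodl.
case: (leqP N0 y) => yN.
  by apply: le_trans (HN0 _ _ yN cq cc) _; rewrite lerDl.
apply: le_trans (norm_mertens_sum y (class_ind_le1 R q c)) _.
apply: (@le_trans _ _ N0%:R); first by rewrite ler_nat ltnW.
by rewrite lerDr mulr_ge0// ltW.
Qed.

(* Hyperbola method for [Lam = mu * ln], cut at [K]. *)
Lemma psi_class_diff_split a b N K : coprime q a -> coprime q b -> (0 < N)%N ->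
  psi_of (class_diff a b) N =
  \sum_(1 <= l < N.+1) (l <= K)%N%:R * ln l%:R *
     mertens_sum (dilate l (class_diff a b)) (N %/ l) +
  \sum_(1 <= m < N.+1) mu m *
     \sum_(1 <= l < (N %/ m).+1) (K < l)%N%:R * (dilate m (class_diff a b) l * ln l%:R).
Proof.
move=> aq bq N0; set g := class_diff a b.
have := @sum_dirichlet R mu (fun k => ln k%:R) Lam g N (fun k k0 => sum_mobius_ln R k0).
rewrite -/(psi_of g N) => ->.
have -> : \sum_(1 <= l < N.+1) (l <= K)%N%:R * ln l%:R * mertens_sum (dilate l g) (N %/ l) =
  \sum_(1 <= m < N.+1) \sum_(1 <= l < (N %/ m).+1) (l <= K)%N%:R * ln l%:R * (mu m * g (m * l)%N).
  rewrite [RHS]sum_hyperbola_sym; apply: eq_bigr => l _.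
  by rewrite /mertens_sum mulr_sumr; apply: eq_bigr => m _; rewrite /dilate mulnC.
rewrite -big_split/=; apply: eq_bigr => m _.
rewrite !mulr_sumr -big_split/=; apply: eq_bigr => l _.
rewrite ltnNge /dilate; case: (l <= K)%N => /=; ring.
Qed.

(** The terms with [l <= K] involve at most [K] Moebius sums, each [o(N)]. For [l > K] only
    [m <= N / (K + 1)] occur, and mean zero leaves the inner sums logarithmic, for a total of
    [O(N ln K / K)]. *)
Lemma psi_class_diff_o (eps : R) : 0 < eps -> exists N0, forall a b N, (N0 <= N)%N ->
  coprime q a -> coprime q b -> `|psi_of (class_diff a b) N| <= eps * N%:R.
Proof.
move=> e0; have qr := natr_gt0 R q_gt0; have q1 := q_ge1 R q_gt0.
have z0 : 0 <= 64 * q%:R / eps by rewrite divr_ge0 ?mulr_ge0// ltW.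
have := archi_boundP z0; set J := Num.bound _; rewrite ltr_pdivrMr// => HJ.
have Jr0 : 0 < J%:R :> R.
  by rewrite ltr0n; case: J HJ => // HJ; rewrite mul0r in HJ; nra.
have J0 : (0 < J)%N by rewrite -(ltr0n R).
(* A square, so that [ln K = 2 ln J <= 2 J] is enough for [(1 + ln K) / K = O(1 / J)]. *)
pose K := (J ^ 2)%N.
have K0 : (0 < K)%N by rewrite expn_gt0 J0.
have Kr : 0 < K%:R :> R by rewrite ltr0n.
have lK := lnn_ge0 R K.
pose A : R := 4 * K%:R * (1 + ln K%:R).
have A0 : 0 < A by rewrite mulr_gt0 ?mulr_gt0//; lra.
have [C C0 HC] := mertens_dilate_class_o (divr_gt0 e0 (mulr_gt0 (ltr0n R 2) A0)).
have := archi_boundP (divr_ge0 (mulr_ge0 (ltW A0) C0) (ltW e0)).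
set T := Num.bound _; rewrite ltr_pdivrMr// => HT.
exists (4 * T).+1 => a b N NT aq bq.
have N0 : (0 < N)%N by apply: leq_trans NT.
have Nr := natr_gt0 R N0.
set g := class_diff a b.
have gp : periodic q g by exact: periodic_class_diff.
have gs : coprime_supported q g.
  by move=> n nq; rewrite /g /class_diff !supported_class_ind// subrr.
rewrite (psi_class_diff_split K aq bq N0) -/g.
set X := \sum_(1 <= l < N.+1) _; set Y := \sum_(1 <= m < N.+1) _.
have HX : `|X| <= eps * N%:R / 2.
  have Md l y : `|mertens_sum (dilate l g) y| <= 2 * (eps / (2 * A) * y%:R + C).
    have -> : mertens_sum (dilate l g) y = mertens_sum (dilate l (e_ a)) y - mertens_sum (dilate l (e_ b)) y.
      by rewrite /mertens_sum -sumrB; apply: eq_bigr => n _; rewrite -mulrBr.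
    apply: le_trans (ler_normB _ _) _.
    by have := HC a l y aq; have := HC b l y bq; lra.
  pose W := 2 * (eps / (2 * A) * N%:R + C).
  have c0 : 0 <= eps / (2 * A) by rewrite divr_ge0 ?(ltW e0)// mulr_ge0// ltW.
  have W0 : 0 <= W by rewrite mulr_ge0// addr_ge0// mulr_ge0.
  apply: (@le_trans _ _ (\sum_(1 <= l < K.+1) ((1 + ln K%:R) * W))).
    apply: (@le_trans _ _ (\sum_(1 <= l < N.+1) (l <= K)%N%:R * ((1 + ln K%:R) * W))).
      apply: le_trans (ler_norm_sum _ _ _) _; apply: ler_sum => l _.
      case: (leqP l K) => lK'; last by rewrite !mul0r normr0.
      rewrite !mul1r normrM ger0_norm ?lnn_ge0// ler_pM ?lnn_ge0//.
        by have := lnn_le R lK'; lra.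
      apply: le_trans (Md _ _) _; rewrite ler_pM2l// lerD2r ler_wpM2l//.
      by rewrite ler_nat leq_div.
    have D0 : 0 <= (1 + ln K%:R) * W by rewrite mulr_ge0//; lra.
    case: (leqP N K) => NK.
      rewrite [leRHS](@big_cat_nat _ _ _ N.+1 1 K.+1)//= -[leLHS]addr0 lerD ?sumr_ge0//.
      by apply: ler_sum => l _; case: (l <= K)%N; rewrite ?mul1r ?mul0r.
    rewrite (@big_cat_nat _ _ _ K.+1 1 N.+1)//=; last by rewrite ltnS ltnW.
    rewrite [X in _ + X]big_nat [X in _ + X]big1 ?addr0.
      by apply: ler_sum => l _; case: (l <= K)%N; rewrite ?mul1r ?mul0r.
    by move=> l /andP[Kl _]; rewrite leqNgt Kl mul0r.
  rewrite sumr_const_nat subn1/= -[_ *+ K]mulr_natl.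
  have -> : K%:R * ((1 + ln K%:R) * W) = A / 2 * (eps / (2 * A) * N%:R + C).
    have KE : K%:R * (1 + ln K%:R) = A / 4 by rewrite /A; field.
    by rewrite mulrA KE /W; field; rewrite gt_eqF.
  have -> : A / 2 * (eps / (2 * A) * N%:R + C) = eps * N%:R / 4 + A * C / 2.
    by field; rewrite gt_eqF.
  have eN : 0 <= eps * N%:R by rewrite mulr_ge0// ltW.
  suff : A * C <= eps * N%:R / 4 by lra.
  have : (4 * T)%N%:R <= N%:R :> R by rewrite ler_nat ltnW.
  rewrite natrM => H; have : eps * (4 * T%:R) <= eps * N%:R by rewrite ler_pM2l.
  lra.
have HY : `|Y| <= eps * N%:R / 2.
  pose v := (N %/ K.+1)%N.
  pose V : R := N%:R / K.+1%:R.
  have vV : v%:R <= V by rewrite ler_pdivlMr ?ltr0n// -natrM ler_nat leq_divM.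
  have KK : 0 < K.+1%:R :> R by rewrite ltr0n.
  have inner m : (0 < m)%N -> (m <= v)%N ->
     `|\sum_(1 <= l < (N %/ m).+1) (K < l)%N%:R * (dilate m g l * ln l%:R)| <=
     8 * q%:R * (1 + ln K.+1%:R + ln (V / m%:R)).
    move=> m0 mv; have mr := natr_gt0 R m0.
    have Km : (K < N %/ m)%N.
      by rewrite leq_divRL// mulnC -leq_divRL.
    have mN : (m <= N)%N by apply: leq_trans mv (leq_div _ _).
    have yy : (0 < N %/ m)%N by apply: leq_ltn_trans Km.
    have -> : \sum_(1 <= l < (N %/ m).+1) (K < l)%N%:R * (dilate m g l * ln l%:R) =
       \sum_(1 <= l < (N %/ m).+1) dilate m g l * ln l%:R -
       \sum_(1 <= l < K.+1) dilate m g l * ln l%:R.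
      rewrite !(@big_cat_nat _ _ _ K.+1 1 (N %/ m).+1)//=; try by rewrite ltnS ltnW.
      rewrite addrAC subrr add0r big_nat big1 ?add0r; last first.
        by move=> l /andP[_ lK']; rewrite ltnNge -ltnS lK' mul0r.
      apply: eq_big_nat => l /andP[Kl _]; by rewrite Kl mul1r.
    have g0 := total_dilate0 q_gt0 m gp gs (total_class_diff a b).
    have gb k : `|dilate m g k| <= 1 by exact: class_diff_le1.
    have H1 := sum_zero_mean_ln q_gt0 yy (periodic_dilate m gp) g0 gb.
    have H2 := sum_zero_mean_ln q_gt0 K0 (periodic_dilate m gp) g0 gb.
    apply: le_trans (ler_normB _ _) _.
    have mN' : (0 < m <= N)%N by rewrite m0.
    have /andP[L0 _] := ln_divn R mN'.
    have L1 : ln (N%:R / m%:R) = ln K.+1%:R + ln (V / m%:R) :> R.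
      have V0 : 0 < V by rewrite divr_gt0.
      rewrite -lnM ?posrE ?divr_gt0//; congr ln; rewrite /V; field.
      by rewrite !gt_eqF// -natr1 addr_gt0.
    have L2 := lnn_le R (ltnW Km).
    have : q%:R * ln (N %/ m)%:R <= q%:R * (ln K.+1%:R + ln (V / m%:R)) :> R.
      by rewrite ler_pM2l//; lra.
    have : q%:R * ln K%:R <= q%:R * ln (N %/ m)%:R :> R by rewrite ler_pM2l.
    lra.
  have HY1 : `|Y| <= \sum_(1 <= m < v.+1) 8 * q%:R * (1 + ln K.+1%:R + ln (V / m%:R)).
    rewrite /Y (@big_cat_nat _ _ _ v.+1 1 N.+1)//=; last by rewrite ltnS leq_div.
    rewrite [X in _ + X]big_nat [X in _ + X]big1 ?addr0; last first.
      move=> m /andP[vm mN]; rewrite big_nat big1 ?mulr0// => l /andP[l0 lN].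
      have m0 : (0 < m)%N by apply: leq_trans vm.
      rewrite ltnNge (_ : (l <= K)%N) ?mul0r//.
      rewrite leqNgt; apply/negP => Kl; move: vm; rewrite ltnNge => /negP; apply.
      by rewrite leq_divRL// mulnC -leq_divRL// (leq_trans Kl).
    apply: le_trans (ler_norm_sum _ _ _) _; rewrite [leLHS]big_nat [leRHS]big_nat.
    apply: ler_sum => m /andP[m0 mv]; rewrite normrM.
    apply: le_trans (ler_wpM2r (normr_ge0 _) (normr_mobius R m)) _.
    by rewrite mul1r; apply: inner.
  apply: le_trans HY1 _; rewrite -mulr_sumr big_split/= sumr_const_nat subn1/= -[_ *+ v]mulr_natl.
  have H1 := sum_ln_div vV.
  have lK1 := lnn_ge0 R K.+1.
  have H2 : v%:R * (1 + ln K.+1%:R) <= V * (1 + ln K.+1%:R) by rewrite ler_wpM2r//; lra.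
  have H3 : V * (2 + ln K.+1%:R) <= N%:R * (4 / J%:R).
    rewrite /V -mulrA ler_pM2l// ler_pdivrMl//.
    have lJ := ln_le_sub1 Jr0.
    have H4 : ln K.+1%:R <= 1 + 2 * ln J%:R :> R.
      have := lnS_le R K0; have : K%:R^-1 <= 1 :> R by rewrite invf_le1// ler1n.
      by rewrite {3}/K natrX lnXn//; lra.
    have -> : K.+1%:R * (4 / J%:R) = 4 * J%:R + 4 / J%:R :> R.
      by rewrite -natr1 /K natrX; field; rewrite gt_eqF.
    have : 0 < 4 / J%:R :> R by rewrite divr_gt0.
    have := natr_ge1 R J0; lra.
  have H5 : 8 * q%:R * (4 / J%:R) <= eps / 2.
    by rewrite mulrA ler_pdivrMr//; lra.
  have : 8 * q%:R * (v%:R * (1 + ln K.+1%:R) + \sum_(1 <= k < v.+1) ln (V / k%:R)) <=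
    8 * q%:R * (N%:R * (4 / J%:R)).
    by rewrite ler_pM2l ?mulr_gt0//; lra.
  have : N%:R * (8 * q%:R * (4 / J%:R)) <= N%:R * (eps / 2) by rewrite ler_pM2l.
  lra.
by apply: le_trans (ler_normD _ _) _; lra.
Qed.

(** The powers of [p] up to [N] contribute at most [ln N] together, and proper powers occur only
    when [p ^ 2 <= N], that is for at most [sqrt N] primes. *)
Lemma sum_mangoldt_nonprime N : (0 < N)%N ->
  \sum_(1 <= n < N.+1 | ~~ prime n) Lam n <= Num.sqrt N%:R * ln N%:R.
Proof.
move=> N0; have Nr := natr_gt0 R N0; have lN := lnn_ge0 R N.
apply: (@le_trans _ _ (\sum_(1 <= p < N.+1 | (p * p <= N)%N) ln N%:R)); last first.
  rewrite big_const_seq iter_addr_0 -[_ *+ _]mulr_natl ler_wpM2r//.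
  have s0 : 0 <= Num.sqrt N%:R :> R by exact: sqrtr_ge0.
  rewrite -Num.Theory.truncn_ge_nat// -size_filter -[X in (_ <= X)%N](size_iota 1).
  apply: uniq_leq_size; first by rewrite filter_uniq// iota_uniq.
  move=> p; rewrite mem_filter mem_index_iota => /and3P[pp p0 _].
  rewrite mem_iota p0 add1n ltnS /=.
  rewrite Num.Theory.truncn_ge_nat// -(ler_pXn2r (ltn0Sn 1)) ?nnegrE//.
  by rewrite sqr_sqrtr// -natrX ler_nat -mulnn.
pose P p n := (primes n == [:: p]) && ~~ prime n.
have LE n : (0 < n <= N)%N -> ~~ prime n ->
    Lam n = \sum_(1 <= p < N.+1) (P p n)%:R * ln p%:R.
  move=> /andP[n0 nN] np; rewrite /Lam; case E : (primes n) => [|p [|p' s]].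
  - by rewrite big1// => p _; rewrite /P E mul0r.
  - have : p \in primes n by rewrite E inE.
    rewrite mem_primes => /and3P[pp _ pn].
    rewrite (bigD1_seq p) ?iota_uniq//=; last first.
      by rewrite mem_index_iota prime_gt0//= ltnS (leq_trans (dvdn_leq n0 pn)).
    rewrite /P E eqxx np mul1r big1 ?addr0// => p' pp'.
    by rewrite eqseq_cons andbT eq_sym (negbTE pp') mul0r.
  - by rewrite big1// => p'' _; rewrite /P E eqseq_cons andbF mul0r.
apply: (@le_trans _ _ (\sum_(1 <= p < N.+1) \sum_(1 <= n < N.+1) (P p n)%:R * ln p%:R)).
  rewrite exchange_big/= big_mkcond/=; apply: ler_sum_nat => n nN.
  case: ifP => np; first by rewrite LE.
  by apply: sumr_ge0 => p _; rewrite mulr_ge0 ?lnn_ge0.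
rewrite [leRHS]big_mkcond [leLHS]big_nat [leRHS]big_nat; apply: ler_sum => p /andP[p0 pN].
have PE n : P p n -> exists2 j, (1 < j)%N & n = (p ^ j)%N /\ prime p.
  move=> /andP[/eqP E np]; have pn : p \in primes n by rewrite E inE.
  move: (pn); rewrite mem_primes => /and3P[pp n0 _].
  have nE : n = (p ^ logn p n)%N.
    by rewrite {1}(prod_prime_decomp n0) prime_decompE E big_seq1.
  exists (logn p n) => //; case: (ltngtP (logn p n) 1) => // H.
    by move: H; rewrite ltnS leqn0 eqn0Ngt logn_gt0 pn.
  by move: np; rewrite nE H expn1 pp.
case: ifPn => ppN; last first.
  rewrite big_nat big1// => n /andP[n0 nN]; case: (boolP (P p n)) => Pn; rewrite ?mul0r//.
  have [j j1 [nE pp]] := PE n Pn; exfalso; move/negP: ppN; apply.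
  rewrite mulnn -ltnS; apply: leq_ltn_trans nN; rewrite nE.
  by rewrite leq_exp2l// prime_gt1.
rewrite -mulr_suml.
have [/hasP[n0 _ Pn0]|/hasPn nP] := boolP (has (P p) (index_iota 1 N.+1)); last first.
  by rewrite big_seq big1 ?mul0r// => n /nP /negbTE ->.
have [_ _ [_ pp]] := PE n0 Pn0.
have p1 := prime_gt1 pp.
have /andP[t1 t2] := trunc_log_bounds p1 N0; set T := trunc_log p N in t1 t2.
have cT : (count (P p) (index_iota 1 N.+1) <= T)%N.
  have := @uniq_leq_size _ [seq n <- index_iota 1 N.+1 | P p n] [seq (p ^ j)%N | j <- iota 1 T].
  rewrite size_map size_iota size_filter; apply; first by rewrite filter_uniq// iota_uniq.
  move=> n; rewrite mem_filter mem_index_iota => /and3P[Pn _ nN].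
  have [j j1 [nE _]] := PE n Pn; apply/mapP; exists j => //.
  rewrite mem_iota add1n ltnS (ltnW j1)/= -ltnS -(ltn_exp2l _ _ p1) -nE.
  exact: leq_trans nN t2.
apply: (@le_trans _ _ (T%:R * ln p%:R)).
  rewrite ler_wpM2r ?lnn_ge0// -natr_sum ler_nat.
  apply: leq_trans cT; rewrite -sum1_count [leqRHS]big_mkcond/=.
  by apply: leq_sum => n _; case: (P p n).
by rewrite mulr_natl -lnXn ?ltr0n// -natrX; exact: lnn_le.
Qed.

End PrimesInClasses.

(** * From [psi] to prime counts *)

Section PrimeAverages.
Variable R : realType.
Local Notation Lam := (@mangoldt R).

Definition prime_count (N : nat) : R := \sum_(1 <= p < N.+1 | prime p) 1.
Local Notation Pi := prime_count.

Lemma prime_count_ge0 N : 0 <= Pi N.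
Proof. by apply: sumr_ge0. Qed.

(** A substitute for partial summation: counts are always compared through their products with
    [ln N = ln p + ln (N / p)], and [sum_prime_ln_quot_o] makes the second sum [o(N)]. *)
Lemma prime_sum_split (f : nat -> R) N :
  \sum_(1 <= p < N.+1 | prime p) f p * ln N%:R =
  \sum_(1 <= p < N.+1 | prime p) f p * ln p%:R +
  \sum_(1 <= p < N.+1 | prime p) f p * ln (N%:R / p%:R).
Proof.
rewrite -big_split/= [LHS]big_nat_cond [RHS]big_nat_cond.
apply: eq_bigr => p /andP[/andP[p0 pN] _].
have N0 : (0 < N)%N by apply: leq_trans p0 _; rewrite -ltnS.
have pr := natr_gt0 R p0; have Nr := natr_gt0 R N0.
by rewrite -mulrDr; congr (_ * _); rewrite ln_div ?posrE// addrC subrK.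
Qed.

Lemma ln_quot_ge0 N p : (0 < p <= N)%N -> 0 <= ln (N%:R / p%:R : R).
Proof.
move=> /andP[p0 pN]; apply: ln_ge0; rewrite ler_pdivlMr ?ltr0n// mul1r ler_nat//.
Qed.

Lemma sum_prime_ln_quot N : \sum_(1 <= p < N.+1 | prime p) ln (N%:R / p%:R) <= N%:R :> R.
Proof.
apply: le_trans (sum_ln_div (lexx N%:R)).
rewrite big_mkcond; apply: ler_sum_nat => p pN.
by case: ifP => // _; exact: ln_quot_ge0.
Qed.

Lemma psi_prime_part N : \sum_(1 <= p < N.+1 | prime p) ln p%:R +
  \sum_(1 <= n < N.+1 | ~~ prime n) Lam n = psi R N.
Proof.
rewrite /psi [RHS](bigID prime)/=; congr (_ + _).
by apply: eq_bigr => p pp; rewrite mangoldt_prime.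
Qed.

Lemma prime_count_ln_le N : (0 < N)%N -> Pi N * ln N%:R <= 9 * N%:R.
Proof.
move=> N0; rewrite /Pi mulr_suml prime_sum_split.
under eq_bigr do rewrite mul1r.
under [X in _ + X]eq_bigr do rewrite mul1r.
have := psi_prime_part N; have := psi_le R N; have := sum_prime_ln_quot N.
have : 0 <= \sum_(1 <= n < N.+1 | ~~ prime n) Lam n.
  by apply: sumr_ge0 => n _; exact: mangoldt_ge0.
lra.
Qed.

(** By Mertens' estimate with modulus 1, the sum of [Lam n / n] over [N / K < n <= N] is at least 1
    once [ln K > 2 C + 3]; there [1 / n] is at most [K / N]. *)
Lemma psi_ge : exists2 K, (0 < K)%N & forall N, (K <= N)%N -> N%:R / K%:R <= psi R N.
Proof.
have [C C0 HC] := @mertens_coprime R 1 isT.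
have z0 : 0 <= (2 * C + 3) / ln 2 :> R by rewrite divr_ge0 ?addr_ge0 ?mulr_ge0 ?ln_ge0// ler1n.
have l2 : 0 < ln 2 :> R by rewrite ln_gt0// ltr1n.
have := archi_boundP z0; set T := Num.bound _; rewrite ltr_pdivrMr// => HT.
exists (2 ^ T)%N; first by rewrite expn_gt0.
set K := (2 ^ T)%N => N KN.
have K0 : (0 < K)%N by rewrite expn_gt0.
have N0 : (0 < N)%N by apply: leq_trans KN.
have v0 : (0 < N %/ K)%N by rewrite divn_gt0.
have KN' : (0 < K <= N)%N by rewrite K0.
have Kr := natr_gt0 R K0; have Nr := natr_gt0 R N0.
have H1 := HC N N0; have H2 := HC _ v0.
have lKE : ln K%:R = T%:R * ln 2 :> R by rewrite /K natrX lnXn ?ltr0n// mulr_natl.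
have /andP[L0 L1] := ln_divn R KN'.
rewrite ln_div ?posrE// in L0.
have : \sum_(1 <= n < N.+1) coprime_ind R 1 n * Lam n / n%:R =
   \sum_(1 <= n < (N %/ K).+1) coprime_ind R 1 n * Lam n / n%:R +
   \sum_((N %/ K).+1 <= n < N.+1) Lam n / n%:R.
  rewrite (@big_cat_nat _ _ _ (N %/ K).+1 1 N.+1)//= ?ltnS ?leq_div//; congr (_ + _).
  by apply: eq_bigr => n _; rewrite /coprime_ind coprime1n mul1r.
move: H1 H2; set A := \sum_(1 <= n < N.+1) _; set B := \sum_(1 <= n < _) _ => H1 H2 ABE.
have : 1 <= \sum_((N %/ K).+1 <= n < N.+1) Lam n / n%:R.
  have -> : \sum_((N %/ K).+1 <= n < N.+1) Lam n / n%:R = A - B by rewrite ABE addrAC subrr add0r.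
  by move: H1 H2; rewrite !ler_norml => /andP[? ?] /andP[? ?]; lra.
have H3 : \sum_((N %/ K).+1 <= n < N.+1) Lam n / n%:R <= K%:R / N%:R * psi R N.
  apply: (@le_trans _ _ (\sum_((N %/ K).+1 <= n < N.+1) K%:R / N%:R * Lam n)).
    apply: ler_sum_nat => n /andP[nv nN].
    have nr : 0 < n%:R :> R by rewrite ltr0n; apply: leq_trans nv.
    rewrite mulrC ler_wpM2r ?mangoldt_ge0// -invf_div lef_pV2 ?posrE ?divr_gt0//.
    by rewrite ler_pdivrMr// -natrM ler_nat ltnW// -ltn_divLR.
  rewrite -mulr_sumr ler_wpM2l ?divr_ge0//.
  rewrite /psi [leRHS](@big_cat_nat _ _ _ (N %/ K).+1 1 N.+1)//= ?ltnS ?leq_div//.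
  by rewrite lerDr sumr_ge0// => n _; exact: mangoldt_ge0.
move=> H4; have := le_trans H4 H3; rewrite mulrAC ler_pdivlMr// mul1r.
by rewrite ler_pdivrMr// mulrC.
Qed.

Lemma sqrt_ln_o (eps : R) : 0 < eps -> exists2 N0, (0 < N0)%N &
  forall N, (N0 <= N)%N -> Num.sqrt N%:R * ln N%:R <= eps * N%:R.
Proof.
move=> e0; have z0 : 0 <= 16 / eps ^+ 2 by rewrite divr_ge0 ?sqr_ge0.
have := archi_boundP z0; set T := Num.bound _; rewrite ltr_pdivrMr ?exprn_gt0// => HT.
exists (T ^ 2).+1 => // N NT.
have N0 : (0 < N)%N by apply: leq_trans NT.
have N1 := natr_ge1 R N0; have l0 := lnn_ge0 R N.
have s0 : 0 <= Num.sqrt N%:R :> R by exact: sqrtr_ge0.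
have sE : Num.sqrt N%:R ^+ 2 = N%:R :> R by rewrite sqr_sqrtr.
have sT : T%:R <= Num.sqrt N%:R :> R.
  rewrite -(ler_pXn2r (ltn0Sn 1)) ?nnegrE// sE -natrX ler_nat ltnW//.
have := ln_sqrt_bound N1; move: s0 sE sT; set s := Num.sqrt _; set l := ln _ in l0 * => s0 sE sT H.
rewrite -sE expr2 mulrA [_ * s]mulrC ler_wpM2l//.
have e2 : 0 <= eps ^+ 2 by rewrite sqr_ge0.
have : T%:R * eps ^+ 2 <= s * eps ^+ 2 by rewrite ler_wpM2r.
move=> H1; have H2 : 16 * s <= (s * eps ^+ 2) * s by rewrite ler_wpM2r//; lra.
rewrite -(ler_pXn2r (ltn0Sn 1)) ?nnegrE// ?mulr_ge0// ?ltW//.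
by rewrite exprMn; nra.
Qed.

Lemma prime_count_ln_ge : exists2 c : R, 0 < c & exists2 N0, (0 < N0)%N &
  forall N, (N0 <= N)%N -> c * N%:R <= Pi N * ln N%:R.
Proof.
have [K K0 HK] := psi_ge; have Kr := natr_gt0 R K0.
have c0 : 0 < (2 * K%:R)^-1 :> R by rewrite invr_gt0 mulr_gt0.
have [N1 N10 HN1] := sqrt_ln_o c0.
exists (2 * K%:R)^-1 => //; exists (maxn K N1); first by rewrite leq_max K0.
move=> N; rewrite geq_max => /andP[KN NN].
have N0 : (0 < N)%N by apply: leq_trans KN.
have H1 := HK N KN; have H2 := HN1 N NN.
have := psi_prime_part N; have := sum_mangoldt_nonprime R N0.
have : \sum_(1 <= p < N.+1 | prime p) ln p%:R <= Pi N * ln N%:R.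
  rewrite /Pi mulr_suml [leLHS]big_nat_cond [leRHS]big_nat_cond.
  apply: ler_sum => p /andP[/andP[p0 pN] _]; rewrite mul1r lnn_le//.
have E : N%:R / K%:R = (2 * K%:R)^-1 * N%:R + (2 * K%:R)^-1 * N%:R :> R.
  by field; rewrite gt_eqF.
lra.
Qed.

Lemma prime_count_unbounded (M : R) : exists2 N0, (1 < N0)%N &
  forall N, (N0 <= N)%N -> M <= Pi N.
Proof.
have [c c0 [N1 N10 HN1]] := prime_count_ln_ge.
have e0 : 0 < c / (`|M| + 1) by rewrite divr_gt0// ltr_wpDl.
have [N2 N20 HN2] := sqrt_ln_o e0.
exists (maxn 2 (maxn N1 N2)); first by rewrite leq_max.
move=> N; rewrite !geq_max => /and3P[N21 NN1 NN2].
have l0 : 0 < ln N%:R :> R by rewrite ln_gt0// ltr1n.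
have s1 : 1 <= Num.sqrt N%:R :> R.
  by rewrite -[leLHS]sqrtr1 ler_sqrt// ler1n ltnW.
have H1 := HN1 N NN1; have H2 := HN2 N NN2.
have H3 : (`|M| + 1) * (Num.sqrt N%:R * ln N%:R) <= c * N%:R.
  move: H2; rewrite mulrAC ler_pdivlMr 1?mulrC//; exact: ltr_wpDl.
rewrite -(ler_pM2r l0); apply: le_trans H1; apply: le_trans H3.
have := ler_norm M => HM; have M0 : 0 <= `|M| by [].
have : (`|M| + 1) * (1 * ln N%:R) <= (`|M| + 1) * (Num.sqrt N%:R * ln N%:R).
  rewrite ler_wpM2l ?addr_ge0// ler_wpM2r ?(ltW l0)//.
have : M * ln N%:R <= (`|M| + 1) * ln N%:R by rewrite ler_wpM2r ?(ltW l0)//; lra.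
lra.
Qed.

(** The primes up to [N / K] contribute [O(N ln K / K)]. Beyond, each term is at most [ln K], and
    [prime_count_ln_le] leaves [O(N / ln N)] of them. *)
Lemma sum_prime_ln_quot_o (eps : R) : 0 < eps -> exists2 N0, (0 < N0)%N &
  forall N, (N0 <= N)%N ->
  \sum_(1 <= p < N.+1 | prime p) ln (N%:R / p%:R) <= eps * N%:R.
Proof.
move=> e0; have z0 : 0 <= 4 / eps by rewrite divr_ge0 ?(ltW e0).
have := archi_boundP z0; set J := Num.bound _; rewrite ltr_pdivrMr// => HJ.
have J0 : (0 < J)%N.
  by case: J HJ => // HJ; rewrite mul0r in HJ; have : (0 : R) < 4 := ltr0n R 4; lra.
have Jr := natr_gt0 R J0.
pose K := (J ^ 2)%N; have K0 : (0 < K)%N by rewrite expn_gt0 J0.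
have Kr := natr_gt0 R K0; have lK := lnn_ge0 R K.
have l2 : 0 < ln 2 :> R by rewrite ln_gt0// ltr1n.
have w0 : 0 <= 18 * ln K%:R / eps / ln 2 by rewrite !divr_ge0 ?mulr_ge0 ?(ltW e0) ?(ltW l2).
have := archi_boundP w0; set T := Num.bound _; rewrite ltr_pdivrMr// ltr_pdivrMr// => HT.
exists (2 ^ T.+1)%N; first by rewrite expn_gt0.
move=> N NT; have N0 : (0 < N)%N by apply: leq_trans NT; rewrite expn_gt0.
have Nr := natr_gt0 R N0.
have lN : T.+1%:R * ln 2 <= ln N%:R :> R.
  by rewrite mulr_natl -lnXn// -natrX; apply: lnn_le.
have lNp : 0 < ln N%:R :> R by apply: lt_le_trans lN; rewrite mulr_gt0.
pose v := (N %/ K)%N; pose V : R := N%:R / K%:R.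
have vV : v%:R <= V by rewrite ler_pdivlMr// -natrM ler_nat leq_divM.
have vN : (v <= N)%N by exact: leq_div.
rewrite (@big_cat_nat _ _ _ v.+1 1 N.+1)//=.
have V0 : 0 < V by rewrite divr_gt0.
have P1 : \sum_(1 <= p < v.+1 | prime p) ln (N%:R / p%:R) <= V * (1 + ln K%:R).
  apply: (@le_trans _ _ (\sum_(1 <= p < v.+1) (ln K%:R + ln (V / p%:R)))).
    rewrite big_mkcond/= [leLHS]big_nat [leRHS]big_nat; apply: ler_sum => p /andP[p0 pv].
    have pr := natr_gt0 R p0.
    have E : ln (N%:R / p%:R) = ln K%:R + ln (V / p%:R) :> R.
      rewrite -lnM ?posrE ?divr_gt0//; congr ln; rewrite /V; field.
      by rewrite !gt_eqF.
    case: ifP => _; first by rewrite E.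
    by rewrite -E ln_quot_ge0// p0 (leq_trans _ vN).
  rewrite big_split/= sumr_const_nat subn1/= -[_ *+ v]mulr_natl.
  have := sum_ln_div vV; have : v%:R * ln K%:R <= V * ln K%:R by rewrite ler_wpM2r.
  lra.
have P2 : \sum_(v.+1 <= p < N.+1 | prime p) ln (N%:R / p%:R) <= Pi N * ln K%:R.
  rewrite /Pi mulr_suml [leRHS](@big_cat_nat _ _ _ v.+1 1 N.+1)//= -[leLHS]add0r.
  apply: lerD; first by apply: sumr_ge0 => p _; rewrite mul1r.
  rewrite [leLHS]big_nat_cond [leRHS]big_nat_cond; apply: ler_sum => p /andP[/andP[pv pN] _].
  have p0 : (0 < p)%N by apply: leq_trans pv.
  have pr := natr_gt0 R p0.
  rewrite mul1r ler_ln ?posrE ?divr_gt0// ler_pdivrMr// -natrM ler_nat ltnW//.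
  by rewrite mulnC -ltn_divLR.
have P3 := prime_count_ln_le N0.
have lJ := ln_le_sub1 Jr.
have H1 : V * (1 + ln K%:R) <= eps * N%:R / 2.
  have lKE : ln K%:R = 2 * ln J%:R :> R by rewrite /K natrX lnXn//; ring.
  have KE : K%:R = J%:R * J%:R :> R by rewrite /K natrX expr2.
  have JJ : J%:R * 4 <= J%:R * (J%:R * eps) by rewrite ler_pM2l// ltW.
  have : N%:R * (1 + ln K%:R) <= N%:R * (eps / 2 * K%:R) by rewrite ler_pM2l// lKE KE; lra.
  by move=> ?; rewrite /V [leLHS]mulrAC ler_pdivrMr//; lra.
have H2 : Pi N * ln K%:R <= eps * N%:R / 2.
  rewrite -(ler_pM2r lNp).
  have : Pi N * ln N%:R * ln K%:R <= 9 * N%:R * ln K%:R by rewrite ler_wpM2r.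
  have H : 18 * ln K%:R <= eps * ln N%:R.
    have : T%:R * ln 2 * eps <= T.+1%:R * ln 2 * eps.
      by rewrite ler_pM2r// ler_pM2r// ler_nat.
    have : T.+1%:R * ln 2 * eps <= ln N%:R * eps by rewrite ler_pM2r.
    lra.
  have : N%:R * (18 * ln K%:R) <= N%:R * (eps * ln N%:R) by rewrite ler_pM2l.
  lra.
by lra.
Qed.

Variable q : nat.
Hypothesis q_gt0 : (0 < q)%N.
Local Notation cop := (@coprime_ind R q).
Local Notation ph := ((totient q)%:R : R).
Local Notation e_ := (class_ind R q).

Definition class_count a N : R := \sum_(1 <= p < N.+1 | prime p) e_ a p.

Lemma class_count_diff_o (eps : R) : 0 < eps -> exists2 N0, (0 < N0)%N &
  forall a b N, (N0 <= N)%N -> coprime q a -> coprime q b ->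
  `|class_count a N - class_count b N| <= eps * Pi N.
Proof.
move=> e0; have [c c0 [N1 N10 HN1]] := prime_count_ln_ge.
have d0 : 0 < eps * c / 3 by rewrite divr_gt0// mulr_gt0.
have [N2 HN2] := psi_class_diff_o q_gt0 d0.
have [N3 N30 HN3] := sqrt_ln_o d0; have [N4 N40 HN4] := sum_prime_ln_quot_o d0.
exists (maxn 2 (maxn (maxn N1 N2) (maxn N3 N4))); first by rewrite leq_max.
move=> a b N; rewrite !geq_max => /and3P[N21 /andP[NN1 NN2] /andP[NN3 NN4]] aq bq.
have N0 : (0 < N)%N by apply: ltnW.
have Nr := natr_gt0 R N0.
have l0 : 0 < ln N%:R :> R by rewrite ln_gt0// ltr1n.
rewrite -(ler_pM2r l0) -{1}(gtr0_norm l0) -normrM.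
have H1 := HN1 N NN1; have H2 := HN2 a b N NN2 aq bq; have H3 := HN3 N NN3; have H4 := HN4 N NN4.
pose g := class_diff R q a b.
have -> : (class_count a N - class_count b N) * ln N%:R =
   (psi_of g N - \sum_(1 <= n < N.+1 | ~~ prime n) Lam n * g n) +
   \sum_(1 <= p < N.+1 | prime p) g p * ln (N%:R / p%:R).
  rewrite /class_count -sumrB mulr_suml (prime_sum_split g); congr (_ + _).
  have -> : psi_of g N = \sum_(1 <= p < N.+1 | prime p) Lam p * g p +
     \sum_(1 <= n < N.+1 | ~~ prime n) Lam n * g n by rewrite /psi_of (bigID prime).
  by rewrite addrK; apply: eq_bigr => p pp; rewrite mangoldt_prime// mulrC.
have gb n : `|g n| <= 1 by exact: class_diff_le1.
have A1 : `|\sum_(1 <= n < N.+1 | ~~ prime n) Lam n * g n| <= eps * c / 3 * N%:R.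
  apply: le_trans H3; apply: le_trans (sum_mangoldt_nonprime R N0).
  apply: le_trans (ler_norm_sum _ _ _) _; apply: ler_sum => n _.
  by rewrite normrM (ger0_norm (mangoldt_ge0 _ _)) ler_piMr// mangoldt_ge0.
have A2 : `|\sum_(1 <= p < N.+1 | prime p) g p * ln (N%:R / p%:R)| <= eps * c / 3 * N%:R.
  apply: le_trans H4; apply: le_trans (ler_norm_sum _ _ _) _.
  rewrite [leLHS]big_nat_cond [leRHS]big_nat_cond; apply: ler_sum => p /andP[pN _].
  have := ln_quot_ge0 pN => lp; rewrite normrM (ger0_norm lp) ler_piMl//.
apply: le_trans (ler_normD _ _) _; apply: le_trans (lerD (ler_normB _ _) (lexx _)) _.
have : eps * (c * N%:R) <= eps * (Pi N * ln N%:R) by rewrite ler_pM2l.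
lra.
Qed.

Lemma sum_class_ind n : \sum_(0 <= b < q | coprime q b) e_ b n = cop n.
Proof.
rewrite big_mkcond (bigD1_seq (n %% q)%N) ?iota_uniq//=; last first.
  by rewrite mem_index_iota ltn_mod.
rewrite {1}/class_ind modn_mod eqxx coprime_modr big_seq_cond big1 ?addr0.
  by rewrite /coprime_ind; case: coprime.
move=> b /andP[]; rewrite mem_index_iota => /andP[_ bq] bn.
by rewrite /class_ind (modn_small bq) eq_sym (negbTE bn); case: ifP.
Qed.

Lemma sum_not_coprime N : \sum_(1 <= p < N.+1 | prime p) (1 - cop p) <= q%:R.
Proof.
have -> : \sum_(1 <= p < N.+1 | prime p) (1 - cop p) =
  \sum_(1 <= p < N.+1 | prime p && ~~ coprime q p) 1.
  rewrite big_mkcondr; apply: eq_bigr => p _; rewrite /coprime_ind.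
  by case: coprime; rewrite ?subrr ?subr0.
rewrite big_const_seq iter_addr_0 ler_nat -size_filter -[X in (_ <= X)%N](size_iota 1).
apply: uniq_leq_size; first by rewrite filter_uniq// iota_uniq.
move=> p; rewrite mem_filter mem_index_iota => /andP[/andP[pp npq] /andP[p0 _]].
rewrite mem_iota p0 add1n ltnS dvdn_leq//.
by move: npq; rewrite coprime_sym prime_coprime// negbK.
Qed.

Lemma class_count_not_coprime a N : ~~ coprime q a -> 0 <= class_count a N <= q%:R.
Proof.
move=> aq; rewrite sumr_ge0/=; last by move=> p _; rewrite /class_ind.
apply: le_trans (sum_not_coprime N); apply: ler_sum => p _.
rewrite /class_ind /coprime_ind; case: eqP => [pa|_] /=; last first.
  by case: coprime; rewrite ?subrr ?subr0.
by rewrite -coprime_modr pa coprime_modr (negbTE aq) subr0.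
Qed.

(** [class_count_diff_o] is summed over all coprime [b]: the counts in these classes add up to all
    primes except those dividing [q], of which there are at most [q]. *)
Lemma class_count_o (eps : R) : 0 < eps -> exists2 N0, (0 < N0)%N &
  forall a N, (N0 <= N)%N -> coprime q a -> `|class_count a N - Pi N / ph| <= eps * Pi N.
Proof.
move=> e0; have p0 := totientr_gt0 R q_gt0.
have p1 : 1 <= ph by rewrite ler1n totient_gt0.
have e20 : 0 < eps / 2 by rewrite divr_gt0.
have [N1 N10 HN1] := class_count_diff_o e20.
have [N2 N20 HN2] := prime_count_unbounded (2 * q%:R / eps).
exists (maxn N1 N2); first by rewrite leq_max N10.
move=> a N; rewrite geq_max => /andP[NN1 NN2] aq.
have HP := HN2 N NN2; rewrite ler_pdivrMr// in HP.
have P0 := prime_count_ge0 N.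
have E : ph * class_count a N - Pi N =
   \sum_(0 <= b < q) cop b * (class_count a N - class_count b N) -
   \sum_(1 <= p < N.+1 | prime p) (1 - cop p).
  rewrite sumrB -/(Pi N); under eq_bigr do rewrite mulrBr.
  rewrite sumrB -mulr_suml -/(total q cop) total_coprime_ind.
  have -> : \sum_(0 <= b < q) cop b * class_count b N = \sum_(1 <= p < N.+1 | prime p) cop p.
    under [RHS]eq_bigr do rewrite -sum_class_ind.
    rewrite exchange_big/= [RHS]big_mkcond; apply: eq_bigr => b _.
    by rewrite /coprime_ind; case: coprime; rewrite ?mul1r ?mul0r.
  by ring.
have H1 : `|\sum_(0 <= b < q) cop b * (class_count a N - class_count b N)| <= ph * (eps / 2 * Pi N).
  rewrite -(total_coprime_ind R q) /total mulr_suml.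
  apply: le_trans (ler_norm_sum _ _ _) _; apply: ler_sum => b _.
  rewrite /coprime_ind; case: (boolP (coprime q b)) => bq; last by rewrite !mul0r normr0.
  by rewrite !mul1r HN1.
have H2 := sum_not_coprime N.
have H3 : 0 <= \sum_(1 <= p < N.+1 | prime p) (1 - cop p).
  apply: sumr_ge0 => p _; have := coprime_ind_le1 R q p; rewrite ler_norml => /andP[]; lra.
rewrite -(ler_pM2l p0) -{1}(gtr0_norm p0) -normrM mulrBr.
have -> : ph * (Pi N / ph) = Pi N by rewrite mulrC divfK// gt_eqF.
rewrite E; apply: le_trans (ler_normB _ _) _; rewrite [X in _ + X]ger0_norm//.
have : 1 * (eps * Pi N) <= ph * (eps * Pi N) by rewrite ler_wpM2r// mulr_ge0// ltW.
lra.
Qed.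

Lemma prime_count_nat N : Pi N = (count prime (iota 0 N.+1))%:R.
Proof.
rewrite /Pi -[iota 0 N.+1]/(0%N :: iota 1 N) /= add0n.
by rewrite big_const_seq iter_addr_0 /index_iota subn1.
Qed.

Theorem prime_average_periodic F (eps : R) : periodic q F -> 0 < eps ->
  exists N0, forall N, (N0 <= N)%N ->
  `|(\sum_(0 <= p < N | prime p) F p) / (count prime (iota 0 N.+1))%:R -
    (\sum_(0 <= a < q | coprime q a) F a) / ph| <= eps.
Proof.
move=> Fp e0; have [b b0 Fb] := periodic_bounded q_gt0 Fp.
have qr := natr_gt0 R q_gt0.
have p0 := totientr_gt0 R q_gt0.
have qb : 0 < 2 * (q%:R * b + 1) by rewrite mulr_gt0// ltr_wpDl// mulr_ge0// ltW.
have d0 : 0 < eps / (2 * (q%:R * b + 1)) by rewrite divr_gt0.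
have [N1 N10 HN1] := class_count_o d0.
have [N2 N20 HN2] := prime_count_unbounded (1 + 2 * (q%:R * (b * q%:R) + b) / eps).
exists (maxn N1 N2) => N; rewrite geq_max => /andP[NN1 NN2].
have HP := HN2 N NN2; rewrite -prime_count_nat.
have w0 : 0 <= 2 * (q%:R * (b * q%:R) + b) / eps.
  by rewrite divr_ge0 ?(ltW e0)// mulr_ge0// addr_ge0// !mulr_ge0.
have P0 : 0 < Pi N by lra.
have HP' : 2 * (q%:R * (b * q%:R) + b) <= eps * Pi N.
  by rewrite [eps * _]mulrC -ler_pdivrMr//; lra.
set t := (\sum_(0 <= a < q | coprime q a) F a) / ph.
have -> : (\sum_(0 <= p < N | prime p) F p) / Pi N - t =
  (\sum_(0 <= p < N | prime p) F p - t * Pi N) / Pi N.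
  by rewrite mulrBl mulfK// gt_eqF.
rewrite normrM normfV (gtr0_norm P0) ler_pdivrMr//.
have FE n : F n = \sum_(0 <= r < q) F r * e_ r n.
  exact: class_expansion.
have S1 : \sum_(1 <= p < N.+1 | prime p) F p = \sum_(0 <= r < q) F r * class_count r N.
  under eq_bigr do rewrite FE.
  by rewrite exchange_big/=; apply: eq_bigr => r _; rewrite mulr_sumr.
(* The sum runs over [p < N] but is divided by the number of primes up to [N]: one boundary term, at
   most [b]. *)
have S2 : `|\sum_(0 <= p < N | prime p) F p - \sum_(1 <= p < N.+1 | prime p) F p| <= b.
  have -> : \sum_(1 <= p < N.+1 | prime p) F p = \sum_(0 <= p < N.+1 | prime p) F p.
    by rewrite [RHS]big_ltn_cond.
  rewrite big_mkcond [X in _ - X]big_mkcond big_nat_recr//= opprD addrA subrr add0r normrN.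
  by case: ifP; rewrite ?normr0.
have S3 : `|\sum_(1 <= p < N.+1 | prime p) F p - t * Pi N| <=
   q%:R * (b * (eps / (2 * (q%:R * b + 1)) * Pi N) + b * q%:R).
  rewrite S1 /t -mulrA mulr_suml [X in _ - X]big_mkcond -sumrB.
  apply: le_trans (ler_norm_sum _ _ _) _.
  have -> : q%:R * (b * (eps / (2 * (q%:R * b + 1)) * Pi N) + b * q%:R) =
    \sum_(0 <= r < q) (b * (eps / (2 * (q%:R * b + 1)) * Pi N) + b * q%:R).
    by rewrite sumr_const_nat subn0 mulr_natl.
  apply: ler_sum => r _; case: ifPn => rq.
    rewrite -mulrBr normrM; apply: (@le_trans _ _ (b * (eps / (2 * (q%:R * b + 1)) * Pi N))).
      by rewrite ler_pM//; have := HN1 r N NN1 rq; rewrite [ph^-1 * _]mulrC.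
    by rewrite lerDl mulr_ge0.
  rewrite subr0 normrM; apply: (@le_trans _ _ (b * q%:R)).
    by rewrite ler_pM//; have /andP[? ?] := class_count_not_coprime N rq; rewrite ger0_norm.
  by rewrite lerDr mulr_ge0// mulr_ge0 ?(ltW d0) ?(ltW P0).
have S4 : q%:R * (b * (eps / (2 * (q%:R * b + 1)) * Pi N)) <= eps * Pi N / 2.
  have -> : q%:R * (b * (eps / (2 * (q%:R * b + 1)) * Pi N)) =
    (q%:R * b) / (q%:R * b + 1) * (eps * Pi N / 2).
    by field; rewrite gt_eqF// ltr_wpDl// mulr_ge0// ltW.
  rewrite ler_piMl//; first by rewrite divr_ge0// mulr_ge0 ?(ltW e0) ?(ltW P0).
  by rewrite ler_pdivrMr ?ltr_wpDl ?mulr_ge0 ?(ltW qr)//; lra.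
move: S2 S3; rewrite !ler_norml => /andP[? ?] /andP[? ?].
by apply/andP; split; lra.
Qed.

End PrimeAverages.

(** * Averages along primes in a subshift over an odometer *)

Section Dynamics.
Variables (R : realType) (A : finType).
Local Notation FS := (full_shift A).
Local Notation S := (@left_shift A).
Implicit Types (x y z : full_shift A) (X : set (full_shift A)).

Definition agree (k : nat) x y := forall i : int, (`|i| <= k)%N -> x i = y i.

Lemma agree_trans k x y z : agree k x y -> agree k y z -> agree k x z.
Proof. by move=> xy yz i ik; rewrite xy// yz. Qed.

Lemma coordinate_nbhs x (i : int) : nbhs x [set y : FS | y i = x i].
Proof.
have := @proj_continuous int (fun=> discrete_topology A) i x [set x i].
by apply; exact: discrete_set1.
Qed.

Lemma agree_nbhs x k : nbhs x [set y : FS | agree k y x].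
Proof.
have H m : nbhs x [set y : FS | forall j : nat, (j < m)%N -> y j%:Z = x j%:Z /\ y (- j%:Z) = x (- j%:Z)].
  elim: m => [|m IH]; first by apply: filterS (filterT : nbhs x setT) => y _ j.
  apply: filterS (filterI (filterI (coordinate_nbhs x m%:Z) (coordinate_nbhs x (- m%:Z))) IH) => y [[/= y1 y2] y3] j; rewrite ltnS leq_eqVlt => /orP[/eqP ->//|].
  exact: y3.
apply: filterS (H k.+1) => y /= Hy i ik.
case: (intP i) ik => [|m|m] ik; first by have [] := Hy 0%N isT.
  by have [] := Hy m.+1 ik.
by rewrite abszN in ik; have [_] := Hy m.+1 ik.
Qed.

(** The supersets of the sets [agree k y x] form a filter. It converges to [x], since in a product
    single coordinates suffice and coordinate [i] is fixed by the window of radius [|i|]. *)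
Lemma nbhs_agree x (U : set FS) : nbhs x U -> exists k, [set y | agree k y x] `<=` U.
Proof.
pose F : set_system FS := [set V | exists k, [set y | agree k y x] `<=` V].
have FF : Filter F.
  split.
  - by exists 0%N.
  - move=> V W [k kV] [l lW]; exists (maxn k l) => y yx; split.
      by apply: kV => i ik; apply: yx; rewrite leq_max ik.
    by apply: lW => i ik; apply: yx; rewrite leq_max ik orbT.
  - by move=> V W VW [k kV]; exists k => y /kV /VW.
suff : F --> x by apply.
apply/cvg_sup => i W [_ [[B Bop <-] Bx sBW]].
exists `|i|%N => y yx; apply: sBW; rewrite /= /preimage/=.
by rewrite yx.
Qed.

Lemma full_shift_compact : compact [set: FS].
Proof.
have := @tychonoff int (fun=> discrete_topology A) (fun=> setT).
have -> : [set f : FS | forall i : int, [set: discrete_topology A] (f i)] = setT.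
  by apply/seteqP; split.
apply => i; apply: finite_compact; exact: (@finite_finset A).
Qed.

(** A cluster point given by compactness, phrased by arbitrarily late agreements so that no
    subsequence has to be extracted. *)
Lemma sequence_accumulation X (u : nat -> FS) : closed X -> (forall m, X (u m)) ->
  exists2 x, X x & forall k k0, exists2 m, (k0 <= m)%N & agree k (u m) x.
Proof.
move=> Xcl uX; have Xco : compact X.
  by apply: subclosed_compact full_shift_compact _.
have uX' : (u @ \oo) X by exists 0%N => // m _; exact: uX.
have [x [Xx xcl]] := Xco (u @ \oo) _ uX'.
exists x => // k k0.
have : (u @ \oo) [set u m | m in [set m | (k0 <= m)%N]].
  by exists k0 => // m /= k0m; exists m.
move=> /xcl/(_ (agree_nbhs x k))[_ [[m /= k0m <-] umx]].
by exists m.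
Qed.

(** This is continuity of [g] on [X], with windows as a basis of neighbourhoods. *)
Definition locally_constant_upto X (g : FS -> R) := forall x (e : R), X x -> 0 < e ->
  exists k, forall z, X z -> agree k z x -> `|g z - g x| <= e.

Lemma uniform_continuity X (g : FS -> R) (e : R) : closed X ->
  locally_constant_upto X g -> 0 < e ->
  exists k, forall y z, X y -> X z -> agree k y z -> `|g y - g z| <= e.
Proof.
move=> Xcl gX e0; apply: contrapT => nk.
have /choice[u Hu] : forall k, exists yz : FS * FS,
    [/\ X yz.1, X yz.2, agree k yz.1 yz.2 & e < `|g yz.1 - g yz.2|].
  move=> k; apply: contrapT => nyz; apply: nk; exists k => y z Xy Xz yz.
  by rewrite leNgt; apply/negP => H; apply: nyz; exists (y, z).
have [x Xx xP] := @sequence_accumulation X (fun m => (u m).1) Xcl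
  (fun m => let: And4 H _ _ _ := Hu m in H).
have [k kP] := gX x (e / 2) Xx (divr_gt0 e0 (ltr0n R 2)).
have [m km umx] := xP k k; have [X1 X2 a12 big] := Hu m.
have a21 : agree k (u m).2 x.
  by apply: agree_trans umx; move=> i ik; rewrite a12// (leq_trans ik).
have := kP _ X1 umx; have := kP _ X2 a21.
have := ler_distD (g x) (g (u m).1) (g (u m).2).
rewrite [`|g x - g (u m).2|]distrC; lra.
Qed.

Lemma bounded_on X (g : FS -> R) : closed X -> locally_constant_upto X g ->
  exists2 B : R, 0 <= B & forall x, X x -> `|g x| <= B.
Proof.
move=> Xcl gX; apply: contrapT => nB.
have /choice[u Hu] : forall m : nat, exists y : FS, X y /\ m%:R < `|g y|.
  move=> m; apply: contrapT => ny; apply: nB; exists m%:R => // y Xy.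
  by rewrite leNgt; apply/negP => H; apply: ny; exists y.
have [x Xx xP] := @sequence_accumulation X u Xcl (fun m => (Hu m).1).
have [k kP] := gX x 1 Xx ltr01.
have [m km umx] := xP k (Num.bound (`|g x| + 1)).
have [Xu big] := Hu m; have := kP _ Xu umx.
have : `|g x| + 1 < m%:R.
  apply: lt_le_trans (archi_boundP _) _; first by rewrite addr_ge0.
  by rewrite ler_nat.
have := ler_normD (g (u m) - g x) (g x); rewrite subrK; lra.
Qed.

(** * Windows, the metric and diameters *)

Section Distance.
Local Notation d := (@shift_dist A R).

Let S_ y z : set R := [set (`|n|%N)%:R | n in [set n : int | y n <> z n]].

Lemma diff_lbound y z : lbound (S_ y z) 0.
Proof. by move=> _ [n _ <-]. Qed.

Lemma diff_nonempty y z : y <> z -> S_ y z !=set0.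
Proof.
move=> yz; apply: contrapT => H; apply: yz; apply/funext => n.
by apply: contrapT => yzn; apply: H; exists (`|n|%N)%:R; exists n.
Qed.

Lemma shift_dist_ge0 y z : 0 <= d y z.
Proof. by rewrite /shift_dist; case: ifP => // _; exact: powR_ge0. Qed.

Lemma shift_dist_le1 y z : d y z <= 1.
Proof.
rewrite /shift_dist; case: asboolP => // yz.
rewrite -[leRHS](powRr0 2) ler_powR ?ler1n// oppr_le0.
by apply: lb_le_inf; [exact: diff_nonempty|exact: diff_lbound].
Qed.

Lemma shift_dist_agree m y z : d y z < 2 `^ (- m%:R) -> agree m y z.
Proof.
rewrite /shift_dist; case: asboolP => [->//|yz].
move=> H i im; apply: contrapT => yzi; move: H; apply/negP; rewrite -leNgt.
rewrite ler_powR ?ler1n// lerN2; apply: (@le_trans _ _ (`|i|%N)%:R); last by rewrite ler_nat.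
by apply: ge_inf; [exists 0; exact: diff_lbound|exists i].
Qed.

Lemma diam_has_sup (E : set FS) y : E y -> has_sup [set d yz.1 yz.2 | yz in E `*` E].
Proof.
move=> Ey; split; first by exists (d y y); exists (y, y).
by exists 1 => _ [yz _ <-]; exact: shift_dist_le1.
Qed.

Lemma shift_dist_diam (E : set FS) y z : E y -> E z -> d y z <= diam d E.
Proof.
move=> Ey Ez; apply: sup_upper_bound; first exact: diam_has_sup Ey.
by exists (y, z).
Qed.

Lemma diam_ge0 (E : set FS) : 0 <= diam d E.
Proof.
have [[y Ey]|nE] := pselect (E !=set0).
  by apply: le_trans (shift_dist_diam Ey Ey); exact: shift_dist_ge0.
(* An empty set has diameter 0, the default value of [sup]. *)
rewrite /diam (_ : [set _ | _ in _] = set0) ?sup0//.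
by apply/seteqP; split=> // r [[y z] [Ey _] _]; case: nE; exists y.
Qed.

End Distance.

(** * Prime averages along the tower *)

Section Tower.
Variables (X : set FS) (n : nat -> nat) (pi : FS -> odometer_space).
Hypothesis n_gt0 : forall t, (0 < n t)%N.
Hypothesis X_sub : is_subsystem S X.
Hypothesis pi_onto : pi @` X = odometer n.
Hypothesis pi_shift : forall x, X x -> pi (S x) = odometer_map n (pi x).

Lemma iter_shift_in y p : X y -> X (iter p S y).
Proof.
by move=> Xy; elim: p => [|p IH] //=; case: X_sub => _ <-; exists (iter p S y).
Qed.

Lemma pi_lt y t : X y -> (pi y t < n t)%N.
Proof.
move=> Xy; have : odometer n (pi y) by rewrite -pi_onto; exists y.
by case/(_ t).
Qed.

Lemma pi_iter y t p : X y -> pi (iter p S y) t = ((pi y t + p) %% n t)%N.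
Proof.
move=> Xy; elim: p => [|p IH]; first by rewrite addn0 modn_small// pi_lt.
rewrite iterS pi_shift; last exact: iter_shift_in.
by rewrite /odometer_map IH modnDml addn1 addnS.
Qed.

(** The weak inequality leaves [diam < 2 ^ - m] for the other levels, the strict form that
    [shift_dist_agree] requires. *)
Definition wide_level (m t j : nat) : R :=
  ((2 : R) `^ (- m%:R) <= diam (@shift_dist A R) (tower_level n X pi t j))%R%:R.

Lemma wide_level_ge0 m t j : 0 <= wide_level m t j.
Proof. exact: ler0n. Qed.

(** Markov's inequality for the diameters. *)
Lemma sum_wide_level m t : \sum_(0 <= j < n t) wide_level m t j <= 2 `^ m%:R * tower_diam n X pi R t.
Proof.
rewrite mulr_sumr; apply: ler_sum => j _; rewrite /wide_level; case: (leP _ (diam _ _)) => H.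
  rewrite -ler_pdivrMl ?powR_gt0// mulr1; apply: le_trans H.
  by rewrite powRN.
by rewrite mulr_ge0 ?powR_ge0// diam_ge0.
Qed.

Lemma sum_shift_mod (q c : nat) (w : nat -> R) :
  \sum_(0 <= a < q) w ((c + a) %% q)%N = \sum_(0 <= a < q) w a.
Proof.
case: q => [|q]; first by rewrite !big_geq.
elim: c => [|c IH].
  by apply: eq_big_nat => a /andP[_ aq]; rewrite add0n modn_small.
rewrite -IH [RHS]big_nat_recl//= [LHS]big_nat_recr//= addrC addn0 addSnnS modnDr.
by congr (_ + _); apply: eq_bigr => a _; rewrite addSnnS.
Qed.

(* [g (iter p S y)] is replaced by a function of [p] modulo [n t]; the error is
   small unless [iter p S y] lies in one of the few wide tower levels. *)
Lemma prime_average_near (g : FS -> R) y (eps : R) :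
  locally_constant_upto X g -> X y -> 0 < eps ->
  (fun t => tower_diam n X pi R t / (totient (n t))%:R) @ \oo --> (0 : R) ->
  exists (L : R) N0, forall N, (N0 <= N)%N ->
    `|(\sum_(0 <= p < N | prime p) g (iter p S y)) / (prime_counting N)%:R - L| <= eps.
Proof.
move=> gX Xy e0 small; have Xcl := X_sub.1.
have e8 : 0 < eps / 8 by rewrite divr_gt0.
have [m mP] := uniform_continuity Xcl gX e8.
have [B B0 BP] := bounded_on Xcl gX.
have B1 : 0 < 2 * B + 1 by rewrite ltr_wpDl// mulr_ge0.
have m0 : 0 < 2 `^ m%:R * (2 * B + 1) :> R by rewrite mulr_gt0// powR_gt0.
(* The limiting frequency of wide levels along primes is at most [2 ^ m delta / phi]. The choice of
   [t] makes its product with [2 B + 1], which bounds the error on such a level, at most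
   [eps / 8]. *)
have [t tP] : exists t, tower_diam n X pi R t / (totient (n t))%:R <=
    eps / 8 / (2 `^ m%:R * (2 * B + 1)).
  have /cvgrPdist_le/(_ _ (divr_gt0 e8 m0))[t _ tP] := small.
  by exists t; have := tP t (leqnn t); rewrite sub0r normrN; apply: le_trans; exact: ler_norm.
set q := n t in tP; pose c : nat := pi y t.
pose F p := g (iter (p %% q) S y); pose b p := wide_level m t ((c + p) %% q).
have Fp : periodic q F by move=> p; rewrite /F modn_mod.
have bp : periodic q b by move=> p; rewrite /b modnDmr.
have e4 : 0 < eps / 4 by rewrite divr_gt0.
have e4B : 0 < eps / 4 / (2 * B + 1) by rewrite divr_gt0.
have [N1 HN1] := prime_average_periodic (n_gt0 t) Fp e4.
have [N2 HN2] := prime_average_periodic (n_gt0 t) bp e4B.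
set LF := (_ / _) in HN1; set Lb := (_ / _) in HN2.
have near p : `|g (iter p S y) - F p| <= eps / 8 + (2 * B + 1) * b p.
  have lvl r : (c + r = c + p %[mod q])%N -> tower_level n X pi t ((c + p) %% q) (iter r S y).
    move=> E; have Xr := iter_shift_in r Xy; split=> //; split; last by rewrite /= pi_iter.
    by rewrite -pi_onto; exists (iter r S y).
  have Xp := iter_shift_in p Xy; have Xp' := iter_shift_in (p %% q) Xy.
  rewrite /b /wide_level; case: (leP _ (diam _ _)) => H.
    have := ler_normB (g (iter p S y)) (F p); have := BP _ Xp; have := BP _ Xp'.
    rewrite -/(F p) mulr1n mulr1; move: e8; lra.
  rewrite mulr0n mulr0 addr0; apply: mP => //; apply: shift_dist_agree.
  apply: le_lt_trans H; apply: shift_dist_diam; apply: lvl => //.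
  by rewrite modnDmr.
have Lb_le : (2 * B + 1) * Lb <= eps / 8.
  (* Omitting the condition [coprime q a] only enlarges the sum, and the starting level [c] only
     rotates it; the divisor stays [totient q]. *)
  have bS : \sum_(0 <= a < q | coprime q a) b a <= 2 `^ m%:R * tower_diam n X pi R t.
    apply: le_trans (sum_wide_level m t); rewrite -(sum_shift_mod q c) big_mkcond/=.
    by apply: ler_sum => a _; case: ifP => // _; exact: wide_level_ge0.
  rewrite mulrC -ler_pdivlMr// /Lb; apply: le_trans (_ : _ <= 2 `^ m%:R *
    (tower_diam n X pi R t / (totient q)%:R)) _; first by rewrite mulrA ler_wpM2r.
  by rewrite -ler_pdivlMl ?powR_gt0//; apply: le_trans tP _; rewrite invfM mulrA mulrAC mulrC.
exists LF, (maxn N1 N2) => N; rewrite geq_max => /andP[NN1 NN2].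
have := HN1 N NN1; have := HN2 N NN2; rewrite -/(prime_counting N).
set P : R := (prime_counting N)%:R => A2 A1.
have P0 : 0 <= P by exact: ler0n.
have one : (\sum_(0 <= p < N | prime p) (1 : R)) / P <= 1.
  have : \sum_(0 <= p < N | prime p) (1 : R) <= P.
    rewrite big_const_seq iter_addr_0 ler_nat /prime_counting -addn1 iotaD count_cat.
    by rewrite /index_iota subn0 leq_addr.
  have [P1|P1] := ltrP 0 P; first by rewrite ler_pdivrMr// mul1r.
  by have -> : P = 0 by [apply/eqP; rewrite eq_le P1]; rewrite invr0 mulr0.
have diff : `|(\sum_(0 <= p < N | prime p) g (iter p S y)) / P -
              (\sum_(0 <= p < N | prime p) F p) / P| <=
    eps / 8 * ((\sum_(0 <= p < N | prime p) (1 : R)) / P) +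
    (2 * B + 1) * ((\sum_(0 <= p < N | prime p) b p) / P).
  rewrite -mulrBl -sumrB normrM [`|P^-1|]ger0_norm ?invr_ge0// !mulrA -mulrDl.
  rewrite ler_wpM2r ?invr_ge0//; apply: le_trans (ler_norm_sum _ _ _) _.
  by rewrite !mulr_sumr -big_split/=; apply: ler_sum => p _; rewrite mulr1.
have : eps / 8 * ((\sum_(0 <= p < N | prime p) (1 : R)) / P) <= eps / 8.
  by rewrite ler_piMr// ltW.
have : (2 * B + 1) * ((\sum_(0 <= p < N | prime p) b p) / P) <= eps / 8 + eps / 4.
  have /(ler_wpM2l (ltW B1)) : (\sum_(0 <= p < N | prime p) b p) / P <= Lb + eps / 4 / (2 * B + 1).
    by move: A2; rewrite ler_norml => /andP[_]; rewrite lerBlDl addrC.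
  have -> : (2 * B + 1) * (Lb + eps / 4 / (2 * B + 1)) = (2 * B + 1) * Lb + eps / 4.
    by rewrite mulrDr; congr (_ + _); rewrite mulrC divfK// gt_eqF.
  by move: Lb_le; lra.
move: diff A1; rewrite !ler_norml => /andP[? ?] /andP[? ?] ? ?.
by apply/andP; split; lra.
Qed.

(** The number [L] of [prime_average_near] varies with the precision, through [t]. Being eventually
    close to some number for every precision is exactly the Cauchy property, and completeness of [R]
    supplies the limit. *)
Lemma prime_average_cvg (g : FS -> R) y :
  locally_constant_upto X g -> X y ->
  (fun t => tower_diam n X pi R t / (totient (n t))%:R) @ \oo --> (0 : R) ->
  exists L : R, (fun N : nat =>
    (\sum_(0 <= p < N | prime p) g (iter p S y)) / (prime_counting N)%:R) @ \oo --> L.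
Proof.
move=> gX Xy small; apply/cvg_ex/cauchy_cvgP/cauchy_exP => e e0.
have e2 : 0 < e / 2 by rewrite divr_gt0.
have [L [N0 HN]] := prime_average_near gX Xy e2 small.
exists L, N0 => // N /= NN0; rewrite /ball/= distrC.
by apply: le_lt_trans (HN N NN0) _; rewrite ltr_pdivrMr// mulr_natr mulr2n ltrDl.
Qed.

End Tower.

(** * Reduction to real and imaginary parts *)

Section ComplexValued.
Variable X : set FS.
(* [R[i]] gets its topology from its [numFieldType] structure. *)
Local Notation C := (R[i] : numFieldType).

Lemma continuous_agree (K : numFieldType) (f : FS -> K) x (e : K) :
  {within X, continuous f} -> X x -> 0 < e ->
  exists k, forall z, X z -> agree k z x -> `|f z - f x| <= e.
Proof.
move=> /subspace_continuousP/(_ x) fx Xx e0.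
have /cvgrPdist_le/(_ e e0) := fx Xx.
rewrite /prop_near1 /nbhs/= => /nbhs_agree[k kP].
by exists k => z Xz zx; rewrite distrC; exact: kP.
Qed.

Lemma norm_Re_le (z : R[i]) (e : R) : `|z| <= e%:C%C -> `|complex.Re z| <= e.
Proof. by move=> ze; rewrite -lecR (le_trans (normc_ge_Re z)). Qed.

Lemma norm_le_Re_Im (z : R[i]) : `|z| <= (`|complex.Re z| + `|complex.Im z|)%:C%C.
Proof.
rewrite normc_def lecR -[leRHS]ger0_norm ?addr_ge0// -sqrtr_sqr ler_wsqrtr//.
rewrite sqrrD !real_normK ?num_real// -addrA lerD2l lerDr.
by rewrite mulrn_wge0// mulr_ge0.
Qed.

Lemma norm_Im_le (z : R[i]) (e : R) : `|z| <= e%:C%C -> `|complex.Im z| <= e.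
Proof.
move=> ze; rewrite -normrN -ReiNIm; apply: norm_Re_le.
by rewrite normrM [`|'i%C|]normc_def/= expr0n expr1n add0r sqrtr1 mulr1.
Qed.

Lemma locally_constant_Re_Im (f : FS -> C) : {within X, continuous f} ->
  locally_constant_upto X (fun x => complex.Re (f x)) /\
  locally_constant_upto X (fun x => complex.Im (f x)).
Proof.
move=> fX; split=> x e Xx e0; have e0' : 0 < e%:C%C by rewrite ltcR.
all: have [k kP] := continuous_agree fX Xx e0'; exists k => z Xz zx; have := kP z Xz zx.
  by move=> /norm_Re_le; rewrite raddfB.
by move=> /norm_Im_le; rewrite raddfB.
Qed.

Lemma cvgn_complex (u : nat -> C) (a b : R) :
  (fun N => complex.Re (u N)) @ \oo --> a -> (fun N => complex.Im (u N)) @ \oo --> b ->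
  cvgn u.
Proof.
move=> ua ub; apply/cvg_ex; exists (a +i* b)%C; apply/cvgrPdist_le => e e0.
(* A positive element of [R[i]] is real, so precision may be measured in [R]. *)
have [r r0 re] : exists2 r : R, 0 < r & e = r%:C%C.
  by exists (complex.Re e); rewrite -?ltcR RRe_real// gtr0_real.
have r2 : 0 < r / 2 by rewrite divr_gt0.
move/cvgrPdist_le/(_ _ r2) : ua => ua; move/cvgrPdist_le/(_ _ r2) : ub => ub.
near=> N; rewrite re; apply: le_trans (norm_le_Re_Im _) _; rewrite lecR.
have h1 : `|a - complex.Re (u N)| <= r / 2 by near: N.
have h2 : `|b - complex.Im (u N)| <= r / 2 by near: N.
by rewrite !raddfB/= (splitr r) lerD.
Unshelve. all: by end_near.
Qed.

Lemma Re_div_nat (z : R[i]) k : complex.Re (z / k%:R) = complex.Re z / k%:R.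
Proof.
rewrite -(rmorph_nat (@real_complex R)) -fmorphV; case: z => x y /=.
by rewrite mulr0 subr0.
Qed.

Lemma Im_div_nat (z : R[i]) k : complex.Im (z / k%:R) = complex.Im z / k%:R.
Proof.
rewrite -(rmorph_nat (@real_complex R)) -fmorphV; case: z => x y /=.
by rewrite mulr0 add0r.
Qed.

End ComplexValued.

End Dynamics.

Theorem theoremB (R : realType) (A : finType) (X : set (full_shift A))
    (n : nat -> nat) (pi : full_shift A -> odometer_space)
    (n_gt0 : forall t, (0 < n t)%N)
    (n_dvd : forall t, (n t %| n t.+1)%N)
    (X_min : minimal_subsystem (@left_shift A) X)
    (pi_ext : almost_1_1_extension (@left_shift A) X
                (odometer_map n) (odometer n) pi)
    (delta_small :
       (fun t : nat => tower_diam n X pi R t / (totient (n t))%:R) @ \oo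
         --> (0 : R)) :
  satisfies_PNT R[i] (@left_shift A) X.
Proof.
move=> y f Xy fX; have [X_sub _ _] := X_min.
have [_ pi_onto pi_shift _] := pi_ext.
have [fRe fIm] := locally_constant_Re_Im fX.
have [a aP] := prime_average_cvg n_gt0 X_sub pi_onto pi_shift fRe Xy delta_small.
have [b bP] := prime_average_cvg n_gt0 X_sub pi_onto pi_shift fIm Xy delta_small.
apply: (@cvgn_complex _ _ a b).
  under eq_fun do rewrite Re_div_nat raddf_sum; exact: aP.
under eq_fun do rewrite Im_div_nat raddf_sum; exact: bP.
Qed.
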